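(* Let $B=(B_s)_{s\ge 0}$ be a standard Brownian motion and, for $\delta>0$, define \[ F(\delta)=\mathbb{P}\Big(\sup_{t\ge 0}\Big|\int_0^1 e^{-st}\,dB_s\Big|\le \delta\Big). \] Then for $\delta\in(0,1/4)$, \[ \log F(\delta)=-\frac{2}{3\pi^2}\log^3(1/\delta)+o\big(\log^3(1/\delta)\big), \] where the $o(\cdot)$ is as $\delta\downarrow 0$.
   Context: The process $t\mapsto \int_0^1 e^{-st}\,dB_s$ (Wiener integrals), $t\ge 0$, is taken in its version with continuous sample paths. All logarithms are natural, and $\log^3 x=(\log x)^3$. *)

(* Defs.v *)
From HB Require Import structures.
From mathcomp Require Export all_boot all_order all_algebra.
From mathcomp Require Export all_classical all_reals all_analysis.
Export Order.TTheory GRing.Theory Num.Theory.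
Export numFieldNormedType.Exports.

Set Implicit Arguments.
Unset Strict Implicit.
Unset Printing Implicit Defensive.

#[global] Open Scope classical_set_scope.
#[global] Open Scope ring_scope.

(* Subfamilies need no separate clause: take [A i = setT] outside of them. *)
Definition mutually_independent (R : realType) (d : measure_display)
    (T : measurableType d) (P : probability T R) (I : finType)
    (X : I -> T -> R) : Prop :=
  forall A : I -> set R, (forall i, measurable (A i)) ->
    P [set w | forall i, A i (X i w)]
    = (\prod_(i : I) P [set w | A i (X i w)])%E.

(* Only the times [0 <= t] are meaningful; the values at negative times are
   unconstrained. The second parameter of [normal_prob] is the standard
   deviation, not the variance. *)
Definition standard_brownian_motion (R : realType) (d : measure_display)
    (T : measurableType d) (P : probability T R)
    (B : R -> {RV P >-> R}) : Prop :=
  [/\ {ae P, forall w, B 0 w = 0},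
      {ae P, forall w, {within `[0, +oo[, continuous (fun t => B t w)}},
      forall s t : R, 0 <= s -> s < t ->
        forall A : set R, measurable A ->
          pushforward P (B t \- B s) A = normal_prob 0 (Num.sqrt (t - s)) A
    & forall (n : nat) (t : nat -> R), 0 <= t 0%N ->
        {homo t : i j / (i <= j)%N >-> i <= j} ->
        mutually_independent P (fun i : 'I_n => B (t i.+1) \- B (t i))].

(* A step function is coded by a list of triples [(u, v, c)], standing for the
   sum of the functions [c * \1_(]u, v])]; the intervals may overlap. *)
Definition step_in (R : realType) (a b : R) (p : seq (R * R * R)) : bool :=
  all (fun q => [&& a <= q.1.1, q.1.1 <= q.1.2 & q.1.2 <= b]) p.

Definition step_fun (R : realType) (p : seq (R * R * R)) (x : R) : R :=
  \sum_(q <- p) q.2 * \1_(`]q.1.1, q.1.2]) x.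

Definition step_integral (R : realType) (T : Type) (B : R -> T -> R)
    (p : seq (R * R * R)) (w : T) : R :=
  \sum_(q <- p) q.2 * (B q.1.2 w - B q.1.1 w).

(* [X] is (a version of) the Wiener integral of [f] over [[a, b]] with respect
   to [B]: the L^2(P) limit of the integrals of step functions that converge
   to [f] in L^2([a, b]). By the Ito isometry the limit does not depend on the
   approximating sequence. *)
Definition is_wiener_integral (R : realType) (d : measure_display)
    (T : measurableType d) (P : probability T R) (B : R -> {RV P >-> R})
    (a b : R) (f : R -> R) (X : {RV P >-> R}) : Prop :=
  measurable_fun `[a, b] f /\
  exists p : nat -> seq (R * R * R),
    [/\ forall n, step_in a b (p n),
        (\int[lebesgue_measure]_(s in `[a, b])
           ((step_fun (p n) s - f s) ^+ 2)%:E)%E @[n --> \oo] --> 0%E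
      & ('E_P[fun w =>
            ((step_integral (fun t => B t) (p n) w - X w) ^+ 2)%R])%E
           @[n --> \oo] --> 0%E].

(* [X t] is the integral of [e^(-st)] in [s] over [[0, 1]], for every
   [t >= 0], and all the sample paths of [X] are continuous on [[0, +oo[]. *)
Definition laplace_wiener_process (R : realType) (d : measure_display)
    (T : measurableType d) (P : probability T R)
    (B X : R -> {RV P >-> R}) : Prop :=
  (forall t : R, 0 <= t ->
     is_wiener_integral B 0 1 (fun s => expR (- (s * t))) (X t)) /\
  (forall w : T, {within `[0, +oo[, continuous (fun t => X t w)}).

Definition small_ball_prob (R : realType) (d : measure_display)
    (T : measurableType d) (P : probability T R)
    (X : R -> {RV P >-> R}) (delta : R) : \bar R :=
  P [set w | (ereal_sup [set `|X t w|%:E | t in `[0%R, +oo[]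
              <= delta%:E)%E].

(* Main.v *)
(** Slab probabilities of a Gaussian vector are controlled by its Gram-Schmidt
    residuals. If [l_i] is the distance of the i-th entry from the span of the
    previous ones, then [P (|X_i| <= delta, i < n) <= \prod_i (C delta / l_i)];
    conversely, forcing the Gram-Schmidt coordinates into [[-e_j, e_j]] gives
    at least [\prod_j gauss [-e_j, e_j]] as soon as every entry has
    [\sum_j r_j e_j <= delta], [r_j] being its residual after [j] steps. With
    [[0, 1]] extended to [[0, +oo[] (harmless at large frequencies) the Gram
    matrix of [X] is the Cauchy kernel [1 / (s + t)], whose residuals are the
    products of [|t - t_l| / (t + t_l)], up to [1 / sqrt (2 t)]. In the variable
    [x = ln t] these factors are [tanh (|x - x_l| / 2)], and
    [- ln (tanh (|x| / 2))] has integral [pi^2 / 2] over the line.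

    With [L = ln (1 / delta)], the upper bound takes
    [x_k = 2 L - sqrt 2 pi sqrt k] for [k] up to about [2 L^2 / pi^2], so that
    the sum of [- ln (tanh (|x_i - x_l| / 2))] over [l < i] is close to half
    the integral divided by the local spacing. The lower bound uses batches of
    equally spaced points: the J-th one covers frequencies up to [e^(p h (J+1))],
    beyond which [1 / sqrt t] is small enough, and divides the residuals by [e^q],
    so [e_j] may grow by nearly that factor from one batch to the next and about
    [L / q] batches are needed. Both computations give [2 / (3 pi^2)]. *)
From HB Require Import structures.
From mathcomp Require Import measurable_realfun ring lra zify.
Require Import Defs.
Set Implicit Arguments.
Unset Strict Implicit.
Unset Printing Implicit Defensive.

(** * Gaussian vectors *)

Local Open Scope ereal_scope.

(** [X t] is given only as an L^2 limit of step integrals, so no joint Gaussian law is assumed. The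
    Gaussian work is done on Riemann sums of mesh [1 / N], whose rows act on iid normalized
    increments; passing to [X] costs an additive [C / N] in probability and a doubling of [delta].
    Gram-Schmidt is realized by plane rotations of the iid vector, which reduces everything to
    rotation invariance of the planar Gaussian law. On the grid the Cauchy kernel becomes a
    geometric series, a Szego kernel in the variables [expR (- (t / N))]. Its residuals are
    dominated by the Cauchy ones, which serves the lower bound at fixed [N]; the upper bound lets
    [N] tend to infinity instead. The lower bound needs one constant for all finite sets of tested
    frequencies. On a grid of [N] cells all [N] Gaussian coordinates must be confined, hence batches
    without end, the late ones so wide that they cost little whatever their number. Constant factors
    per frequency are harmless: only about [L^2] frequencies count, against the scale [L^3]. *)

Lemma lebesgue_measure_translate (R : realType) (a : R) (A : set R) :
  measurable A ->
  pushforward lebesgue_measure (fun x : R => (x + a)%R : measurableTypeR R) A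
  = lebesgue_measure A.
Proof.
move=> mA; apply/esym/lebesgue_measure_unique => //=.
  by move=> ?; exact: measurable_funD.
move=> _ _ [[u v]] uv <-; rewrite /pushforward.
have -> : (fun x => (x + a)%R) @^-1` `]u, v]%classic = `](u - a)%R, (v - a)%R]%classic.
  by apply/seteqP; split => x /=; rewrite !in_itv/= ltrBlDr lerBrDr.
rewrite !lebesgue_measure_itv/= !lte_fin ltrD2r.
case: ifPn => // _; rewrite -!EFinD; congr EFin; ring.
Qed.

Lemma ge0_integral_translate (R : realType) (a : R) (f : R -> \bar R) :
  measurable_fun setT f -> (forall x, 0 <= f x) ->
  \int[lebesgue_measure]_x f (x + a)%R = \int[lebesgue_measure]_x f x.
Proof.
move=> mf f0.
transitivity (\int[pushforward lebesgue_measure (fun x : R => (x + a)%R : measurableTypeR R)]_x f x).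
  rewrite ge0_integral_pushforward//; exact: measurable_funD.
apply: eq_measure_integral => [|mfa A mA _]; first exact: measurable_funD.
exact: lebesgue_measure_translate.
Qed.

Lemma lebesgue_tonelli (R : realType) (F : R * R -> \bar R) :
  measurable_fun setT F -> (forall z, 0 <= F z) ->
  \int[lebesgue_measure]_x \int[lebesgue_measure]_y F (x, y) =
  \int[lebesgue_measure]_y \int[lebesgue_measure]_x F (x, y).
Proof.
exact: (@fubini_tonelli _ _ _ _ R lebesgue_measure lebesgue_measure F).
Qed.

Lemma integral2_shear1 (R : realType) (a : R) (F : R * R -> \bar R) :
  measurable_fun setT F -> (forall z, 0 <= F z) ->
  \int[lebesgue_measure]_x \int[lebesgue_measure]_y F ((x + a * y)%R, y) =
  \int[lebesgue_measure]_x \int[lebesgue_measure]_y F (x, y).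
Proof.
move=> mF F0.
pose G (z : R * R) := F ((z.1 + a * z.2)%R, z.2).
have mG : measurable_fun setT G.
  apply: measurableT_comp => //; apply/measurable_fun_pairP; split => /=.
    by apply: measurable_funD => //; exact: measurable_funM.
  exact: measurable_snd.
transitivity (\int[lebesgue_measure]_y \int[lebesgue_measure]_x G (x, y)).
  exact: (lebesgue_tonelli mG (fun z => F0 _)).
transitivity (\int[lebesgue_measure]_y \int[lebesgue_measure]_x F (x, y)); last first.
  exact/esym/(lebesgue_tonelli mF F0).
apply: eq_integral => y _; rewrite /G/=.
apply: (@ge0_integral_translate R (a * y)%R (fun x => F (x, y))) => //.
exact: measurableT_comp.
Qed.

Lemma integral2_shear2 (R : realType) (a : R) (F : R * R -> \bar R) :
  measurable_fun setT F -> (forall z, 0 <= F z) ->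
  \int[lebesgue_measure]_x \int[lebesgue_measure]_y F (x, (y + a * x)%R) =
  \int[lebesgue_measure]_x \int[lebesgue_measure]_y F (x, y).
Proof.
move=> mF F0.
apply: eq_integral => x _.
apply: (@ge0_integral_translate R (a * x)%R (fun y => F (x, y))) => //.
exact: measurableT_comp.
Qed.

(** The change of variables is available for the Radon-Nikodym derivative of [normal_prob]; it
    equals [normal_pdf] almost everywhere because both have the same integral over every measurable
    set. *)
Lemma ge0_integral_normal_prob (R : realType) (m s : R) (f : R -> \bar R) :
  measurable_fun setT f -> (forall x, 0 <= f x) ->
  \int[normal_prob m s]_x f x =
  \int[lebesgue_measure]_x (f x * (normal_pdf m s x)%:E).
Proof.
move=> mf f0.
have dom : normal_prob m s `<< (@lebesgue_measure R) by exact: normal_prob_dominates.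
rewrite -(Radon_Nikodym_SigmaFinite.change_of_variables dom)//.
have fint := Radon_Nikodym_SigmaFinite.f_integrable dom.
have pint := @integrable_normal_pdf R m s.
apply: ae_eq_integral => //.
- by apply: emeasurable_funM => //; exact: (measurable_int _ fint).
- by apply: emeasurable_funM => //; exact: (measurable_int _ pint).
apply: ae_eqe_mul2l.
apply: integral_ae_eq => //; first exact: (measurable_int _ pint).
by move=> E _ mE; rewrite -Radon_Nikodym_SigmaFinite.f_integral.
Qed.

(** A rotation is a product of three shears, each of them a translation of one coordinate with the
    other held fixed. The outer slope [(1 - c) / s] is the tangent of half the angle, hence the
    condition [s != 0]. *)
Lemma integral2_rotate (R : realType) (c s : R) (F : R * R -> \bar R) :
  (c ^+ 2 + s ^+ 2 = 1)%R -> s != 0%R ->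
  measurable_fun setT F -> (forall z, 0 <= F z) ->
  \int[lebesgue_measure]_x \int[lebesgue_measure]_y
     F ((c * x + s * y)%R, (- s * x + c * y)%R) =
  \int[lebesgue_measure]_x \int[lebesgue_measure]_y F (x, y).
Proof.
move=> cs s0 mF F0; pose a := ((1 - c) / s)%R.
pose F1 (z : R * R) := F ((z.1 + a * z.2)%R, z.2).
pose F2 (z : R * R) := F1 (z.1, (z.2 + (- s) * z.1)%R).
have mF1 : measurable_fun setT F1.
  apply: measurableT_comp => //; apply/measurable_fun_pairP; split => /=.
    by apply: measurable_funD => //; exact: measurable_funM.
  exact: measurable_snd.
have mF2 : measurable_fun setT F2.
  apply: measurableT_comp => //; apply/measurable_fun_pairP; split => /=.
    exact: measurable_fst.
  by apply: measurable_funD => //; exact: measurable_funM.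
transitivity (\int[lebesgue_measure]_x \int[lebesgue_measure]_y F2 ((x + a * y)%R, y)); last first.
  apply: (etrans (integral2_shear1 a mF2 (fun z => F0 _))).
  apply: (etrans (integral2_shear2 (- s)%R mF1 (fun z => F0 _))).
  exact: (integral2_shear1 a mF F0).
apply: eq_integral => x _; apply: eq_integral => y _; rewrite /F2 /F1 /=.
have ca : (a * s = 1 - c)%R by rewrite /a divfK.
have ac : (a * (1 + c) = s)%R.
  by rewrite /a mulrAC -subr_sqr expr1n -cs addrAC subrr add0r expr2 mulfK.
congr (F (_, _)).
- rewrite mulrDr mulrDr; rewrite -{1}ac.
  transitivity ((1 - a * s) * x + a * (2 - a * s) * y)%R; last ring.
  by rewrite ca; congr (_ + _ * _)%R; ring.
- transitivity (- s * x + (1 - a * s) * y)%R; last ring.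
  by rewrite ca; congr (_ + _ * _)%R; ring.
Qed.

Definition gauss (R : realType) (A : set R) : \bar R := normal_prob 0 1 A.

Section gauss_probability.
Variable R : realType.

Let gauss0 : @gauss R set0 = 0. Proof. exact: measure0. Qed.

Let gauss_ge0 A : 0 <= @gauss R A. Proof. exact: measure_ge0. Qed.

Let gauss_sigma_additive : semi_sigma_additive (@gauss R).
Proof. exact: (@measure_semi_sigma_additive _ _ _ (@normal_prob R 0 1)). Qed.

HB.instance Definition _ := isMeasure.Build _ _ R (@gauss R)
  gauss0 gauss_ge0 gauss_sigma_additive.

Let gaussT : @gauss R setT = 1.
Proof. exact: (@probability_setT _ _ _ (@normal_prob R 0 1)). Qed.

HB.instance Definition _ := Measure_isProbability.Build _ _ R (@gauss R) gaussT.

End gauss_probability.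

Lemma ge0_integral_gauss (R : realType) (f : R -> \bar R) :
  measurable_fun setT f -> (forall x, 0 <= f x) ->
  \int[@gauss R]_x f x =
  \int[lebesgue_measure]_x (f x * (normal_pdf 0 1 x)%:E).
Proof.
move=> mf f0; rewrite -ge0_integral_normal_prob//.
have mid : measurable_fun setT (id : measurableTypeR R -> R) by [].
transitivity (\int[pushforward (@normal_prob R 0 1) (id : measurableTypeR R -> R)]_x f x).
  exact: eq_measure_integral.
exact: ge0_integral_pushforward.
Qed.

Lemma gauss_prod (R : realType) (C : set (R * R)) : measurable C ->
  (@gauss R \x @gauss R) C =
  \int[lebesgue_measure]_x \int[lebesgue_measure]_y
    ((\1_C (x, y) * (normal_pdf 0 1 x * normal_pdf 0 1 y))%R)%:E.
Proof.
move=> mC.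
have mpdf : measurable_fun setT (@normal_pdf R 0 1) by exact: measurable_normal_pdf.
have mI : measurable_fun setT (fun z : R * R => (\1_C z)%:E : \bar R).
  by apply/measurable_EFinP; exact: measurable_indic.
transitivity (\int[@gauss R \x @gauss R]_z (\1_C z)%:E).
  by rewrite (integral_indic _ measurableT mC) setIT.
rewrite fubini_tonelli1//.
rewrite ge0_integral_gauss//; last first.
- by move=> x; apply: integral_ge0 => y _; rewrite lee_fin.
- exact: measurable_fun_fubini_tonelli_F.
apply: eq_integral => x _; rewrite /fubini_F.
rewrite ge0_integral_gauss//; last first.
  exact: (measurableT_comp mI (pair1_measurable _)).
rewrite -ge0_integralZr//; last first.
- by rewrite lee_fin normal_pdf_ge0.
- by move=> y _; rewrite mule_ge0// lee_fin normal_pdf_ge0.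
- apply: emeasurable_funM; first exact: (measurableT_comp mI (pair1_measurable _)).
  exact/measurable_EFinP.
by apply: eq_integral => y _; rewrite -!EFinM; congr EFin; ring.
Qed.

(** The density of the pair depends on [x ^+ 2 + y ^+ 2] only. *)
Lemma gauss_prod_rotate (R : realType) (c s : R) (C : set (R * R)) :
  (c ^+ 2 + s ^+ 2 = 1)%R -> s != 0%R -> measurable C ->
  (@gauss R \x @gauss R)
    ((fun z => ((c * z.1 + s * z.2)%R, (- s * z.1 + c * z.2)%R)) @^-1` C)
  = (@gauss R \x @gauss R) C.
Proof.
move=> cs s0 mC.
have mpdf : measurable_fun setT (@normal_pdf R 0 1) by exact: measurable_normal_pdf.
pose rot (z : R * R) := ((c * z.1 + s * z.2)%R, (- s * z.1 + c * z.2)%R).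
have mrot : measurable_fun setT rot.
  by apply/measurable_fun_pairP; split => /=;
    apply: measurable_funD; exact: measurable_funM.
have mC' : measurable (rot @^-1` C) by rewrite -[X in measurable X]setTI; exact: mrot.
rewrite -/rot (gauss_prod mC') (gauss_prod mC).
pose F (z : R * R) :=
  ((\1_C z * (normal_pdf 0 1 z.1 * normal_pdf 0 1 z.2))%R)%:E : \bar R.
have F0 z : 0 <= F z by rewrite lee_fin !mulr_ge0 ?normal_pdf_ge0.
have mF : measurable_fun setT F.
  apply/measurable_EFinP; apply: measurable_funM; first exact: measurable_indic.
  by apply: measurable_funM; apply: measurableT_comp.
apply: (etrans _ (integral2_rotate cs s0 mF F0)).
apply: eq_integral => x _; apply: eq_integral => y _; rewrite /F /=.
congr (_ * _)%:E.
rewrite !normal_pdfE ?oner_eq0// /normal_fun mulrACA -expRD [RHS]mulrACA -expRD.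
congr (_ * expR _)%R.
rewrite !subr0 -!mulrDl -!opprD; congr (- _ * _)%R.
transitivity ((c ^+ 2 + s ^+ 2) * (x ^+ 2 + y ^+ 2))%R; last ring.
by rewrite cs mul1r.
Qed.

Local Close Scope ereal_scope.

Local Open Scope ereal_scope.

Lemma measure_unique_rect d1 d2 (T1 : measurableType d1) (T2 : measurableType d2)
    (R : realType) (m1 m2 : {measure set (T1 * T2) -> \bar R}) :
  m1 setT < +oo ->
  (forall A B, measurable A -> measurable B -> m1 (A `*` B) = m2 (A `*` B)) ->
  forall X, measurable X -> m1 X = m2 X.
Proof.
move=> fin12 m12 X mX.
pose G : set (set (T1 * T2)) :=
  [set C | exists A, measurable A /\ exists B, measurable B /\ C = A `*` B].
apply: (measure_unique G (fun=> setT)) => //.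
- rewrite measurable_prod_measurableType //; congr (<<s _ >>).
  rewrite predeqE; split => [[A mA [B mB <-]]|[A [mA [B [mB ->]]]]].
    by exists A; split => //; exists B.
  by exists A => //; exists B.
- move=> _ _ [X1 [mX1 [X2 [mX2 ->]]]] [Y1 [mY1 [Y2 [mY2 ->]]]].
  rewrite -setXI; exists (X1 `&` Y1); split; first exact: measurableI.
  by exists (X2 `&` Y2); split => //; exact: measurableI.
- by move=> _; exists setT; split => //; exists setT; split => //; rewrite setXTT.
- by rewrite bigcup_const//; exists 0%N.
- by move=> A [A1 [mA1 [A2 [mA2 ->]]]]; exact: m12.
Qed.

Definition iid_gauss (R : realType) (d : measure_display) (T : measurableType d)
    (P : probability T R) (I : finType) (xi : I -> T -> R) : Prop :=
  (forall i, measurable_fun setT (xi i)) /\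
  forall A : I -> set R, (forall i, measurable (A i)) ->
    P [set w | forall i, A i (xi i w)] = \prod_(i : I) gauss (A i).

Lemma measurable_forall_preimage (R : realType) (d : measure_display)
    (T : measurableType d) (I : finType) (xi : I -> T -> R) (A : I -> set R) :
  (forall i, measurable_fun setT (xi i)) -> (forall i, measurable (A i)) ->
  measurable [set w | forall i, A i (xi i w)].
Proof.
move=> mxi mA.
have -> : [set w | forall i, A i (xi i w)] =
    \bigcap_(i in [set: I]) (xi i @^-1` A i).
  by apply/seteqP; split => w /= Aw i; [move=> _|]; exact: Aw.
apply: fin_bigcap_measurable => [|i _]; first exact: finite_finset.
by rewrite -[X in measurable X]setTI; exact: mxi.
Qed.

Definition rotate_pair (R : realType) (T : Type) (I : finType) (a b : I)
    (c s : R) (xi : I -> T -> R) (i : I) (w : T) : R :=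
  if i == a then (c * xi a w + s * xi b w)%R
  else if i == b then (- s * xi a w + c * xi b w)%R else xi i w.

(** On the event [E] fixed by the other coordinates, the pair [(xi a, xi b)] has as its law [P E]
    times the planar Gaussian law: the two finite measures agree on rectangles. Planar rotation
    invariance then applies to the rectangle of [A a] and [A b]. *)
Lemma iid_gauss_rotate (R : realType) (d : measure_display)
    (T : measurableType d) (P : probability T R) (I : finType)
    (xi : I -> T -> R) (a b : I) (c s : R) :
  a != b -> (c ^+ 2 + s ^+ 2 = 1)%R -> s != 0%R ->
  iid_gauss P xi -> iid_gauss P (rotate_pair a b c s xi).
Proof.
move=> ab cs s0 [mxi Pxi]; split.
  move=> i; rewrite /rotate_pair; case: (i == a); last case: (i == b) => //;
    by apply: measurable_funD; exact: measurable_funM.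
move=> A mA.
pose E := [set w | forall i, i != a -> i != b -> A i (xi i w)].
pose A2 (X Y : set R) i := if i == a then X else if i == b then Y else A i.
have mA2 X Y : measurable X -> measurable Y -> forall i, measurable (A2 X Y i).
  by move=> mX mY i; rewrite /A2; case: ifP => // _; case: ifP.
have A2E X Y : [set w | forall i, A2 X Y i (xi i w)] =
    E `&` (xi a @^-1` X) `&` (xi b @^-1` Y).
  have ba : b == a = false by rewrite eq_sym (negbTE ab).
  apply/seteqP; split => w /=.
    move=> AX; split; [split|].
    - by move=> i /negbTE ia /negbTE ib; have := AX i; rewrite /A2 ia ib.
    - by have := AX a; rewrite /A2 eqxx.
    - by have := AX b; rewrite /A2 ba eqxx.
  move=> [[Ew Xw] Yw] i; rewrite /A2; case: ifPn => [/eqP ->//|ia].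
  by case: ifPn => [/eqP ->//|ib]; exact: Ew.
have PA2 X Y : measurable X -> measurable Y ->
    P (E `&` (xi a @^-1` X) `&` (xi b @^-1` Y)) =
    gauss X * (gauss Y * \prod_(i | (i != a) && (i != b)) gauss (A i)).
  move=> mX mY; rewrite -A2E Pxi; last exact: mA2.
  rewrite (bigD1 a)//= (bigD1 b)/=; last by rewrite eq_sym.
  rewrite /A2 eqxx eq_sym (negbTE ab) eqxx; congr (_ * (_ * _)).
  by apply: eq_bigr => i /andP[/negbTE -> /negbTE ->].
have PE : P E = \prod_(i | (i != a) && (i != b)) gauss (A i).
  have := PA2 setT setT measurableT measurableT.
  by rewrite !preimage_setT !setIT => ->; rewrite !probability_setT !mul1e.
have mE : measurable E.
  have := measurable_forall_preimage mxi (mA2 setT setT measurableT measurableT).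
  by rewrite A2E !preimage_setT !setIT.
pose z w := (xi a w, xi b w).
have mz : measurable_fun setT z by apply/measurable_fun_pairP; split; exact: mxi.
have mrotA : measurable_fun setT (fun z : R * R => ((c * z.1 + s * z.2)%R, (- s * z.1 + c * z.2)%R)).
  by apply/measurable_fun_pairP; split => /=;
    apply: measurable_funD; exact: measurable_funM.
have finPE : P E \is a fin_num by exact: fin_num_measure.
have key C : measurable C -> P (E `&` z @^-1` C) = P E * (@gauss R \x @gauss R) C.
  move=> mC.
  pose k : {nonneg R} := NngNum (fine_ge0 (measure_ge0 P E)).
  have PEk : P E = k%:num%:E by rewrite /= fineK.
  pose m1 := pushforward (mrestr P mE) z.
  transitivity (m1 C); first by rewrite /m1 /pushforward /mrestr setIC.
  rewrite PEk -/(mscale k (@gauss R \x @gauss R) C).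
  apply: measure_unique_rect => //.
  - apply: (@le_lt_trans _ _ 1); last exact: ltry.
    apply: probability_le1; apply: measurableI => //.
    by rewrite -[X in measurable X]setTI; exact: mz.
  - move=> X Y mX mY.
    rewrite -[LHS]/(P (z @^-1` (X `*` Y) `&` E)).
    rewrite -[RHS]/(k%:num%:E * (@gauss R \x @gauss R) (X `*` Y)).
    rewrite -PEk PE product_measure1E// muleC -muleA -PA2//.
    congr (P _); apply/seteqP; rewrite /z; split => w /=; tauto.
have -> : [set w | forall i, A i (rotate_pair a b c s xi i w)] =
    E `&` z @^-1` ((fun z : R * R => ((c * z.1 + s * z.2)%R, (- s * z.1 + c * z.2)%R)) @^-1` (A a `*` A b)).
  have ba : b == a = false by rewrite eq_sym (negbTE ab).
  apply/seteqP; split => w /=.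
    move=> Aw; split.
      by move=> i /negbTE ia /negbTE ib; have := Aw i; rewrite /rotate_pair ia ib.
    by split; [have := Aw a|have := Aw b]; rewrite /rotate_pair ?ba eqxx.
  move=> [Ew [Aaw Abw]] i; rewrite /rotate_pair; case: ifPn => [/eqP ->//|ia].
  by case: ifPn => [/eqP ->//|ib]; exact: Ew.
rewrite key; last first.
  rewrite -[X in measurable X]setTI; apply: mrotA => //; exact: measurableX.
rewrite gauss_prod_rotate//; last exact: measurableX.
rewrite product_measure1E// [RHS](bigD1 a)//= [X in _ = _ * X](bigD1 b)/=; last first.
  by rewrite eq_sym.
by rewrite -PE muleC muleA.
Qed.

Lemma iid_gauss_law (R : realType) (d : measure_display)
    (T : measurableType d) (P : probability T R) (I : finType)
    (xi : I -> T -> R) (i : I) (A : set R) :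
  iid_gauss P xi -> measurable A -> P (xi i @^-1` A) = gauss A.
Proof.
move=> [_ Pxi] mA; pose B k := if k == i then A else setT.
have -> : xi i @^-1` A = [set w | forall k, B k (xi k w)].
  apply/seteqP; split => w /=; first by move=> Aw k; rewrite /B; case: eqP => [->|].
  by move=> /(_ i); rewrite /B eqxx.
rewrite Pxi; last by move=> k; rewrite /B; case: ifP.
rewrite (bigD1 i)//= /B eqxx big1 ?mule1// => k /negbTE ->.
by rewrite probability_setT.
Qed.

Local Close Scope ereal_scope.

(** * Gram-Schmidt by plane rotations *)

Section triangularize.
Variables (R : realType) (d : measure_display) (T : measurableType d).
Variables (P : probability T R) (N : nat).

(** A change of orthonormal basis of the coordinates: the rows keep their values outcome by outcome,
    and the Gram clause keeps all distances between rows, from which the entries of [L] are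
    estimated later. *)
Definition same_gauss_rows (xi zeta : 'I_N -> T -> R)
    (V L : nat -> 'I_N -> R) : Prop :=
  [/\ iid_gauss P zeta,
      forall i w, \sum_k V i k * xi k w = \sum_k L i k * zeta k w &
      forall i j, \sum_k V i k * V j k = \sum_k L i k * L j k].

Let bigD2 (a b : 'I_N) (F : 'I_N -> R) : a != b ->
  \sum_k F k = F a + (F b + \sum_(k | (k != a) && (k != b)) F k).
Proof. by move=> ab; rewrite (bigD1 a)//= (bigD1 b)//= eq_sym. Qed.

(** A Givens rotation of the columns [a] and [b], with cosine and sine proportional to the two
    entries of row [i]. The last clause protects the rows cleared before. *)
Lemma eliminate_entry (xi : 'I_N -> T -> R) (V : nat -> 'I_N -> R)
    (i : nat) (a b : 'I_N) : a != b -> iid_gauss P xi ->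
  exists zeta L, [/\ same_gauss_rows xi zeta V L, L i b = 0,
    forall j k, k != a -> k != b -> L j k = V j k &
    forall j, V j a = 0 -> V j b = 0 -> L j a = 0 /\ L j b = 0].
Proof.
move=> ab iidx; have [Vib|Vib] := eqVneq (V i b) 0.
  by exists xi, V; split => //; split.
have ba : b == a = false by rewrite eq_sym (negbTE ab).
set p := V i a; set r := V i b.
pose t := Num.sqrt (p ^+ 2 + r ^+ 2).
have t2 : t ^+ 2 = p ^+ 2 + r ^+ 2 by rewrite sqr_sqrtr// addr_ge0 ?sqr_ge0.
have t0 : t != 0.
  have : t ^+ 2 != 0 by rewrite t2 paddr_eq0 ?sqr_ge0// negb_and !expf_eq0/= Vib orbT.
  by rewrite expf_eq0.
pose c := p / t; pose s := r / t.
have cs : c ^+ 2 + s ^+ 2 = 1.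
  by rewrite !expr_div_n -mulrDl -t2 divff// expf_neq0.
have s0 : s != 0 by rewrite mulf_neq0// invr_eq0.
exists (rotate_pair a b c s xi).
exists (fun j k => if k == a then c * V j a + s * V j b
  else if k == b then - s * V j a + c * V j b else V j k).
have csE x y : (c ^+ 2 + s ^+ 2) * (x * y) = x * y by rewrite cs mul1r.
split.
- split; first exact: iid_gauss_rotate.
  + move=> j w; rewrite !(bigD2 _ ab) /rotate_pair !eqxx ba.
    rewrite -[in LHS](csE (V j a)) -[in LHS](csE (V j b)).
    have -> : \sum_(k | (k != a) && (k != b)) V j k * xi k w =
      \sum_(k | (k != a) && (k != b))
      (if k == a then c * V j a + s * V j b
       else if k == b then - s * V j a + c * V j b else V j k) *
      (if k == a then c * xi a w + s * xi b w
       else if k == b then - s * xi a w + c * xi b w else xi k w).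
      by apply: eq_bigr => k /andP[/negbTE -> /negbTE ->].
    ring.
  + move=> j l; rewrite !(bigD2 _ ab) !eqxx ba.
    rewrite -[in LHS](csE (V j a)) -[in LHS](csE (V j b)).
    have -> : \sum_(k | (k != a) && (k != b)) V j k * V l k =
      \sum_(k | (k != a) && (k != b))
      (if k == a then c * V j a + s * V j b
       else if k == b then - s * V j a + c * V j b else V j k) *
      (if k == a then c * V l a + s * V l b
       else if k == b then - s * V l a + c * V l b else V l k).
      by apply: eq_bigr => k /andP[/negbTE -> /negbTE ->].
    ring.
- by rewrite ba eqxx /c /s -/p -/r; field.
- by move=> j k /negbTE -> /negbTE ->.
- by move=> j -> ->; rewrite !eqxx ba !mulr0 addr0.
Qed.

Lemma same_gauss_rows_trans xi zeta eta V L M :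
  same_gauss_rows xi zeta V L -> same_gauss_rows zeta eta L M ->
  same_gauss_rows xi eta V M.
Proof.
move=> [_ e1 e2] [iid f1 f2]; split=> // i j; [by rewrite e1 f1|by rewrite e2 f2].
Qed.

Lemma triangularize (xi : 'I_N -> T -> R) (V : nat -> 'I_N -> R) :
  iid_gauss P xi ->
  exists zeta L, same_gauss_rows xi zeta V L /\
    forall (i : nat) (k : 'I_N), (i < k)%N -> L i k = 0.
Proof.
move=> iidx.
(* Rows before [i] are cleared to the right of the diagonal, row [i] so far in the columns before
   [m]. Its entry in column [m] goes next, by a rotation of the columns [i] and [m]; all earlier
   rows already vanish in both. *)
pose tri i m (L : nat -> 'I_N -> R) := forall j (k : 'I_N), (j < k)%N ->
  ((j < i) || ((j == i) && (k < m)))%N -> L j k = 0.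
suff key i m : (i <= N)%N -> (m <= N)%N ->
    exists zeta L, same_gauss_rows xi zeta V L /\ tri i m L.
  have [//|//|zeta [L [gL tL]]] := key N N; exists zeta, L; split => // i k ik.
  by apply: tL => //; rewrite (ltn_trans ik).
elim: i m => [|i IHi] m.
  elim: m => [_ _|m IHm _ mN].
    by exists xi, V; split; [split|move=> j k _; rewrite ltn0 ltn0 andbF].
  have [//||zeta [L [gL tL]]] := IHm; first exact: ltnW.
  have [m0|m0] := posnP m.
    exists zeta, L; split => // j k jk; rewrite ltn0/= => /andP[/eqP j0].
    by rewrite m0 ltnS leqn0 => /eqP k0; rewrite j0 k0 in jk.
  pose a : 'I_N := Ordinal (leq_ltn_trans (leq0n m) mN); pose b : 'I_N := Ordinal mN.
  have ab : a != b by rewrite -val_eqE/=; lia.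
  have iidz : iid_gauss P zeta by case: gL.
  have [zeta' [L' [gL' L'0 L'e _]]] := eliminate_entry L 0 ab iidz.
  exists zeta', L'; split; first exact: same_gauss_rows_trans gL gL'.
  move=> j k jk; rewrite ltn0/= => /andP[/eqP j0]; rewrite ltnS leq_eqVlt.
  rewrite j0 in jk *; move=> /orP[/eqP km|km].
    by rewrite (_ : k = b)//; exact: val_inj.
  rewrite L'e; first by apply: tL => //; rewrite ltn0 eqxx.
    by rewrite -val_eqE/=; lia.
  by rewrite -val_eqE/=; lia.
elim: m => [iN _|m IHm iN mN].
  have [||zeta [L [gL tL]]] := IHi N => //; first exact: ltnW.
  exists zeta, L; split => // j k jk; rewrite ltn0 andbF orbF ltnS leq_eqVlt.
  move=> /orP[/eqP ji|ji]; apply: tL => //; last by rewrite ji.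
  by rewrite ji eqxx ltnn/=.
have [//||zeta [L [gL tL]]] := IHm; first exact: ltnW.
have [mi|im] := leqP m i.+1.
  exists zeta, L; split => // j k jk.
  move=> /orP[ji|/andP[/eqP ji km]]; apply: tL => //; first by rewrite ji.
  lia.
have [iN'|iN'] := leqP N i.+1; first by lia.
pose a : 'I_N := Ordinal iN'; pose b : 'I_N := Ordinal mN.
have ab : a != b by rewrite -val_eqE/= neq_ltn im.
have iidz : iid_gauss P zeta by case: gL.
have [zeta' [L' [gL' L'0 L'e L'z]]] := eliminate_entry L i.+1 ab iidz.
exists zeta', L'; split; first exact: same_gauss_rows_trans gL gL'.
move=> j k jk /orP[ji|/andP[/eqP ji km]].
  have [La Lb] : L' j a = 0 /\ L' j b = 0.
    apply: L'z; apply: tL => /=; rewrite ?ji//; lia.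
  have [->//|ka] := eqVneq k a; have [->//|kb] := eqVneq k b.
  by rewrite L'e//; apply: tL => //; rewrite ji.
subst j; have [->//|kb] := eqVneq k b.
have ka : k != a by rewrite -val_eqE/= neq_ltn jk orbT.
rewrite L'e//; apply: tL => //; rewrite eqxx ltnn/=.
by move: kb; rewrite -val_eqE/=; lia.
Qed.

End triangularize.

(** * Independence of disjoint groups of coordinates *)

Section independence.
Local Open Scope ereal_scope.
Variables (R : realType) (d : measure_display) (T : measurableType d).
Variables (P : probability T R) (I : finType) (xi : I -> T -> R).
Hypothesis iidx : iid_gauss P xi.

Let mxi i : measurable_fun setT (xi i). Proof. by case: iidx. Qed.

Definition cylinders (J : pred I) : set (set T) :=
  [set E | exists A : I -> set R, (forall i, measurable (A i)) /\
     E = [set w | forall i, J i -> A i (xi i w)]].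

Definition sigma_of (J : pred I) : set (set T) := <<s cylinders J >>.

Let restr (J : pred I) (A : I -> set R) i : set R := if J i then A i else setT.

Let m_restr (J : pred I) (A : I -> set R) : (forall i, measurable (A i)) ->
  forall i, measurable (restr J A i).
Proof. by move=> mA i; rewrite /restr; case: ifP. Qed.

Let restrE (J : pred I) (A : I -> set R) :
  [set w | forall i, J i -> A i (xi i w)] =
  [set w | forall i, restr J A i (xi i w)].
Proof.
apply/seteqP; split => w /= Aw i; first by rewrite /restr; case: ifPn => // /Aw.
by move=> Ji; have := Aw i; rewrite /restr Ji.
Qed.

Let cylinders_measurable J : cylinders J `<=` measurable.
Proof.
move=> E [A [mA ->]]; rewrite restrE; apply: measurable_forall_preimage => //.
exact: m_restr.
Qed.

Lemma sigma_of_measurable J : sigma_of J `<=` measurable.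
Proof.
apply: smallest_sub; last exact: cylinders_measurable.
exact: sigma_algebra_measurable.
Qed.

Let cylindersI J : setI_closed (cylinders J).
Proof.
move=> _ _ [A [mA ->]] [B [mB ->]]; exists (fun i => A i `&` B i); split.
  by move=> i; exact: measurableI.
apply/seteqP; split => w /=.
  by move=> [Aw Bw] i Ji; split; [exact: Aw|exact: Bw].
by move=> ABw; split => i Ji; have [] := ABw i Ji.
Qed.

Let cylindersT J : cylinders J setT.
Proof.
exists (fun=> setT); split => //; apply/seteqP; split => //.
Qed.

Let indep_cyl (J : pred I) E F : cylinders J E -> cylinders (predC J) F ->
  P (E `&` F) = P E * P F.
Proof.
move=> [A [mA ->]] [B [mB ->]].
pose AB i := if J i then A i else B i.
have -> : [set w | forall i, J i -> A i (xi i w)] `&`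
    [set w | forall i, predC J i -> B i (xi i w)] =
    [set w | forall i, AB i (xi i w)].
  apply/seteqP; split => w /=.
    move=> [Aw Bw] i; rewrite /AB; case: ifPn => Ji; first exact: Aw.
    exact: Bw.
  move=> ABw; split => i /= Ji; have := ABw i; rewrite /AB ?Ji//.
  by rewrite (negbTE Ji).
have [_ Pxi] := iidx.
rewrite Pxi; last by move=> i; rewrite /AB; case: ifP.
rewrite !restrE !Pxi; [|exact: m_restr|exact: m_restr].
rewrite -big_split/=; apply: eq_bigr => i _; rewrite /AB /restr /=.
by case: ifPn => _ /=; rewrite probability_setT ?mul1e ?mule1.
Qed.

Let indep_ext (G : set (set T)) F : setI_closed G -> G setT ->
  G `<=` measurable -> measurable F ->
  (forall E, G E -> P (E `&` F) = P E * P F) ->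
  forall E, <<s G >> E -> P (E `&` F) = P E * P F.
Proof.
move=> GI GT Gm mF GE E sGE.
have finPF : P F \is a fin_num by exact: fin_num_measure.
pose k : {nonneg R} := NngNum (fine_ge0 (measure_ge0 P F)).
have PFk : P F = k%:num%:E by rewrite /= fineK.
rewrite -[LHS]/(mrestr P mF E) PFk muleC.
rewrite -[RHS]/(mscale k P E).
apply: (g_sigma_algebra_measure_unique G _ (fun=> setT)) => //.
- by rewrite bigcup_const//; exists 0%N.
- move=> A GA; rewrite -[LHS]/(P (A `&` F)) -[RHS]/(k%:num%:E * P A).
  by rewrite GE// PFk muleC.
- move=> _; rewrite -[X in X < _]/(P (setT `&` F)).
  apply: (@le_lt_trans _ _ 1); last exact: ltry.
  by apply: probability_le1; exact: measurableI.
Qed.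

(** Both sides are finite measures in each event separately, and they agree on cylinders, which are
    closed under intersection; one event at a time is extended from the cylinders to the whole
    sigma-algebra. *)
Lemma indep_groups (J : pred I) E F : sigma_of J E -> sigma_of (predC J) F ->
  P (E `&` F) = P E * P F.
Proof.
move=> sE sF.
apply: (indep_ext (@cylindersI J) (@cylindersT J)) => //.
  exact: sigma_of_measurable sF.
move=> {sE}E cE; rewrite setIC muleC.
apply: (indep_ext (@cylindersI (predC J)) (@cylindersT _)) => //.
  exact: cylinders_measurable cE.
by move=> {sF}F cF; rewrite setIC muleC; exact: (@indep_cyl J).
Qed.

Lemma sigma_of_preimage (J : pred I) i (A : set R) : J i -> measurable A ->
  sigma_of J (xi i @^-1` A).
Proof.
move=> Ji mA; apply: sub_sigma_algebra.
exists (fun j => if j == i then A else setT); split.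
  by move=> j; case: ifP.
apply/seteqP; split => w /=.
  by move=> Aw j _; case: eqP => // ->.
by move=> /(_ i Ji); rewrite eqxx.
Qed.

Lemma sigma_of_lin (J : pred I) (c : I -> R) (A : set R) :
  (forall i, ~~ J i -> c i = 0%R) -> measurable A ->
  sigma_of J [set w | A (\sum_i c i * xi i w)%R].
Proof.
move=> c0 mA.
(* Here [T] carries the sigma-algebra generated by the coordinates in [J], so the ordinary closure
   of measurable functions under sums and products gives the claim. *)
have mf : measurable_fun setT (fun w : g_sigma_algebraType (cylinders J) => (\sum_i c i * xi i w)%R).
  apply: measurable_sum => i.
  have [Ji|Ji] := boolP (J i); last first.
    rewrite c0//; under eq_fun do rewrite mul0r.
    exact: measurable_cst.
  apply: measurable_funM; first exact: measurable_cst.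
  by move=> _ B mB; rewrite setTI; exact: sigma_of_preimage.
have := mf measurableT _ mA.
by rewrite setTI.
Qed.

Lemma sigma_of_setI J E F : sigma_of J E -> sigma_of J F -> sigma_of J (E `&` F).
Proof. by move=> sE sF; exact: (@measurableI _ (g_sigma_algebraType (cylinders J))). Qed.

Lemma sigma_of_setT J : sigma_of J setT.
Proof. exact: (@measurableT _ (g_sigma_algebraType (cylinders J))). Qed.

Lemma sigma_of_forall J n (E : nat -> set T) :
  (forall i, (i < n)%N -> sigma_of J (E i)) ->
  sigma_of J [set w | forall i, (i < n)%N -> E i w].
Proof.
elim: n => [|n IH] sE.
  by rewrite (_ : [set _ | _] = setT); [exact: sigma_of_setT|exact/seteqP].
rewrite (_ : [set _ | _] = [set w | forall i, (i < n)%N -> E i w] `&` E n).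
  by apply: sigma_of_setI; [apply: IH => i ni; apply: sE; lia|apply: sE].
apply/seteqP; split => w /=.
  by move=> Ew; split => [i ni|]; apply: Ew; lia.
move=> [Ew En] i; rewrite ltnS leq_eqVlt => /orP[/eqP ->//|]; exact: Ew.
Qed.

End independence.

Local Open Scope ereal_scope.

Lemma normal_peak1_le1 (R : realType) : (normal_peak (1 : R) <= 1)%R.
Proof.
rewrite /normal_peak invf_le1 ?sqrtr_gt0; last first.
  by rewrite expr1n mul1r mulrn_wgt0// pi_gt0.
rewrite -[X in (X <= _)%R]sqrtr1 ler_wsqrtr// expr1n mul1r mulr2n.
by have := pi_ge2 R; lra.
Qed.

Lemma gauss_itv_le (R : realType) (a b : R) : (a <= b)%R ->
  gauss `[a, b]%classic <= (b - a)%:E.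
Proof.
move=> ab; rewrite /gauss /normal_prob.
have -> : (b - a)%:E = lebesgue_measure `[a, b]%classic :> \bar R.
  rewrite lebesgue_measure_itv/= lte_fin; case: ltP => [_|ba].
    by rewrite -EFinB.
  have -> : a = b by apply/eqP; rewrite eq_le ab ba.
  by rewrite subrr.
rewrite -[leRHS]mul1e -integral_cst//.
apply: ge0_le_integral => //=.
- by move=> x _; rewrite lee_fin normal_pdf_ge0.
- by apply/measurable_EFinP; apply: measurable_funTS; exact: measurable_normal_pdf.
- by move=> x _; rewrite lee_fin (le_trans (normal_pdf_ub _ _ _))// normal_peak1_le1.
Qed.

Lemma gauss_slab_le (R : realType) (c l delta : R) : (0 <= delta)%R -> l != 0%R ->
  gauss [set z | (`|c + l * z| <= delta)%R] <= (2 * delta / `|l|)%:E.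
Proof.
move=> d0 l0; have l_gt0 : (0 < `|l|)%R by rewrite normr_gt0.
have -> : [set z | (`|c + l * z| <= delta)%R] =
    `[(- c / l - delta / `|l|)%R, (- c / l + delta / `|l|)%R]%classic.
  apply/seteqP; split => z /=; rewrite in_itv/= => h.
    suff : (`|z + c / l| <= delta / `|l|)%R.
      by rewrite ler_norml mulNr => /andP[? ?]; apply/andP; split; lra.
    rewrite ler_pdivlMr// -normrM mulrDl divfK//.
    by rewrite addrC mulrC (mulrC z) in h *.
  have : (`|z + c / l| <= delta / `|l|)%R.
    by rewrite ler_norml; move: h; rewrite mulNr => /andP[? ?]; apply/andP; split; lra.
  rewrite ler_pdivlMr// -normrM mulrDl divfK//.
  by rewrite addrC mulrC.
apply: (le_trans (gauss_itv_le _)).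
  by have : (0 <= delta / `|l|)%R by [rewrite divr_ge0]; lra.
by rewrite lee_fin le_eqVlt; apply/orP; left; apply/eqP; field; rewrite normr_eq0 l0.
Qed.

Lemma measurable_norm_le (R : realType) (delta : R) :
  measurable [set x : R | (`|x| <= delta)%R].
Proof.
rewrite (_ : [set _ | _] = `[(- delta)%R, delta]%classic)//.
by apply/seteqP; split => x /=; rewrite in_itv/= ler_norml.
Qed.

(** Induction on the rows. The earlier slab events and the off-diagonal part [c] of row [n] depend
    on the coordinates before [n] only, hence are independent of [zeta k0]. Given them, [zeta k0]
    must fall into an interval of length [2 * delta] over the absolute diagonal entry, and the
    Gaussian density is at most one. *)
Lemma triangular_slab_le (R : realType) (d : measure_display)
    (T : measurableType d) (P : probability T R) (N : nat)
    (zeta : 'I_N -> T -> R) (L : nat -> 'I_N -> R) (l : nat -> R)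
    (delta : R) (n : nat) :
  iid_gauss P zeta -> (forall (i : nat) (k : 'I_N), (i < k)%N -> L i k = 0%R) ->
  (0 <= delta)%R -> (n <= N)%N ->
  (forall k : 'I_N, (k < n)%N -> (0 < l k <= `|L k k|)%R) ->
  P [set w | forall i, (i < n)%N -> (`|\sum_k L i k * zeta k w| <= delta)%R]
  <= (\prod_(i < n) (2 * delta / l i))%R%:E.
Proof.
move=> iidz triL d0; have [mz Pz] := iidz.
elim: n => [_ _|n IH nN lL].
  by rewrite big_ord0 (_ : [set _ | _] = setT) ?probability_setT//; apply/seteqP.
have {}IH := IH (ltnW nN) (fun k kn => lL k (ltnW kn)).
set E := [set w | forall i, (i < n)%N -> _] in IH *.
pose k0 : 'I_N := Ordinal nN.
pose J : pred 'I_N := fun k => (k < n)%N.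
have sE : sigma_of zeta J E.
  apply: sigma_of_forall => i ni.
  apply: (sigma_of_lin (A := [set x | (`|x| <= delta)%R])) => //.
    by move=> k; rewrite -leqNgt => nk; apply: triL; exact: leq_trans nk.
  exact: measurable_norm_le.
have mE : measurable E by exact: (sigma_of_measurable iidz sE).
pose ck (k : 'I_N) : R := if (k < n)%N then L n k else 0%R.
pose c w := (\sum_k ck k * zeta k w)%R.
have mc : measurable_fun setT c.
  by apply: measurable_sum => k; exact: measurable_funM.
have rowE w : (\sum_k L n k * zeta k w = c w + L n k0 * zeta k0 w)%R.
  rewrite (bigD1 k0)//= addrC /c [in RHS](bigD1 k0)//= {1}/ck ltnn mul0r add0r.
  congr (_ + _)%R; apply: eq_bigr => k kk0; rewrite /ck; case: ifPn => // nk.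
  rewrite triL//; move: kk0 nk; rewrite -val_eqE/= -leqNgt => kn nk.
  by rewrite ltn_neqAle eq_sym kn.
pose C := [set z : R * R | (`|z.1 + L n k0 * z.2| <= delta)%R].
have mC : measurable C.
  pose f (z : R * R) := (`|z.1 + L n k0 * z.2|)%R.
  have mf : measurable_fun setT f.
    apply: measurableT_comp => //; apply: measurable_funD => //.
    exact: measurable_funM.
  rewrite (_ : C = f @^-1` `]-oo, delta]); last first.
    by apply/seteqP; split => z /=; rewrite in_itv/=.
  by rewrite -[X in measurable X]setTI; exact: mf.
pose z w := (c w, zeta k0 w).
have mzz : measurable_fun setT z by apply/measurable_fun_pairP; split; [exact: mc|exact: mz].
pose mu := pushforward (mrestr P mE) c.
have -> : [set w | forall i, (i < n.+1)%N -> (`|\sum_k L i k * zeta k w| <= delta)%R] =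
    E `&` z @^-1` C.
  apply/seteqP; split => w /=.
    move=> Ew; split; last by have := Ew n (ltnSn n); rewrite rowE.
    by move=> i ni; apply: Ew; exact: ltnW.
  move=> [Ew Cw] i; rewrite ltnS leq_eqVlt => /orP[/eqP ->|]; last exact: Ew.
  by rewrite rowE.
(* The joint law of [c] and [zeta k0] on [E] is the product of [mu] and [gauss], since both agree on
   rectangles; the section bound can then be integrated. *)
have -> : P (E `&` z @^-1` C) = (mu \x @gauss R) C.
  rewrite setIC -[LHS]/(pushforward (mrestr P mE) z C).
  apply: measure_unique_rect => //.
    apply: (@le_lt_trans _ _ 1); last exact: ltry.
    apply: probability_le1; apply: measurableI => //.
    by rewrite -[X in measurable X]setTI; exact: mzz.
  move=> X Y mX mY.
  transitivity (mu X * gauss Y); last exact/esym/product_measure1E.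
  rewrite -[LHS]/(P (z @^-1` (X `*` Y) `&` E)) -[mu X]/(P (c @^-1` X `&` E)).
  have -> : z @^-1` (X `*` Y) `&` E = (c @^-1` X `&` E) `&` zeta k0 @^-1` Y.
    by apply/seteqP; rewrite /z; split => w /=; tauto.
  rewrite -(iid_gauss_law k0 iidz mY).
  apply: (indep_groups iidz (J := J)).
    apply: sigma_of_setI => //.
    by apply: sigma_of_lin => // k; rewrite /J /ck => /negbTE ->.
  by apply: sigma_of_preimage => //=; rewrite /J/= ltnn.
have lk0 := lL k0 (ltnSn n); rewrite /= in lk0; have /andP[ln0 lnL] := lk0.
have Lk0 : L n k0 != 0%R by rewrite -normr_gt0 (lt_le_trans ln0).
have E0 : 0 <= P E by exact: measure_ge0.
apply: (@le_trans _ _ (\int[mu]_x (2 * delta / l n)%:E)).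
  apply: ge0_le_integral => //.
  - exact: measurable_fun_xsection.
  - move=> x _ /=.
    rewrite (_ : xsection C x = [set y | (`|x + L n k0 * y| <= delta)%R]); last first.
      by apply/seteqP; split => y /=; rewrite xsectionE.
    apply: (le_trans (gauss_slab_le _ d0 Lk0)).
    by rewrite lee_fin ler_wpM2l ?mulr_ge0// lef_pV2 ?posrE ?normr_gt0.
rewrite integral_cst//.
have muT : mu setT = P E.
  by rewrite -[LHS]/(P (c @^-1` setT `&` E)) preimage_setT setTI.
rewrite -muT in IH; rewrite big_ord_recr/= [leRHS]EFinM muleC.
by apply: lee_wpmul2r => //; rewrite lee_fin divr_ge0 ?mulr_ge0// ltW.
Qed.

Local Close Scope ereal_scope.

Local Open Scope ereal_scope.

Lemma lebesgue_measure_scale (R : realType) (s : R) (A : set R) :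
  (0 < s)%R -> measurable A ->
  pushforward lebesgue_measure (fun x : R => (x / s)%R : measurableTypeR R) A
  = s%:E * lebesgue_measure A.
Proof.
move=> s0 mA.
have mf : measurable_fun setT (fun x : measurableTypeR R => (x / s)%R : measurableTypeR R).
  exact: measurable_funM.
have is0 : (0 <= s^-1)%R by rewrite invr_ge0 ltW.
pose k : {nonneg R} := NngNum is0.
suff -> : lebesgue_measure A =
    mscale k (pushforward lebesgue_measure (fun x : R => (x / s)%R : measurableTypeR R)) A.
  by rewrite /mscale/= muleA -EFinM divff ?gt_eqF// mul1e.
move=> mf2; apply: lebesgue_measure_unique => //.
move=> _ [[u v]] uv <-.
rewrite -[RHS]/(s^-1%:E * lebesgue_measure ((fun x => (x / s)%R) @^-1` `]u, v]%classic)).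
have -> : (fun x => (x / s)%R) @^-1` `]u, v]%classic = `](u * s)%R, (v * s)%R]%classic.
  by apply/seteqP; split => x /=; rewrite !in_itv/= ltr_pdivlMr// ler_pdivrMr.
rewrite !lebesgue_measure_itv/= !lte_fin ltr_pM2r//.
case: ifPn => [_|_]; last by rewrite mule0.
by rewrite -!EFinD -EFinM; congr EFin; field; rewrite gt_eqF.
Qed.

Lemma ge0_integral_scale (R : realType) (s : R) (f : R -> \bar R) :
  (0 < s)%R -> measurable_fun setT f -> (forall x, 0 <= f x) ->
  \int[lebesgue_measure]_x f (x / s)%R = s%:E * \int[lebesgue_measure]_x f x.
Proof.
move=> s0 mf f0.
have mg : measurable_fun setT (fun x : measurableTypeR R => (x / s)%R : measurableTypeR R).
  exact: measurable_funM.
transitivity (\int[pushforward lebesgue_measure (fun x : R => (x / s)%R : measurableTypeR R)]_x f x).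
  by rewrite ge0_integral_pushforward.
pose k : {nonneg R} := NngNum (ltW s0).
transitivity (\int[mscale k lebesgue_measure]_x f x).
  by apply: eq_measure_integral => A mA _; exact: lebesgue_measure_scale.
exact: ge0_integral_mscale.
Qed.

Lemma normal_prob_scale (R : realType) (s : R) (A : set R) :
  (0 < s)%R -> measurable A ->
  normal_prob 0 s ((fun x => (x / s)%R) @^-1` A) = gauss A.
Proof.
move=> s0 mA; have sn0 : s != 0%R by rewrite gt_eqF.
have mpdf : measurable_fun setT (@normal_pdf R 0 1) by exact: measurable_normal_pdf.
pose f x : \bar R := (\1_A x * normal_pdf 0 1 x)%:E.
have mf : measurable_fun setT f.
  by apply/measurable_EFinP; apply: measurable_funM; first exact: measurable_indic.
have f0 x : 0 <= f x by rewrite lee_fin mulr_ge0// normal_pdf_ge0.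
have {2}-> : A = setT `&` A by rewrite setTI.
have -> : gauss (setT `&` A) = \int[lebesgue_measure]_x f x.
  rewrite /gauss /normal_prob setTI integral_mkcond; apply: eq_integral => x _.
  by rewrite /f patchE indicE; case: ifPn => _; rewrite ?mul1r ?mul0r.
rewrite -[RHS]mul1e -[X in X%:E](divff sn0) mulrC EFinM -muleA -ge0_integral_scale//.
rewrite -ge0_integralZl//; last by rewrite lee_fin invr_ge0 ltW.
  rewrite /normal_prob [LHS]integral_mkcond; apply: eq_integral => x _.
  rewrite /f patchE indicE.
  have -> : ((x / s)%R \in A) = (x \in (fun x => (x / s)%R) @^-1` A).
    by apply/idP/idP; rewrite !inE.
  case: ifPn => _; last by rewrite mul0r mule0.
  rewrite mul1r -EFinM; congr EFin.
  rewrite !normal_pdfE ?oner_eq0// mulrA; congr (_ * expR _)%R.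
    rewrite /normal_peak expr1n mul1r -mulrnAr sqrtrM ?sqr_ge0// sqrtr_sqr.
    by rewrite gtr0_norm// invfM.
  by field.
apply: measurableT_comp => //.
exact: measurable_funM.
Qed.

Lemma markov_sqr (R : realType) (d : measure_display) (T : measurableType d)
    (mu : {measure set T -> \bar R}) (Y : T -> R) (eta : R) :
  (0 <= eta)%R -> measurable_fun setT Y ->
  (eta ^+ 2)%:E * mu [set w | (eta < `|Y w|)%R] <= \int[mu]_w ((Y w) ^+ 2)%:E.
Proof.
move=> eta0 mY.
have mA : measurable [set w | (eta < `|Y w|)%R].
  rewrite (_ : [set _ | _] = (fun w => `|Y w|%R) @^-1` `]eta, +oo[); last first.
    by apply/seteqP; split => w /=; rewrite in_itv/= andbT.
  by rewrite -[X in measurable X]setTI; apply: measurableT_comp.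
have mY2 : measurable_fun setT (fun w => ((Y w) ^+ 2)%:E).
  by apply/measurable_EFinP; exact: measurable_funX.
rewrite -integral_cst//.
apply: (@le_trans _ _ (\int[mu]_(w in [set w | (eta < `|Y w|)%R]) ((Y w) ^+ 2)%:E)).
  apply: ge0_le_integral => //=.
  - by move=> x _; rewrite lee_fin sqr_ge0.
  - exact: measurable_funTS.
  - move=> x /= ex; rewrite lee_fin -(real_normK (num_real (Y x))).
    by rewrite ler_sqr ?nnegrE// ltW.
by apply: ge0_subset_integral => // x _; rewrite lee_fin sqr_ge0.
Qed.

Definition gauss_moment2 (R : realType) : \bar R := \int[@gauss R]_x (x ^+ 2)%:E.

Lemma gauss_moment2_ge0 (R : realType) : 0 <= gauss_moment2 R.
Proof. by apply: integral_ge0 => x _; rewrite lee_fin sqr_ge0. Qed.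

(** Comparison with the normal density of standard deviation 2: [1 + 3 / 8 * x ^+ 2 <= expR (3 / 8 *
    x ^+ 2)] absorbs the square, where 3/8 is the difference of 1/2 and 1/8. *)
Lemma gauss_moment2_fin (R : realType) : gauss_moment2 R \is a fin_num.
Proof.
have n0 : ((2 : R) != 0)%R by [].
have m2 : measurable_fun setT (fun x : R => (x ^+ 2)%:E).
  by apply/measurable_EFinP; exact: measurable_funX.
rewrite ge0_fin_numE ?gauss_moment2_ge0// /gauss_moment2 ge0_integral_gauss//; last first.
  by move=> x; rewrite lee_fin sqr_ge0.
pose C : R := (8 / 3 * normal_peak 1 / normal_peak 2)%R.
have p1 : (0 < normal_peak (1 : R))%R by rewrite normal_peak_gt0.
have p2 : (0 < normal_peak (2 : R))%R by rewrite normal_peak_gt0.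
apply: (@le_lt_trans _ _ (\int[lebesgue_measure]_x (C%:E * (normal_pdf 0 2 x)%:E))).
  apply: ge0_le_integral => //.
  - by move=> x _; rewrite -EFinM lee_fin mulr_ge0 ?sqr_ge0 ?normal_pdf_ge0.
  - by apply: emeasurable_funM => //; apply/measurable_EFinP; exact: measurable_normal_pdf.
  - apply: emeasurable_funM => //; apply/measurable_EFinP; exact: measurable_normal_pdf.
  - move=> x _; rewrite -!EFinM lee_fin !normal_pdfE// /C /normal_fun !subr0 expr1n.
    have -> : (8 / 3 * normal_peak 1 / normal_peak 2 * (normal_peak 2 * expR (- x ^+ 2 / (2 ^+ 2 *+ 2))))%R
        = (normal_peak 1 * (8 / 3 * expR (- x ^+ 2 / (2 ^+ 2 *+ 2))))%R.
      by field; rewrite gt_eqF.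
    rewrite mulrCA ler_pM2l//.
    have -> : (- x ^+ 2 / (2 ^+ 2 *+ 2) = - x ^+ 2 / (1 *+ 2) + 3 / 8 * x ^+ 2 :> R)%R by field.
    rewrite expRD mulrCA mulrC ler_pM2l ?expR_gt0//.
    by have := expR_ge1Dx (3 / 8 * x ^+ 2)%R; lra.
rewrite ge0_integralZl//.
- by rewrite integral_normal_pdf mule1 ltry.
- by apply/measurable_EFinP; exact: measurable_normal_pdf.
- by move=> x _; rewrite lee_fin normal_pdf_ge0.
- by rewrite lee_fin /C divr_ge0 ?mulr_ge0// ltW.
Qed.

(** One expression for both regimes: linear in [e] for small [e], and [1 - K / (e + K)] for large
    [e]. Minus its logarithm is [ln (1 + K / e)], so half-widths that grow geometrically have a
    summable cost. *)
Lemma gauss_itv_ge (R : realType) :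
  exists2 K : R, (0 < K)%R &
    forall e : R, (0 < e)%R -> (e / (e + K))%:E <= gauss [set x | (`|x| <= e)%R].
Proof.
set s2 := fine (gauss_moment2 R).
have s2E : gauss_moment2 R = s2%:E by rewrite fineK// gauss_moment2_fin.
have s20 : (0 <= s2)%R by rewrite fine_ge0// gauss_moment2_ge0.
(* Up to [E0] the density on the interval is at least its value [p] at [E0], whence [(2 * p)^-1] in
   [K]; beyond [E0] Chebyshev's inequality is used, with [e ^+ 2] larger than both [e] and
   [2 * s2]. *)
pose E0 := (1 + 2 * s2)%R; pose p := normal_pdf 0 1 E0.
have E01 : (1 <= E0)%R by rewrite /E0; lra.
have p0 : (0 < p)%R by rewrite /p normal_pdfE ?oner_eq0// mulr_gt0 ?expR_gt0// normal_peak_gt0// oner_eq0.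
pose K := (1 + (2 * p)^-1)%R.
have ip0 : (0 < (2 * p)^-1)%R by rewrite invr_gt0 mulr_gt0.
have K1 : (1 < K)%R by rewrite /K; lra.
exists K => [|e e0]; first lra.
have [eE|Ee] := leP e E0.
  apply: (@le_trans _ _ (2 * e * p)%:E).
    rewrite lee_fin ler_pdivrMr; last lra.
    have h : (1 <= 2 * p * (e + K))%R.
      rewrite -ler_pdivrMl; last by rewrite mulr_gt0.
      by rewrite mulr1 /K; lra.
    by have := ler_pM2l e0 1%R (2 * p * (e + K))%R; rewrite h mulr1; nra.
  rewrite /gauss /normal_prob (_ : [set _ | _] = `[(- e)%R, e]%classic); last first.
    by apply/seteqP; split => x /=; rewrite in_itv/= ler_norml.
  have -> : (2 * e * p)%:E = \int[lebesgue_measure]_(x in `[(- e)%R, e]) p%:E.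
    rewrite integral_cst//= lebesgue_measure_itv/= lte_fin ifT; last lra.
    by rewrite -EFinB -EFinM; congr EFin; ring.
  apply: ge0_le_integral => //=.
  - by move=> x _; rewrite lee_fin ltW.
  - by apply/measurable_EFinP; apply: measurable_funTS; exact: measurable_normal_pdf.
  - move=> x; rewrite in_itv/= => /andP[ex xe]; rewrite lee_fin /p !normal_pdfE ?oner_eq0//.
    rewrite ler_pM2l ?normal_peak_gt0 ?oner_eq0// /normal_fun ler_expR !subr0.
    by rewrite expr1n ler_pM2r ?invr_gt0//; nra.
have mA : measurable [set x : R | (`|x| <= e)%R] by exact: measurable_norm_le.
have := @markov_sqr R _ _ (@gauss R) idfun e (ltW e0) (@measurable_id _ _ _).
rewrite -/(gauss_moment2 R) s2E.
have -> : [set w : R | (e < `|idfun w|)%R] = ~` [set x | (`|x| <= e)%R].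
  by apply/seteqP; split => x /=; rewrite real_ltNge ?num_real// => /negP.
move=> h.
have hC : gauss (~` [set x : R | (`|x| <= e)%R]) = 1 - gauss [set x | (`|x| <= e)%R].
  exact: (@probability_setC _ _ R (@gauss R)).
have {h}: (e ^+ 2)%:E * gauss (~` [set x : R | (`|x| <= e)%R]) <= s2%:E := h.
rewrite hC.
have : gauss [set x : R | (`|x| <= e)%R] \is a fin_num by exact: fin_num_measure.
move: (gauss _) => [g|//|//] _; rewrite -EFinB -EFinM !lee_fin => h.
rewrite ler_pdivrMr; last lra.
have e1 : (1 < e)%R by lra.
have ee : (e < e ^+ 2)%R by rewrite expr2; nra.
have h2 : (2 * s2 < e ^+ 2)%R by rewrite /E0 in Ee; lra.
suff : ((1 - g) * (e + K) <= K)%R by nra.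
rewrite -(ler_pM2l (x := (e ^+ 2)%R)); last lra.
rewrite mulrA; apply: (@le_trans _ _ (s2 * (e + K))%R); first by rewrite ler_pM2r//; lra.
rewrite /E0 in Ee; nra.
Qed.

Local Close Scope ereal_scope.

(** * Cauchy and Szego kernels *)

Section schur.
Variable R : realType.

(* Gram-Schmidt on Gram matrices: the inner products of what is left of the
   vectors [i] and [j] after projecting out the vectors [0], ..., [m - 1]. *)
Fixpoint schur (G : nat -> nat -> R) (m i j : nat) : R :=
  if m is m'.+1 then
    schur G m' i j - schur G m' i m' * schur G m' j m' / schur G m' m' m'
  else G i j.

(** Multiplying a kernel by [B x * B y] commutes with a Schur complement, since the factors at the
    pivot cancel. A single elimination identity for [K] therefore iterates to a product. *)
Lemma schur_kernel (A : Type) (K b : A -> A -> R) (D : A -> Prop) (t : nat -> A) :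
  (forall x y a, D x -> D y -> D a ->
     K x y - K x a * K y a / K a a = b a x * b a y * K x y) ->
  (forall i, D (t i)) -> (forall i, K (t i) (t i) != 0) ->
  (forall i j, (i < j)%N -> b (t i) (t j) != 0) ->
  forall m i j, schur (fun i j => K (t i) (t j)) m i j =
    (\prod_(l < m) b (t l) (t i)) * (\prod_(l < m) b (t l) (t j)) * K (t i) (t j).
Proof.
move=> Kb Dt K0 b0; elim=> [|m IH] i j /=; first by rewrite !big_ord0 !mul1r.
rewrite !IH !big_ord_recr/=.
set Bi := \prod_(l < m) b (t l) (t i); set Bj := \prod_(l < m) b (t l) (t j).
set Bm := \prod_(l < m) b (t l) (t m).
have Bm0 : Bm != 0 by apply/prodf_neq0 => l _; exact: b0.
transitivity (Bi * Bj * (K (t i) (t j) - K (t i) (t m) * K (t j) (t m) / K (t m) (t m))).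
  by field; rewrite Bm0 K0.
rewrite Kb//; ring.
Qed.

Lemma schur_cvg (G : nat -> nat -> nat -> R) (G0 : nat -> nat -> R) :
  (forall i j, G N i j @[N --> \oo] --> G0 i j) ->
  (forall m, schur G0 m m m != 0) ->
  forall m i j, schur (G N) m i j @[N --> \oo] --> schur G0 m i j.
Proof.
move=> GG0 G00; elim=> [|m IH] i j //=.
apply: cvgB => //; apply: cvgM; first exact: cvgM.
by apply: cvgV.
Qed.

Lemma laplace_kernel_schur (x y a : R) : 0 < x -> 0 < y -> 0 < a ->
  (x + y)^-1 - (x + a)^-1 * (y + a)^-1 / (a + a)^-1 =
  ((x - a) / (x + a)) * ((y - a) / (y + a)) * (x + y)^-1.
Proof. by move=> x0 y0 a0; field; rewrite !gt_eqF//=; lra. Qed.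

(** The kernel [x * y / (1 - x * y)] is the inner product of the sequences [x ^+ k.+1] and
    [y ^+ k.+1]; the exponents start at 1 because the grid rows are evaluated at right endpoints. *)
Lemma szego_kernel_schur (x y a : R) : 0 < x < 1 -> 0 < y < 1 -> 0 < a < 1 ->
  x * y / (1 - x * y) -
    x * a / (1 - x * a) * (y * a / (1 - y * a)) / (a * a / (1 - a * a)) =
  ((x - a) / (1 - x * a)) * ((y - a) / (1 - y * a)) * (x * y / (1 - x * y)).
Proof.
have lt1 (u v : R) : 0 < u < 1 -> 0 < v < 1 -> 1 - u * v != 0.
  by move=> /andP[u0 u1] /andP[v0 v1]; rewrite gt_eqF// subr_gt0; nra.
move=> x01 y01 a01; field; rewrite !lt1//=.
by have /andP[a0 _] := a01; rewrite gt_eqF.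
Qed.

Lemma series_geometric_cvg (x y : R) : 0 < x < 1 -> 0 < y < 1 ->
  \sum_(k < n) x ^+ k.+1 * y ^+ k.+1 @[n --> \oo] --> x * y / (1 - x * y).
Proof.
move=> /andP[x0 x1] /andP[y0 y1].
have xy0 : 0 < x * y by rewrite mulr_gt0.
have xy1 : x * y < 1 by nra.
have := @cvg_geometric_series R (x * y) (x * y).
rewrite ger0_norm ?ltW// => /(_ xy1).
suff -> : (fun n => \sum_(k < n) x ^+ k.+1 * y ^+ k.+1) =
  series (geometric (x * y) (x * y)) by [].
apply/funext => n; rewrite seriesEord; apply: eq_bigr => k _ /=.
by rewrite -exprMn exprS.
Qed.

Variable a : nat -> R.
Hypothesis a01 : forall i, 0 < a i < 1.
Variable M : nat.
Hypothesis a_inj : forall i j, (i < j)%N -> (j < M)%N -> a i != a j.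

Let K (x y : R) := x * y / (1 - x * y).
Let b (c x : R) := (x - c) / (1 - x * c).
Let Km m x y := (\prod_(l < m) b (a l) x) * (\prod_(l < m) b (a l) y) * K x y.

Let lt1 (u v : R) : 0 < u < 1 -> 0 < v < 1 -> 1 - u * v != 0.
Proof. by move=> /andP[u0 u1] /andP[v0 v1]; rewrite gt_eqF// subr_gt0; nra. Qed.

Let b0 i j : (i < j)%N -> (j < M)%N -> b (a i) (a j) != 0.
Proof.
move=> ij jM; rewrite mulf_neq0 ?invr_eq0 ?lt1//.
by rewrite subr_eq0 eq_sym; exact: a_inj.
Qed.

Let K0 m : K (a m) (a m) != 0.
Proof.
have /andP[a0 _] := a01 m.
by rewrite mulf_neq0 ?invr_eq0 ?lt1// mulf_neq0// gt_eqF.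
Qed.

Let KmS m x y : (m < M)%N -> 0 < x < 1 -> 0 < y < 1 ->
  Km m.+1 x y = Km m x y - Km m x (a m) * Km m y (a m) / Km m (a m) (a m).
Proof.
move=> mM x01 y01; rewrite /Km !big_ord_recr/=.
set Bx := \prod_(l < m) b (a l) x; set By := \prod_(l < m) b (a l) y.
set Bm := \prod_(l < m) b (a l) (a m).
have Bm0 : Bm != 0 by apply/prodf_neq0 => l _; exact: b0.
transitivity (Bx * By * (K x y - K x (a m) * K y (a m) / K (a m) (a m))).
  by rewrite szego_kernel_schur//; rewrite /K /b; ring.
by field; rewrite Bm0 K0.
Qed.

Let KmC m x y : Km m x y = Km m y x.
Proof. by rewrite /Km /K (mulrC x y) [X in X * _]mulrC. Qed.

Let Km0 m : (m < M)%N -> Km m (a m) (a m) != 0.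
Proof.
move=> mM.
have Bm0 : \prod_(l < m) b (a l) (a m) != 0 by apply/prodf_neq0 => l _; exact: b0.
by rewrite /Km mulf_neq0 ?K0 ?(mulf_neq0 Bm0 Bm0).
Qed.

(** Gram-Schmidt on the sequences [x ^+ k.+1] themselves. The projection coefficients are written
    with [Km], and [residual_cvg] confirms that [Km] is the Gram kernel of these residuals. *)
Fixpoint szego_residual (m : nat) (x : R) (k : nat) : R :=
  if m is m'.+1 then szego_residual m' x k -
    Km m' x (a m') / Km m' (a m') (a m') * szego_residual m' (a m') k
  else x ^+ k.+1.

Let residual_cvg m x y : (m <= M)%N -> 0 < x < 1 -> 0 < y < 1 ->
  \sum_(k < n) szego_residual m x k * szego_residual m y k @[n --> \oo] --> Km m x y.
Proof.
elim: m x y => [|m IH] x y mM x01 y01.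
  by rewrite /Km !big_ord0 !mul1r; exact: series_geometric_cvg.
have {}IH := IH _ _ (ltnW mM).
set cx := Km m x (a m) / Km m (a m) (a m); set cy := Km m y (a m) / Km m (a m) (a m).
have -> : Km m.+1 x y = Km m x y - cy * Km m x (a m) - cx * Km m (a m) y
    + cx * cy * Km m (a m) (a m).
  by rewrite KmS// [Km m (a m) y]KmC /cx /cy; field; exact: Km0.
have -> : (fun n => \sum_(k < n) szego_residual m.+1 x k * szego_residual m.+1 y k) =
  (fun n => \sum_(k < n) szego_residual m x k * szego_residual m y k
     - cy * \sum_(k < n) szego_residual m x k * szego_residual m (a m) k
     - cx * \sum_(k < n) szego_residual m (a m) k * szego_residual m y k
     + cx * cy * \sum_(k < n) szego_residual m (a m) k * szego_residual m (a m) k).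
  apply/funext => n; rewrite !mulr_sumr -!sumrB -big_split/=.
  by apply: eq_bigr => k _; rewrite -/cx -/cy; ring.
apply: cvgD; last by apply: cvgMr; exact: IH.
apply: cvgB; last by apply: cvgMr; exact: IH.
by apply: cvgB; [exact: IH|apply: cvgMr; exact: IH].
Qed.

Let residual_span m x : exists c : nat -> R, forall k,
  szego_residual m x k = x ^+ k.+1 - \sum_(l < m) c l * a l ^+ k.+1.
Proof.
elim: m x => [|m IH] x.
  by exists (fun=> 0) => k; rewrite big_ord0 subr0.
have [cx hx] := IH x; have [ca ha] := IH (a m).
set e := Km m x (a m) / Km m (a m) (a m).
exists (fun l => if l == m then e else cx l - e * ca l) => k /=.
rewrite -/e hx ha big_ord_recr/= eqxx.
have -> : \sum_(l < m) (if val l == m then e else cx l - e * ca l) * a l ^+ k.+1 =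
   \sum_(l < m) cx l * a l ^+ k.+1 - e * \sum_(l < m) ca l * a l ^+ k.+1.
  rewrite mulr_sumr -sumrB; apply: eq_bigr => l _.
  by rewrite ltn_eqF//=; ring.
ring.
Qed.

(** The partial sums of squares of the residual increase to its full squared norm, the diagonal
    value of [Km]. Hence the bound is uniform in the number of coordinates kept, with one choice of
    [c] for all [n]. *)
Lemma szego_dist (x : R) : 0 < x < 1 ->
  exists c : nat -> R, forall n,
   \sum_(k < n) (x ^+ k.+1 - \sum_(l < M) c l * a l ^+ k.+1) ^+ 2 <=
   (\prod_(l < M) ((x - a l) / (1 - x * a l))) ^+ 2 * (x ^+ 2 / (1 - x ^+ 2)).
Proof.
move=> x01; have [c hc] := residual_span M x; exists c => n.
have := @residual_cvg M x x (leqnn M) x01 x01; rewrite /Km /K -!expr2.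
move=> h.
rewrite (eq_bigr (fun k : 'I_n => szego_residual M x k * szego_residual M x k)); last first.
  by move=> k _; rewrite hc expr2.
have nd : nondecreasing_seq
    (fun n => \sum_(k < n) szego_residual M x k * szego_residual M x k).
  apply/nondecreasing_seqP => p; rewrite big_ord_recr/= lerDl -expr2.
  exact: sqr_ge0.
by have := nondecreasing_cvgn_le nd (cvgP _ h) n; rewrite (cvg_lim _ h).
Qed.

End schur.

Lemma gram_quadratic (R : realType) (N N' : nat) (V : nat -> 'I_N -> R)
    (L : nat -> 'I_N' -> R) :
  (forall i j, \sum_k V i k * V j k = \sum_k L i k * L j k) ->
  forall (m i : nat) (c : nat -> R),
  \sum_k (V i k - \sum_(l < m) c l * V l k) ^+ 2 =
  \sum_k (L i k - \sum_(l < m) c l * L l k) ^+ 2.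
Proof.
move=> VL m i c.
have expand n (W : nat -> 'I_n -> R) :
    \sum_k (W i k - \sum_(l < m) c l * W l k) ^+ 2 =
    \sum_k W i k * W i k - 2 * \sum_(l < m) c l * \sum_k W i k * W l k +
    \sum_(l < m) \sum_(l' < m) c l * c l' * \sum_k W l k * W l' k.
  have e1 : \sum_(l < m) c l * \sum_k W i k * W l k =
      \sum_k W i k * \sum_(l < m) c l * W l k.
    under eq_bigr do rewrite mulr_sumr.
    rewrite exchange_big/=; apply: eq_bigr => k _; rewrite mulr_sumr.
    by apply: eq_bigr => l _; ring.
  have e2 : \sum_(l < m) \sum_(l' < m) c l * c l' * \sum_k W l k * W l' k =
      \sum_k (\sum_(l < m) c l * W l k) ^+ 2.
    under eq_bigr do under eq_bigr do rewrite mulr_sumr.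
    under eq_bigr do rewrite exchange_big/=.
    rewrite exchange_big/=; apply: eq_bigr => k _.
    rewrite expr2 big_distrl/=; apply: eq_bigr => l _.
    by rewrite big_distrr/=; apply: eq_bigr => l' _; ring.
  rewrite e1 e2 mulr_sumr -sumrB -big_split/=.
  by apply: eq_bigr => k _; ring.
rewrite !expand VL; congr (_ - 2 * _ + _).
  by apply: eq_bigr => l _; rewrite VL.
by apply: eq_bigr => l _; apply: eq_bigr => l' _; rewrite VL.
Qed.

(** The rows before [j] vanish in column [j], so subtracting a combination of them leaves the entry
    there unchanged. *)
Lemma triangular_coord_le (R : realType) (N : nat) (L : nat -> 'I_N -> R)
    (i : nat) (j : 'I_N) (c : nat -> R) :
  (forall (i : nat) (k : 'I_N), (i < k)%N -> L i k = 0) ->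
  (L i j) ^+ 2 <= \sum_k (L i k - \sum_(l < j) c l * L l k) ^+ 2.
Proof.
move=> triL; rewrite (bigD1 j)//= big1 => [|l _].
  by rewrite subr0 lerDl; apply: sumr_ge0 => k _; exact: sqr_ge0.
by rewrite triL ?mulr0.
Qed.

Lemma triangular_schur (R : realType) (N : nat) (L : nat -> 'I_N -> R)
    (G : nat -> nat -> R) (n : nat) :
  (forall (i : nat) (k : 'I_N), (i < k)%N -> L i k = 0) ->
  (n <= N)%N ->
  (forall i j, (i < n)%N -> (j < n)%N -> \sum_k L i k * L j k = G i j) ->
  (forall m, (m < n)%N -> schur G m m m != 0) ->
  forall k : 'I_N, (k < n)%N -> (L k k) ^+ 2 = schur G k k k.
Proof.
move=> triL nN LG G0.
(* After [m] eliminations the Schur complement is the Gram matrix of the rows with their first [m]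
   columns deleted. *)
have key m i j : (m < n)%N -> (i < n)%N -> (j < n)%N ->
    \sum_(k : 'I_N | (m <= k)%N) L i k * L j k = schur G m i j.
  elim: m i j => [|m IH] i j mn ni nj /=; first by rewrite -LG.
  have mN : (m < N)%N by exact: leq_trans (ltnW mn) nN.
  pose km : 'I_N := Ordinal mN.
  have split_m x y : \sum_(k : 'I_N | (m <= k)%N) L x k * L y k =
      L x km * L y km + \sum_(k : 'I_N | (m < k)%N) L x k * L y k.
    rewrite (bigD1 km)//=; congr (_ + _); apply: eq_bigl => k.
    by rewrite -val_eqE/=; lia.
  have rowm x : (x < n)%N -> schur G m x m = L x km * L m km.
    move=> xn; rewrite -IH ?(ltnW mn)// split_m big1 ?addr0// => k mk.
    by rewrite (triL m k mk) mulr0.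
  rewrite -IH ?(ltnW mn)// split_m !rowm ?(ltnW mn)//.
  have : schur G m m m != 0 by apply: G0; exact: ltnW.
  rewrite rowm ?(ltnW mn)// mulf_eq0 orbb => Lm0.
  by field.
move=> k kn; rewrite -key// (bigD1 k)//= big1 ?addr0 ?expr2// => l /andP[kl lk].
rewrite triL ?mul0r// ltn_neqAle kl andbT eq_sym; exact: lk.
Qed.

Section rows.
Variables (R : realType) (d : measure_display) (T : measurableType d).
Variables (P : probability T R).

Lemma measurable_rows (N : nat) (xi : 'I_N -> T -> R) (V : nat -> 'I_N -> R)
    (delta : R) (I : set nat) :
  iid_gauss P xi ->
  measurable [set w | forall i, I i -> `|\sum_k V i k * xi k w| <= delta].
Proof.
move=> [mxi _].
have -> : [set w | forall i, I i -> `|\sum_k V i k * xi k w| <= delta] =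
    \bigcap_(i in I) ((fun w => \sum_k V i k * xi k w) @^-1` [set x | `|x| <= delta]).
  by apply/seteqP; split => w /=.
apply: bigcap_measurableType => i _.
rewrite -[X in measurable X]setTI.
suff: measurable_fun setT (fun w => \sum_k V i k * xi k w).
  by apply => //; exact: measurable_norm_le.
by apply: measurable_sum => k; exact: measurable_funM.
Qed.

(** The rows outside [I] are unconstrained and can serve as pure pivots. Upper bounds [r] on
    distances are enough, because an entry of the triangular matrix never exceeds the distance from
    its row to the span of the earlier pivots. *)
Lemma gauss_rows_ge (N : nat) (xi : 'I_N -> T -> R) (V : nat -> 'I_N -> R)
    (r : nat -> nat -> R) (e : nat -> R) (delta : R) (I : set nat) :
  iid_gauss P xi -> (forall j, 0 <= e j) ->
  (forall i j, 0 <= r i j) ->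
  (forall i (j : 'I_N), I i -> exists c : nat -> R,
     \sum_k (V i k - \sum_(l < j) c l * V l k) ^+ 2 <= (r i j) ^+ 2) ->
  (forall i, I i -> \sum_(j < N) r i j * e j <= delta) ->
  (\prod_(j < N) gauss [set x | (`|x| <= e j)%R] <=
   P [set w | forall i, I i -> (`|\sum_k V i k * xi k w| <= delta)%R])%E.
Proof.
move=> iidx e0 r0 Vr re.
have [zeta [L [[iidz VLw VLg] triL]]] := triangularize V iidx.
have [mz Pz] := iidz.
rewrite -(Pz (fun j => [set x | `|x| <= e j])); last by move=> j; exact: measurable_norm_le.
apply: le_measure; rewrite ?inE.
- apply: (@measurable_forall_preimage _ _ _ _ zeta (fun j => [set x | `|x| <= e j])) => // j.
  exact: measurable_norm_le.
- exact: measurable_rows.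
move=> w /= ew i Ii; rewrite VLw (le_trans _ (re i Ii))//.
apply: (le_trans (ler_norm_sum _ _ _)); apply: ler_sum => j _; rewrite normrM.
apply: ler_pM => //.
have [c hc] := Vr i j Ii.
rewrite -(ler_pXn2r (n := 2))// ?nnegrE// real_normK ?num_real//.
apply: le_trans hc; rewrite (gram_quadratic VLg).
exact: triangular_coord_le.
Qed.

Lemma gauss_rows_le (N : nat) (xi : 'I_N -> T -> R) (V : nat -> 'I_N -> R)
    (G : nat -> nat -> R) (l : nat -> R) (delta : R) (n : nat) :
  iid_gauss P xi -> (0 <= delta) -> (n <= N)%N ->
  (forall i j, (i < n)%N -> (j < n)%N -> \sum_k V i k * V j k = G i j) ->
  (forall k, (k < n)%N -> 0 < l k) ->
  (forall k, (k < n)%N -> (l k) ^+ 2 <= schur G k k k) ->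
  (P [set w | forall i, (i < n)%N -> (`|\sum_k V i k * xi k w| <= delta)%R] <=
  (\prod_(i < n) (2 * delta / l i))%R%:E)%E.
Proof.
move=> iidx d0 nN VG l0 lG.
have [zeta [L [[iidz VLw VLg] triL]]] := triangularize V iidx.
have -> : [set w | forall i, (i < n)%N -> (`|\sum_k V i k * xi k w| <= delta)%R] =
    [set w | forall i, (i < n)%N -> (`|\sum_k L i k * zeta k w| <= delta)%R].
  by apply/seteqP; split => w /= h i ni; have := h i ni; rewrite VLw.
apply: (triangular_slab_le iidz) => // k kn.
have G0 m : (m < n)%N -> schur G m m m != 0.
  by move=> mn; rewrite gt_eqF// (lt_le_trans _ (lG m mn))// exprn_gt0// l0.
have LG i j : (i < n)%N -> (j < n)%N -> \sum_k L i k * L j k = G i j.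
  by move=> ni nj; rewrite -VLg VG.
have Lk := triangular_schur triL nN LG G0 kn.
rewrite l0//= -(ler_pXn2r (n := 2))// ?nnegrE//; last by rewrite ltW// l0.
by rewrite real_normK ?num_real// Lk lG.
Qed.

End rows.

(** * Riemann sums of the Wiener integrals *)

(** Triangularization leaves the single row [v] one nonzero entry, so the sum is a multiple of one
    standard normal variable, to which Chebyshev's inequality applies. *)
Lemma gauss_row_tail (R : realType) (d : measure_display) (T : measurableType d)
    (P : probability T R) (N : nat) (xi : 'I_N -> T -> R) (v : 'I_N -> R) (eta : R) :
  iid_gauss P xi -> 0 < eta ->
  (P [set w | (eta < `|\sum_k v k * xi k w|)%R] <=
   (fine (gauss_moment2 R) * (\sum_k v k ^+ 2) / eta ^+ 2)%:E)%E.
Proof.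
move=> iidx eta0.
have s0 : 0 <= fine (gauss_moment2 R) by rewrite fine_ge0// gauss_moment2_ge0.
case: N xi v iidx => [|N] xi v iidx.
  rewrite (_ : [set _ | _] = set0) ?measure0; last first.
    by apply/seteqP; split => w //=; rewrite big_ord0 normr0 ltNge ltW.
  by rewrite lee_fin big_ord0 mulr0 mul0r.
have [zeta [L [[iidz VLw VLg] triL]]] := triangularize (fun _ : nat => v) iidx.
have [mz Pz] := iidz.
have Lsum (f : 'I_N.+1 -> R) : \sum_k L 0%N k * f k = L 0%N ord0 * f ord0.
  by rewrite big_ord_recl big1 ?addr0// => k _; rewrite triL ?mul0r.
have v2 : \sum_k v k ^+ 2 = L 0%N ord0 ^+ 2.
  rewrite expr2 -Lsum -(VLg 0%N 0%N); apply: eq_bigr => k _.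
  by rewrite expr2.
rewrite (_ : [set _ | _] = [set w | (eta < `|L 0%N ord0 * zeta ord0 w|)%R]); last first.
  by apply/seteqP; split => w /=; rewrite (VLw 0%N) Lsum.
have mLz : measurable_fun setT (fun w => L 0%N ord0 * zeta ord0 w).
  exact: measurable_funM.
have := markov_sqr P (ltW eta0) mLz.
have -> : (\int[P]_w ((L 0%N ord0 * zeta ord0 w) ^+ 2)%:E =
    (L 0%N ord0 ^+ 2)%:E * gauss_moment2 R)%E.
  under eq_integral do rewrite exprMn EFinM.
  rewrite ge0_integralZl//; last 3 first.
  - by apply/measurable_EFinP; exact: measurable_funX.
  - by move=> w _; rewrite lee_fin sqr_ge0.
  - by rewrite lee_fin sqr_ge0.
  congr (_ * _)%E; rewrite /gauss_moment2.
  transitivity (\int[pushforward P (zeta ord0)]_x (x ^+ 2)%:E)%E.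
    rewrite ge0_integral_pushforward//.
    - by apply/measurable_EFinP; exact: measurable_funX.
    - by move=> x _; rewrite lee_fin sqr_ge0.
  apply: eq_measure_integral => //= A mA _.
  exact: (iid_gauss_law ord0 iidz).
rewrite -[X in (_ <= _ * X -> _)%E](fineK (gauss_moment2_fin R)) -EFinM => h.
rewrite v2 mulrC EFinM lee_pdivlMl ?exprn_gt0//.
by apply: (le_trans h); rewrite mulrC.
Qed.

Section brownian.
Variables (R : realType) (d : measure_display) (T : measurableType d).
Variables (P : probability T R) (B : R -> {RV P >-> R}).
Hypothesis hB : standard_brownian_motion B.

Definition grid_increment (N M : nat) (k : 'I_M) (w : T) : R :=
  Num.sqrt N%:R * (B (k.+1%:R / N%:R) w - B (k%:R / N%:R) w).

Lemma grid_increment_iid (N M : nat) : (0 < N)%N ->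
  iid_gauss P (@grid_increment N M).
Proof.
move=> N0; have [_ _ lawB indB] := hB.
have NR0 : 0 < N%:R :> R by rewrite ltr0n.
have sN : 0 < Num.sqrt (N%:R : R) by rewrite sqrtr_gt0.
split=> [k|A mA].
  by apply: measurable_funM => //; apply: measurable_funB.
pose t (i : nat) : R := i%:R / N%:R.
have t0 : 0 <= t 0%N by rewrite /t mul0r.
have tmono : {homo t : i j / (i <= j)%N >-> i <= j}.
  by move=> i j ij; rewrite /t ler_pM2r ?invr_gt0// ler_nat.
pose A' (k : 'I_M) : set R := (fun x => x / (Num.sqrt N%:R)^-1) @^-1` A k.
have mA' k : measurable (A' k).
  rewrite -[X in measurable X]setTI.
  by apply: (_ : measurable_fun setT (fun x : R => x / (Num.sqrt N%:R)^-1)) => //;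
    exact: measurable_funM.
have := indB M t t0 tmono A' mA'.
have AA' (k : 'I_M) w : A' k ((B (t k.+1) \- B (t k)) w) = A k (grid_increment N k w).
  by rewrite /A' /preimage/= invrK mulrC.
have -> : [set w | forall i, A' i ((B (t i.+1) \- B (t i)) w)] =
    [set w | forall i, A i (grid_increment N i w)].
  by apply/seteqP; split => w /= h i; have := h i; rewrite AA'.
move=> ->; apply: eq_bigr => k _.
transitivity (pushforward P (B (t k.+1) \- B (t k)) (A' k)); first by [].
have tk : t k < t k.+1 by rewrite /t ltr_pM2r ?invr_gt0// ltr_nat.
rewrite lawB//; last by rewrite (le_trans t0)// tmono.
have -> : Num.sqrt (t k.+1 - t k) = (Num.sqrt N%:R)^-1.
  rewrite -mulrBl -natrB// subSnn mul1r.
  by rewrite sqrtrV// ltW.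
by rewrite normal_prob_scale// invr_gt0.
Qed.

Lemma increment_sqr (s t : R) : 0 <= s -> 0 <= t ->
  P.-integrable setT (EFin \o (fun w => (B t w - B s w) ^+ 2)) /\
  (\int[P]_w ((B t w - B s w) ^+ 2)%:E = (fine (gauss_moment2 R) * `|t - s|)%:E)%E.
Proof.
wlog st : s t / s <= t.
  move=> H s0 t0; have [st|/ltW ts] := leP s t; first exact: H.
  have [] := H _ _ ts t0 s0.
  have -> : (fun w => (B s w - B t w) ^+ 2) = (fun w => (B t w - B s w) ^+ 2).
    by apply/funext => w; rewrite -sqrrN opprB.
  move=> h1 h2; split=> //; rewrite distrC -h2; apply: eq_integral => w _.
  by rewrite -sqrrN opprB.
move=> s0 t0.
have mBts : measurable_fun setT (fun w => B t w - B s w) by exact: measurable_funB.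
have m2 : measurable_fun setT (fun w => ((B t w - B s w) ^+ 2)%:E).
  by apply/measurable_EFinP; exact: measurable_funX.
suff h : (\int[P]_w ((B t w - B s w) ^+ 2)%:E = (fine (gauss_moment2 R) * `|t - s|)%:E)%E.
  split=> //; apply/integrableP; split => //.
  under eq_integral do rewrite /= ger0_norm ?sqr_ge0//.
  by rewrite h ltry.
have [->|nst] := eqVneq t s.
  rewrite subrr normr0 mulr0; under eq_integral do rewrite subrr expr0n/=.
  exact: integral0.
have lst : s < t by rewrite lt_neqAle eq_sym nst.
have [_ _ lawB _] := hB.
pose r := Num.sqrt (t - s); have r0 : 0 < r by rewrite sqrtr_gt0 subr_gt0.
pose Z w := (B t w - B s w) / r.
have mZ : measurable_fun setT Z by exact: measurable_funM.
have mX2 : measurable_fun setT (fun x : R => (x ^+ 2)%:E).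
  by apply/measurable_EFinP; exact: measurable_funX.
transitivity (\int[P]_w ((t - s)%:E * ((Z w) ^+ 2)%:E))%E.
  apply: eq_integral => w _; rewrite -EFinM /Z expr_div_n sqr_sqrtr ?subr_ge0//.
  by rewrite mulrC divfK// subr_eq0.
rewrite ge0_integralZl//; last 3 first.
- by apply/measurable_EFinP; exact: measurable_funX.
- by move=> w _; rewrite lee_fin sqr_ge0.
- by rewrite lee_fin subr_ge0.
rewrite ger0_norm ?subr_ge0// mulrC EFinM fineK ?gauss_moment2_fin//.
congr (_ * _)%E; rewrite /gauss_moment2.
transitivity (\int[pushforward P Z]_x (x ^+ 2)%:E)%E.
  by rewrite ge0_integral_pushforward// => x _; rewrite lee_fin sqr_ge0.
apply: eq_measure_integral => //= A mA _.
rewrite -(normal_prob_scale r0 mA) -lawB//.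
rewrite -[X in measurable X]setTI.
by apply: (_ : measurable_fun setT (fun x : R => x / r)) => //; exact: measurable_funM.
Qed.

End brownian.

Lemma integral_lincomb (R : realType) (d : measure_display)
    (T : measurableType d) (mu : {measure set T -> \bar R}) (D : set T)
    (I : eqType) (s : seq I) (c m : I -> R) (f : I -> T -> R) (Q : I -> Prop) :
  measurable D ->
  (forall i, Q i -> mu.-integrable D (EFin \o f i)) ->
  (forall i, Q i -> (\int[mu]_(w in D) (f i w)%:E = (m i)%:E)%E) ->
  {in s, forall i, Q i} ->
  mu.-integrable D (EFin \o (fun w => \sum_(i <- s) c i * f i w)) /\
  (\int[mu]_(w in D) (\sum_(i <- s) c i * f i w)%:E = (\sum_(i <- s) c i * m i)%:E)%E.
Proof.
move=> mD intf intfm; elim: s => [|i s IH] Qs.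
  split.
    apply: (eq_integrable mD (cst 0%E)); last exact: integrable0.
    by move=> w _ /=; rewrite big_nil.
  rewrite big_nil; under eq_integral do rewrite big_nil.
  exact: integral0.
have [|h1 h2] := IH; first by move=> j js; apply: Qs; rewrite inE js orbT.
have Qi : Q i by apply: Qs; rewrite mem_head.
have e w : (\sum_(j <- i :: s) c j * f j w)%:E =
    ((c i)%:E * (f i w)%:E + (\sum_(j <- s) c j * f j w)%:E)%E.
  by rewrite big_cons.
have hi : mu.-integrable D (fun w => (c i)%:E * (f i w)%:E)%E.
  exact/integrableZl/intf.
split.
  apply: (eq_integrable mD (fun w => (c i)%:E * (f i w)%:E + (\sum_(j <- s) c j * f j w)%:E)%E).
    by move=> w _; rewrite /= e.
  exact: integrableD.
under eq_integral do rewrite e.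
rewrite integralD//= h2 integralZl//; last exact: intf.
by rewrite intfm// big_cons EFinD EFinM.
Qed.

(** The right-hand side is the polarization of the distance, the very combination that the
    covariance of two Brownian increments produces; this match is the isometry for indicators of
    intervals. *)
Lemma overlap_length (R : realType) (u v x y : R) : u <= v -> x <= y ->
  (if Num.max u x < Num.min v y then Num.min v y - Num.max u x else 0) =
  2^-1 * (`|v - x| + `|u - y| - `|v - y| - `|u - x|).
Proof.
move=> uv xy.
have cases (p q : R) : p <= q /\ `|p - q| = q - p /\ Num.max p q = q /\ Num.min p q = p \/
    q <= p /\ `|p - q| = p - q /\ Num.max p q = p /\ Num.min p q = q.
  have [h|h] := leP p q; [left|right]; rewrite ?(ltW h)//; do 2 split=> //.
    by rewrite distrC ger0_norm// subr_ge0.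
  by rewrite gtr0_norm// subr_gt0.
have [[h1 [-> [-> _]]]|[h1 [-> [-> _]]]] := cases u x;
have [[h2 [-> [_ ->]]]|[h2 [-> [_ ->]]]] := cases v y;
have [[h3 [-> _]]|[h3 [-> _]]] := cases v x;
have [[h4 [-> _]]|[h4 [-> _]]] := cases u y;
case: ltP => h5; lra.
Qed.

Lemma lebesgue_overlap (R : realType) (a b u v x y : R) :
  a <= u -> u <= v -> v <= b -> a <= x -> x <= y -> y <= b ->
  let mu := @lebesgue_measure R in
  let f := fun s : R => \1_(`]u, v]) s * \1_(`]x, y]) s : R in
  mu.-integrable `[a, b] (EFin \o f) /\
  (\int[mu]_(s in `[a, b]) (f s)%:E =
    (2^-1 * (`|v - x| + `|u - y| - `|v - y| - `|u - x|))%:E)%E.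
Proof.
move=> au uv vb ax xy yb mu f.
have fE : f = \1_(`]u, v] `&` `]x, y]).
  by apply/funext => s; rewrite /f indicI.
have E : `]u, v] `&` `]x, y] `&` `[a, b] = `](Num.max u x), (Num.min v y)]%classic.
  apply/seteqP; split => s /=; rewrite !in_itv/= gt_max le_min.
    by move=> [[/andP[-> ->] /andP[-> ->]] _].
  move=> /andP[/andP[us xs] /andP[sv sy]]; rewrite us xs sv sy.
  by split; [split|]; rewrite // (le_trans au (ltW us)) (le_trans sv vb).
have mE : measurable (`]u, v]%classic `&` `]x, y]%classic : set R) by exact: measurableI.
have I : (\int[mu]_(s in `[a, b]) (f s)%:E =
    (2^-1 * (`|v - x| + `|u - y| - `|v - y| - `|u - x|))%:E)%E.
  transitivity (lebesgue_measure `](Num.max u x), (Num.min v y)]%classic : \bar R).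
    by rewrite fE integral_indic// E.
  rewrite lebesgue_measure_itv/= lte_fin.
  transitivity ((if Num.max u x < Num.min v y then Num.min v y - Num.max u x else 0)%:E).
    by case: ifP.
  by rewrite overlap_length.
split=> //; apply/integrableP; split.
  by rewrite fE; apply/measurable_EFinP; exact: measurable_indic.
under eq_integral.
  move=> s _; rewrite /= ger0_norm; last by rewrite /f !indicE mulr_ge0.
  over.
by rewrite I ltry.
Qed.

Section wiener.
Variables (R : realType) (d : measure_display) (T : measurableType d).
Variables (P : probability T R) (B : R -> {RV P >-> R}).
Hypothesis hB : standard_brownian_motion B.

Let ov (q q' : R * R * R) : R := 2^-1 *
  (`|q.1.2 - q'.1.1| + `|q.1.1 - q'.1.2| - `|q.1.2 - q'.1.2| - `|q.1.1 - q'.1.1|).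

Let in_step a b p (q : R * R * R) : step_in a b p -> q \in p ->
  [/\ a <= q.1.1, q.1.1 <= q.1.2 & q.1.2 <= b].
Proof. by move=> /allP h /h /and3P[]. Qed.

Let sqr_pairs (p : seq (R * R * R)) (g : R * R * R -> R) :
  (\sum_(q <- p) q.2 * g q) ^+ 2 =
  \sum_(z <- [seq (x, y) | x <- p, y <- p]) z.1.2 * z.2.2 * (g z.1 * g z.2).
Proof.
rewrite expr2 big_distrl/= big_allpairs/=; apply: eq_bigr => q _.
by rewrite big_distrr/=; apply: eq_bigr => q' _; ring.
Qed.

(** The Ito isometry, with constant [gauss_moment2 R]. Both sides expand over pairs of steps, and
    each pair contributes the overlap [ov]. *)
Lemma step_integral_sqr (a b : R) (p : seq (R * R * R)) : 0 <= a -> step_in a b p ->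
  (\int[P]_w ((step_integral (fun t => B t) p w) ^+ 2)%:E =
   gauss_moment2 R * \int[lebesgue_measure]_(s in `[a, b]) ((step_fun p s) ^+ 2)%:E)%E.
Proof.
move=> a0 pab.
set s2 := fine (gauss_moment2 R).
pose pp := [seq (x, y) | x <- p, y <- p].
pose cc (z : (R * R * R) * (R * R * R)) := z.1.2 * z.2.2.
pose Q (z : (R * R * R) * (R * R * R)) := z.1 \in p /\ z.2 \in p.
have ppQ : {in pp, forall z, Q z} by move=> z /allpairsP[[x y] [/= xp yp ->]].
have L : (\int[lebesgue_measure]_(s in `[a, b]) ((step_fun p s) ^+ 2)%:E =
    (\sum_(z <- pp) cc z * ov z.1 z.2)%:E)%E.
  have [|||_ <-] := @integral_lincomb R _ _ lebesgue_measure `[a, b]%classic _ pp cc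
    (fun z => ov z.1 z.2)
    (fun z s => \1_(`]z.1.1.1, z.1.1.2]) s * \1_(`]z.2.1.1, z.2.1.2]) s) Q _ _ _ ppQ => //.
  - move=> z [/(in_step pab)[h1 h2 h3] /(in_step pab)[h4 h5 h6]].
    by have [] := lebesgue_overlap h1 h2 h3 h4 h5 h6.
  - move=> z [/(in_step pab)[h1 h2 h3] /(in_step pab)[h4 h5 h6]].
    by have [] := lebesgue_overlap h1 h2 h3 h4 h5 h6.
  by apply: eq_integral => s _; rewrite /step_fun sqr_pairs.
(* Polarization: twice the product of the increments over [(u, v)] and [(x, y)] is the square over
   [(x, v)] plus that over [(y, u)] minus those over [(y, v)] and [(x, u)]. The covariance is thus
   read off from second moments of single increments. *)
pose pol (z : (R * R * R) * (R * R * R)) : seq (R * (R * R)) :=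
  [:: (2^-1, (z.2.1.1, z.1.1.2)); (2^-1, (z.2.1.2, z.1.1.1));
      (- 2^-1, (z.2.1.2, z.1.1.2)); (- 2^-1, (z.2.1.1, z.1.1.1))].
pose dB (q : R * R * R) w := B q.1.2 w - B q.1.1 w.
have polE z : Q z ->
    P.-integrable setT (EFin \o (fun w => dB z.1 w * dB z.2 w)) /\
    (\int[P]_w (dB z.1 w * dB z.2 w)%:E = (s2 * ov z.1 z.2)%:E)%E.
  move=> [/(in_step pab)[h1 h2 h3] /(in_step pab)[h4 h5 h6]].
  pose Q' (e : R * (R * R)) := 0 <= e.2.1 /\ 0 <= e.2.2.
  have [//||||h7 h8] := @integral_lincomb R _ _ P setT _ (pol z) (fun e => e.1)
    (fun e => s2 * `|e.2.2 - e.2.1|) (fun e w => (B e.2.2 w - B e.2.1 w) ^+ 2) Q'.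
  - by move=> e [e1 e2]; have [] := increment_sqr hB e1 e2.
  - by move=> e [e1 e2]; have [] := increment_sqr hB e1 e2.
  - move=> e; rewrite !inE => /or4P[] /eqP ->; rewrite /Q'/=; split; lra.
  move: h7 h8; have -> : (fun w => \sum_(e <- pol z) e.1 * (B e.2.2 w - B e.2.1 w) ^+ 2) =
      (fun w => dB z.1 w * dB z.2 w).
    by apply/funext => w; rewrite /pol !big_cons big_nil/= /dB; field.
  have -> : \sum_(e <- pol z) e.1 * (s2 * `|e.2.2 - e.2.1|) = s2 * ov z.1 z.2.
    by rewrite /pol !big_cons big_nil/= /ov; ring.
  move=> h7 <-; split=> //; apply: eq_integral => w _.
  by congr EFin; rewrite /pol !big_cons big_nil/= /dB; field.
have [|||_] := @integral_lincomb R _ _ P setT _ pp cc (fun z => s2 * ov z.1 z.2)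
    (fun z w => dB z.1 w * dB z.2 w) Q _ _ _ ppQ => //.
- by move=> z /polE [].
- by move=> z /polE [].
rewrite L -[gauss_moment2 R]fineK ?gauss_moment2_fin// -EFinM mulr_sumr.
have -> : \sum_(i <- pp) s2 * (cc i * ov i.1 i.2) =
    \sum_(i <- pp) cc i * (s2 * ov i.1 i.2).
  by apply: eq_bigr => i _; ring.
move=> <-; apply: eq_integral => w _.
by rewrite /step_integral sqr_pairs.
Qed.

Lemma measurable_step_integral p :
  measurable_fun setT (step_integral (fun t => B t) p).
Proof.
apply: measurable_sum => q; apply: measurable_funM => //.
exact: measurable_funB.
Qed.

Lemma measurable_step_fun (p : seq (R * R * R)) : measurable_fun setT (step_fun p).
Proof.
by apply: measurable_sum => q; apply: measurable_funM.
Qed.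

Let step_sub (p q : seq (R * R * R)) := p ++ [seq (e.1, - e.2) | e <- q].

Let step_sub_in a b p q : step_in a b p -> step_in a b q -> step_in a b (step_sub p q).
Proof. by move=> hp hq; rewrite /step_in all_cat all_map; apply/andP. Qed.

Let step_sub_fun p q s : step_fun (step_sub p q) s = step_fun p s - step_fun q s.
Proof.
rewrite /step_fun big_cat big_map/= -sumrN; congr (_ + _).
by apply: eq_bigr => e _; rewrite mulNr.
Qed.

Let step_sub_integral p q w : step_integral (fun t => B t) (step_sub p q) w =
  step_integral (fun t => B t) p w - step_integral (fun t => B t) q w.
Proof.
rewrite /step_integral big_cat big_map/= -sumrN; congr (_ + _).
by apply: eq_bigr => e _; rewrite mulNr.
Qed.

Let ge0_integral_sqrD (d' : measure_display) (U : measurableType d')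
    (mu : {measure set U -> \bar R}) (D : set U) (f g h : U -> R) :
  measurable D -> measurable_fun D f -> measurable_fun D g ->
  (forall x, D x -> h x = f x + g x) ->
  (\int[mu]_(x in D) ((h x) ^+ 2)%:E <=
   2%:E * \int[mu]_(x in D) ((f x) ^+ 2)%:E + 2%:E * \int[mu]_(x in D) ((g x) ^+ 2)%:E)%E.
Proof.
move=> mD mf mg hfg.
have mf2 : measurable_fun D (fun x => ((f x) ^+ 2)%:E).
  by apply/measurable_EFinP; exact: measurable_funX.
have mg2 : measurable_fun D (fun x => ((g x) ^+ 2)%:E).
  by apply/measurable_EFinP; exact: measurable_funX.
have ge0 (k : U -> R) x : (0 <= ((k x) ^+ 2)%:E)%E by rewrite lee_fin sqr_ge0.
rewrite -!ge0_integralZl// -ge0_integralD//; last 4 first.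
- by move=> x _; rewrite mule_ge0// lee_fin.
- exact: emeasurable_funM.
- by move=> x _; rewrite mule_ge0// lee_fin.
- exact: emeasurable_funM.
apply: ge0_le_integral => //.
- apply: (eq_measurable_fun (fun x => ((f x + g x) ^+ 2)%:E)).
    by move=> x /set_mem Dx; rewrite hfg.
  by apply/measurable_EFinP; apply: measurable_funX; exact: measurable_funD.
- by apply: emeasurable_funD; exact: emeasurable_funM.
move=> x Dx; rewrite hfg// -!EFinM -EFinD lee_fin.
by have := sqr_ge0 (f x - g x); rewrite !expr2; nra.
Qed.

(** The step integral of [p] is compared with those of the approximating sequence by the isometry,
    then the sequence is sent to its limit. Two uses of [(x + y) ^+ 2 <= 2 * x ^+ 2 + 2 * y ^+ 2]
    produce the 4. *)
Lemma wiener_integral_dist (a b : R) (f : R -> R) (X : {RV P >-> R})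
    (p : seq (R * R * R)) : 0 <= a -> step_in a b p -> is_wiener_integral B a b f X ->
  (\int[P]_w ((step_integral (fun t => B t) p w - X w) ^+ 2)%:E <=
   4%:E * (gauss_moment2 R * \int[lebesgue_measure]_(s in `[a, b]) ((step_fun p s - f s) ^+ 2)%:E))%E.
Proof.
move=> a0 pab [mf [pn [pnab fcvg Xcvg]]].
set c := (\int[lebesgue_measure]_(s in `[a, b]) ((step_fun p s - f s) ^+ 2)%:E)%E.
pose u n := (\int[lebesgue_measure]_(s in `[a, b]) ((step_fun (pn n) s - f s) ^+ 2)%:E)%E.
pose v n := ('E_P[fun w => ((step_integral (fun t => B t) (pn n) w - X w) ^+ 2)%R])%E.
have s20 := gauss_moment2_ge0 R.
have mdiff p' : measurable_fun (`[a, b]%classic : set R) (fun s => step_fun p' s - f s).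
  by apply: measurable_funB => //; apply: measurable_funTS; exact: measurable_step_fun.
have bound n : (\int[P]_w ((step_integral (fun t => B t) p w - X w) ^+ 2)%:E <=
    2%:E * (gauss_moment2 R * (2%:E * c + 2%:E * u n)) + 2%:E * v n)%E.
  apply: (@le_trans _ _ (2%:E * \int[P]_w ((step_integral (fun t => B t) (step_sub p (pn n)) w) ^+ 2)%:E +
    2%:E * v n)%E).
    rewrite /v unlock; apply: ge0_integral_sqrD => //.
    - exact: measurable_step_integral.
    - by apply: measurable_funB => //; exact: measurable_step_integral.
    - by move=> w _; rewrite step_sub_integral; ring.
  apply: leeD => //; apply: lee_wpmul2l => //.
  rewrite (step_integral_sqr a0 (step_sub_in pab (pnab n))).
  apply: lee_wpmul2l => //.
  have mN : measurable_fun (`[a, b]%classic : set R) (fun s => - (step_fun (pn n) s - f s)).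
    exact: measurableT_comp.
  apply: (le_trans (@ge0_integral_sqrD _ _ (@lebesgue_measure R) `[a, b]%classic
    (fun s => step_fun p s - f s) (fun s => - (step_fun (pn n) s - f s))
    (step_fun (step_sub p (pn n))) _ (mdiff p) mN _)) => //.
    by move=> s _; rewrite step_sub_fun; ring.
  apply: leeD => //; apply: lee_wpmul2l => //.
  by under eq_integral do rewrite sqrrN.
have cvgb : (2%:E * (gauss_moment2 R * (2%:E * c + 2%:E * u n)) + 2%:E * v n)%E @[n --> \oo] -->
    (2%:E * (gauss_moment2 R * (2%:E * c + 2%:E * 0)) + 2%:E * 0)%E.
  have s2fin := gauss_moment2_fin R.
  apply: cvgeD; first by rewrite mule0 fin_num_adde_defl.
    apply: cvgeZl => //; apply: cvgeZl => //; apply: cvgeD.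
    - by rewrite mule0 fin_num_adde_defl.
    - exact: cvg_cst.
    - by apply: cvgeZl.
  by apply: cvgeZl.
have -> : (4%:E * (gauss_moment2 R * c) =
    2%:E * (gauss_moment2 R * (2%:E * c + 2%:E * 0)) + 2%:E * 0)%E.
  rewrite !mule0 !adde0 [in RHS](muleCA (gauss_moment2 R)) [RHS]muleA -EFinM.
  by congr (_%:E * _)%E; ring.
rewrite -(cvg_lim _ cvgb)//; apply: lime_ge; first exact: cvgP cvgb.
exact: nearW.
Qed.

End wiener.

Lemma dist_expRN_le (R : realType) (a b : R) : 0 <= a -> 0 <= b ->
  `|expR (- a) - expR (- b)| <= `|a - b|.
Proof.
wlog ab : a b / a <= b.
  move=> H a0 b0; have [ab|/ltW ba] := leP a b; first exact: H.
  by rewrite distrC [leRHS]distrC H.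
move=> a0 b0; rewrite ger0_norm ?subr_ge0 ?ler_expR ?lerN2// distrC ger0_norm ?subr_ge0//.
have -> : - b = - a + - (b - a) by ring.
rewrite expRD; have e1 : expR (- a) <= 1 by rewrite -expR0 ler_expR oppr_le0.
have e0 := expR_gt0 (- a); have e2 := expR_ge1Dx (- (b - a)).
by have := expR_gt0 (- (b - a)); nra.
Qed.

Section grid.
Variable R : realType.

(** The integrand at the right endpoint of cell [k], divided by the square root of [N] because
    [grid_increment] is normalized to a standard normal. For fixed [t] the values are geometric in
    [k], which is where the Szego kernel comes from. *)
Definition grid_row (N : nat) (t : R) (k : nat) : R :=
  expR (- (t * (k.+1%:R / N%:R))) / Num.sqrt N%:R.

Definition grid_steps (N : nat) (t : R) : seq (R * R * R) :=
  [seq (k%:R / N%:R, k.+1%:R / N%:R, expR (- (t * (k.+1%:R / N%:R)))) | k <- iota 0 N].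

Lemma grid_steps_in N t : (0 < N)%N -> step_in 0 1 (grid_steps N t).
Proof.
move=> N0; have NR : 0 < (N%:R : R) by rewrite ltr0n.
apply/allP => _ /mapP[k + ->] /=; rewrite mem_iota add0n => /andP[_ kN].
by rewrite divr_ge0//= ler_pM2r ?invr_gt0// ler_nat leqnSn ler_pdivrMr// mul1r ler_nat.
Qed.

Lemma grid_cells (N n : nat) (s : R) : (0 < N)%N ->
  \sum_(k <- iota 0 n) \1_(`]k%:R / N%:R, k.+1%:R / N%:R]) s =
  \1_(`](0 : R), n%:R / N%:R]) s :> R.
Proof.
move=> N0; have NR : 0 < (N%:R : R) by rewrite ltr0n.
elim: n => [|n IH].
  rewrite big_nil mul0r indicE memNset//= in_itv/=; lra.
rewrite -addn1 iotaD big_cat/= IH add0n addn1 big_seq1 !indicE.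
have le_n : (n%:R / N%:R : R) <= n.+1%:R / N%:R by rewrite ler_pM2r ?invr_gt0// ler_nat.
have n0 : 0 <= (n%:R / N%:R : R) by rewrite divr_ge0.
have E (u v : R) : (s \in `]u, v]%classic) = (u < s <= v).
  by apply/idP/idP; rewrite inE/= in_itv.
rewrite !E.
have [sn|ns] := leP s (n%:R / N%:R).
  by rewrite andbT addr0 (le_trans sn le_n) andbT.
by rewrite andbF add0r (le_lt_trans n0 ns).
Qed.

Lemma grid_steps_dist (N : nat) (t s : R) : (0 < N)%N -> 0 <= t -> 0 < s <= 1 ->
  `|step_fun (grid_steps N t) s - expR (- (s * t))| <= t / N%:R.
Proof.
move=> N0 t0 /andP[s0 s1]; have NR : 0 < (N%:R : R) by rewrite ltr0n.
have one : \sum_(k <- iota 0 N) \1_(`]k%:R / N%:R, k.+1%:R / N%:R]) s = 1 :> R.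
  by rewrite grid_cells// divff ?gt_eqF// indicE mem_set//= in_itv/= s0 s1.
have sumE (x : R) :
    x = \sum_(k <- iota 0 N) x * \1_(`]k%:R / N%:R, k.+1%:R / N%:R]) s.
  by rewrite -mulr_sumr one mulr1.
rewrite /step_fun big_map/= [X in _ - X]sumE -sumrB [leRHS]sumE.
apply: (le_trans (ler_norm_sum _ _ _)); apply: ler_sum => k _.
rewrite -mulrBl normrM !indicE; case: (boolP (s \in _)) => [|_]; last first.
  by rewrite normr0 !mulr0.
rewrite inE/= in_itv/= => /andP[ks sk]; rewrite normr1 !mulr1.
have k0 : 0 <= (k.+1%:R / N%:R : R) by rewrite divr_ge0.
apply: (le_trans (dist_expRN_le _ _)); [exact: mulr_ge0|exact: mulr_ge0 (ltW _) _|].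
rewrite (mulrC s) -mulrBr normrM ger0_norm// ler_wpM2l// ger0_norm ?subr_ge0//.
rewrite lerBlDr addrC -lerBlDr (le_trans _ (ltW ks))//.
by rewrite -natr1 mulrDl mul1r addrK.
Qed.

Lemma grid_steps_L2 (N : nat) (t : R) : (0 < N)%N -> 0 <= t ->
  (\int[lebesgue_measure]_(s in `[0%R, 1%R])
    ((step_fun (grid_steps N t) s - expR (- (s * t))) ^+ 2)%:E <= ((t / N%:R) ^+ 2)%:E)%E.
Proof.
move=> N0 t0.
have mf : measurable_fun setT
    (fun s : R => ((step_fun (grid_steps N t) s - expR (- (s * t))) ^+ 2)%:E).
  apply/measurable_EFinP; apply: measurable_funX; apply: measurable_funB.
    exact: measurable_step_fun.
  by apply: measurableT_comp => //; apply: measurableT_comp => //; exact: measurable_funM.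
(* The cells are open on the left and miss the point 0, a null set. *)
rewrite -integral_itv_obnd_cbnd; last exact: measurable_funTS.
have -> : ((t / N%:R) ^+ 2)%:E =
    (\int[lebesgue_measure]_(s in `]0%R, 1%R]) ((t / N%:R) ^+ 2)%:E)%E.
  by rewrite integral_cst//= lebesgue_measure_itv/= lte01 oppr0 adde0 mule1.
apply: ge0_le_integral => //.
- by move=> s _; rewrite lee_fin sqr_ge0.
- exact: measurable_funTS.
- move=> s /=; rewrite in_itv/= => s01; rewrite lee_fin -real_normK ?num_real//.
  rewrite ler_pXn2r ?nnegrE ?divr_ge0//; exact: grid_steps_dist.
Qed.

End grid.

Section approx.
Variables (R : realType) (d : measure_display) (T : measurableType d).
Variables (P : probability T R) (B X : R -> {RV P >-> R}).
Hypothesis hB : standard_brownian_motion B.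
Hypothesis hX : laplace_wiener_process B X.

Definition grid_laplace (N : nat) (t : R) (w : T) : R :=
  \sum_(k < N) grid_row N t k * grid_increment B N k w.

Lemma grid_steps_integral N t w : (0 < N)%N ->
  step_integral (fun t => B t) (grid_steps N t) w = grid_laplace N t w.
Proof.
move=> N0; have sN : Num.sqrt (N%:R : R) != 0 by rewrite gt_eqF// sqrtr_gt0 ltr0n.
rewrite /step_integral big_map/= -[N in iota 0 N]subn0 -/(index_iota 0 N) big_mkord.
by apply: eq_bigr => k _; rewrite /grid_row /grid_increment [RHS]mulrA divfK.
Qed.

Lemma measurable_grid_laplace N t : measurable_fun setT (grid_laplace N t).
Proof.
apply: measurable_sum => k; apply: measurable_funM => //.
by apply: measurable_funM => //; exact: measurable_funB.
Qed.

Lemma grid_laplace_tail (N : nat) (t eta : R) : (0 < N)%N -> 0 <= t -> 0 < eta ->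
  (P [set w | (eta < `|grid_laplace N t w - X t w|)%R] <=
   (4 * fine (gauss_moment2 R) * (t / N%:R) ^+ 2 / eta ^+ 2)%:E)%E.
Proof.
move=> N0 t0 eta0; have [hW _] := hX.
have mY : measurable_fun setT (fun w => grid_laplace N t w - X t w).
  by apply: measurable_funB => //; exact: measurable_grid_laplace.
rewrite mulrC EFinM lee_pdivlMl ?exprn_gt0//.
apply: (le_trans (markov_sqr P (ltW eta0) mY)).
under eq_integral do rewrite -grid_steps_integral//.
apply: (le_trans (wiener_integral_dist hB (lexx 0) (grid_steps_in t N0) (hW t t0))).
rewrite -mulrA EFinM; apply: lee_wpmul2l => //.
rewrite EFinM fineK ?gauss_moment2_fin//; apply: lee_wpmul2l.
  exact: gauss_moment2_ge0.
exact: grid_steps_L2.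
Qed.

Lemma slab_approx (n : nat) (a b : nat -> T -> R) (delta eps : R) :
  (forall i, measurable_fun setT (a i)) -> (forall i, measurable_fun setT (b i)) ->
  (P [set w | forall i, (i < n)%N -> (`|a i w| <= delta)%R] <=
   P [set w | forall i, (i < n)%N -> (`|b i w| <= delta + eps)%R] +
   \sum_(i < n) P [set w | (eps < `|a i w - b i w|)%R])%E.
Proof.
move=> ma mb.
have mS (f : nat -> T -> R) e m : (forall i, measurable_fun setT (f i)) ->
    measurable [set w | forall i, (i < m)%N -> (`|f i w| <= e)%R].
  move=> mf.
  have -> : [set w | forall i, (i < m)%N -> (`|f i w| <= e)%R] =
      \bigcap_(i in [set i | (i < m)%N]) (f i @^-1` [set x | `|x| <= e]).
    by apply/seteqP; split => w /=.
  apply: bigcap_measurableType => i _.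
  by rewrite -[X in measurable X]setTI; apply: mf => //; exact: measurable_norm_le.
have mD i : measurable [set w | (eps < `|a i w - b i w|)%R].
  rewrite (_ : [set _ | _] = (fun w => `|a i w - b i w|%R) @^-1` `]eps, +oo[); last first.
    by apply/seteqP; split => w /=; rewrite in_itv/= andbT.
  rewrite -[X in measurable X]setTI; apply: measurableT_comp => //.
  exact: measurable_funB.
have mU m : measurable (\big[setU/set0]_(i < m) [set w | (eps < `|a i w - b i w|)%R]).
  exact: bigsetU_measurable.
apply: (@le_trans _ _ (P ([set w | forall i, (i < n)%N -> (`|b i w| <= delta + eps)%R] `|`
   \big[setU/set0]_(i < n) [set w | (eps < `|a i w - b i w|)%R]))).
  apply: le_measure; rewrite ?inE.
  - exact: mS.
  - by apply: measurableU => //; exact: mS.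
  move=> w /= aw; case: (pselect (exists2 i, (i < n)%N & (eps < `|a i w - b i w|)%R)).
    move=> [i ni h]; right.
    by rewrite -(bigcup_mkord n (fun i => [set w | (eps < `|a i w - b i w|)%R])); exists i.
  move=> h; left => i ni; have [//|lt] := leP `|b i w| (delta + eps).
  exfalso; apply: h; exists i => //.
  have := aw i ni; have := ler_distD (a i w) (b i w) 0.
  rewrite !subr0 distrC => h1 h2; lra.
apply: (le_trans (measureU2 _ _ _)) => //; first exact: mS.
apply: leeD => //.
elim: n => [|m IHm]; first by rewrite !big_ord0 measure0.
rewrite !big_ord_recr/=; apply: (le_trans (measureU2 _ _ _)) => //.
  exact: mU.
exact: leeD.
Qed.

End approx.

(** * Sums of log ((1 + x) / (1 - x)) *)

Lemma is_derive_ge0_le (R : realType) (f f' : R -> R) (a b : R) : a <= b ->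
  (forall x, a <= x <= b -> is_derive x 1 f (f' x)) ->
  (forall x, a <= x <= b -> 0 <= f' x) -> f a <= f b.
Proof.
move=> ab df f'0.
apply: (@ger0_derive1_ndecr R f a b) => //.
- move=> x; rewrite in_itv/= => /andP[ax xb].
  by have [] := df x _; rewrite ?(ltW ax) ?(ltW xb).
- move=> x; rewrite in_itv/= => /andP[ax xb].
  have axb : a <= x <= b by rewrite (ltW ax) (ltW xb).
  by rewrite derive1E; have [_ ->] := df x axb; exact: f'0.
- apply: derivable_within_continuous => x; rewrite in_itv/= => axb.
  by have [] := df x axb.
Qed.

(** [sinh x / x] increases: the derivative in [x] of [a sinh (b x) - b sinh (a x)] is a nonnegative
    multiple of [cosh (b x) - cosh (a x)]. *)
Lemma sinh_ratio_le (R : realType) (a b : R) : 0 <= a -> a <= b ->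
  (expR a - expR (- a)) * b <= a * (expR b - expR (- b)).
Proof.
move=> a0 ab.
pose f (x : R) := a * (expR (b * x) - expR (- (b * x))) - b * (expR (a * x) - expR (- (a * x))).
pose f' (x : R) := a * b * (expR (b * x) + expR (- (b * x)) - expR (a * x) - expR (- (a * x))).
have : f 0 <= f 1.
  apply: (@is_derive_ge0_le R f f') => // x /andP[x0 x1].
    by apply: is_derive_eq; rewrite /f' /GRing.scale/=; ring.
  have abx : a * x <= b * x by rewrite ler_wpM2r.
  have ax0 : 0 <= a * x by rewrite mulr_ge0.
  apply: mulr_ge0; first by rewrite mulr_ge0// (le_trans a0).
  set u := a * x in abx ax0 *; set v := b * x in abx *.
  have -> : expR v + expR (- v) - expR u - expR (- u) =
      (expR v - expR u) * (1 - expR (- v) * expR (- u)).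
    by rewrite !expRN; field; rewrite !gt_eqF ?expR_gt0.
  apply: mulr_ge0; rewrite subr_ge0 ?ler_expR//.
  by rewrite -expRD -expR0 ler_expR; lra.
rewrite /f !mulr0 oppr0 expR0 subrr !mulr0 subrr !mulr1; lra.
Qed.

(** A contraction of Schwarz-Pick type for the map [expR (- p)] from the half-line to the unit
    interval. Up to sign the left-hand quotient is [sinh ((q - p) / 2) / sinh ((p + q) / 2)], so
    [sinh_ratio_le] concludes. *)
Lemma blaschke_exp_le (R : realType) (p q : R) : 0 < p -> 0 < q ->
  `|(expR (- p) - expR (- q)) / (1 - expR (- p) * expR (- q))| <= `|(p - q) / (p + q)|.
Proof.
wlog pq : p q / p <= q.
  move=> H p0 q0; have [pq|/ltW qp] := leP p q; first exact: H.
  have := H _ _ qp q0 p0; rewrite !normrM (mulrC (expR (- q))) (addrC q p).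
  by rewrite distrC (distrC q p).
move=> p0 q0; have e1 : expR (- p) * expR (- q) < 1.
  by rewrite -expRD -expR0 ltr_expR; lra.
have pq0 : 0 < p + q by rewrite addr_gt0.
rewrite ger0_norm; last first.
  by rewrite divr_ge0 ?subr_ge0 ?ler_expR ?lerN2// ltW.
rewrite normrM distrC normfV (ger0_norm (_ : 0 <= q - p)) ?subr_ge0//.
rewrite gtr0_norm// ler_pdivrMr ?subr_gt0// mulrAC ler_pdivlMr//.
have := @sinh_ratio_le R ((q - p) / 2) ((p + q) / 2).
have -> : 0 <= (q - p) / 2 by lra.
have -> : (q - p) / 2 <= (p + q) / 2 by lra.
move=> /(_ isT isT) h.
have E : 0 < expR (- ((p + q) / 2)) by exact: expR_gt0.
rewrite -(ler_pM2r E) in h.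
have e2 : expR ((q - p) / 2) * expR (- ((p + q) / 2)) = expR (- p).
  by rewrite -expRD; congr expR; field.
have e3 : expR (- ((q - p) / 2)) * expR (- ((p + q) / 2)) = expR (- q).
  by rewrite -expRD; congr expR; field.
have e4 : expR ((p + q) / 2) * expR (- ((p + q) / 2)) = 1.
  by rewrite -expRD -expR0; congr expR; field.
have e5 : expR (- ((p + q) / 2)) * expR (- ((p + q) / 2)) = expR (- p) * expR (- q).
  by rewrite -!expRD; congr expR; field.
have l1 : (expR (- p) - expR (- q)) * ((p + q) / 2) =
   (expR ((q - p) / 2) - expR (- ((q - p) / 2))) * ((p + q) / 2) * expR (- ((p + q) / 2)).
  by rewrite -e2 -e3; ring.
have l2 : (q - p) / 2 * (1 - expR (- p) * expR (- q)) =
   (q - p) / 2 * (expR ((p + q) / 2) - expR (- ((p + q) / 2))) * expR (- ((p + q) / 2)).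
  by rewrite -[RHS]mulrA [X in _ = _ * X]mulrBl e4 e5.
rewrite -l1 -l2 in h; lra.
Qed.

(** * The sum of the inverse odd squares *)

Section basel.
Variable R : realType.
Implicit Type x : R.

Lemma sin_le_id x : 0 <= x -> sin x <= x.
Proof.
move=> x0; pose f (y : R) := y - sin y.
suff : f 0 <= f x by rewrite /f sin0; lra.
by apply: (@is_derive_ge0_le R f (fun y => 1 - cos y)) => // y _; rewrite subr_ge0 cos_le1.
Qed.

Lemma mul_cos_le_sin x : 0 <= x <= pi -> x * cos x <= sin x.
Proof.
move=> /andP[x0 xpi]; pose f (y : R) := sin y - y * cos y.
suff : f 0 <= f x by rewrite /f sin0 mul0r subr0; lra.
apply: (@is_derive_ge0_le R f (fun y => y * sin y)) => // y /andP[y0 yx].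
  by apply: is_derive_eq; rewrite /GRing.scale/=; ring.
by rewrite mulr_ge0// sin_ge0_pi// y0 (le_trans yx).
Qed.

Let csc2 x := (sin x ^+ 2)^-1.

Let csc2_bounds x : 0 < x < pi / 2 -> (x ^+ 2)^-1 <= csc2 x <= (x ^+ 2)^-1 + 1.
Proof.
move=> /andP[x0 xpi]; have pi0 := pi_gt0 R.
have xpi2 : x <= pi by lra.
have s0 : 0 < sin x by rewrite sin_gt0_pi// x0; lra.
have c0 : 0 <= cos x by rewrite cos_ge0_pihalf//; apply/andP; split; lra.
have h1 := sin_le_id (ltW x0); have := @mul_cos_le_sin x; rewrite (ltW x0) xpi2 => /(_ isT) h2.
apply/andP; split.
  by rewrite /csc2 lef_pV2 ?posrE ?exprn_gt0// ler_pXn2r ?nnegrE//; exact: ltW.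
have -> : csc2 x = cos x ^+ 2 / sin x ^+ 2 + 1.
  rewrite /csc2 -[X in _ + X](divff (x := sin x ^+ 2)) ?expf_neq0 ?gt_eqF//.
  by rewrite -mulrDl cos2Dsin2 mul1r.
rewrite lerD2r ler_pdivrMr ?exprn_gt0// mulrC ler_pdivlMr ?exprn_gt0//.
rewrite -exprMn ler_pXn2r ?nnegrE ?mulr_ge0//; [|exact: ltW..].
by rewrite mulrC.
Qed.

Let csc2_half x : sin x != 0 ->
  4 * csc2 x = csc2 (x / 2) + csc2 (pi / 2 - x / 2).
Proof.
move=> sx.
have e : sin x = 2 * (sin (x / 2) * cos (x / 2)).
  by rewrite {1}(_ : x = x / 2 + x / 2) ?sinD; [ring|field].
have [s0 c0] : sin (x / 2) != 0 /\ cos (x / 2) != 0.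
  by move: sx; rewrite e mulf_eq0 negb_or mulf_eq0 negb_or => /andP[_ /andP[]].
rewrite /csc2 sinB cos_pihalf sin_pihalf mul0r subr0 mul1r e.
have := cos2Dsin2 (x / 2) => cs.
transitivity ((cos (x / 2) ^+ 2 + sin (x / 2) ^+ 2) / (sin (x / 2) ^+ 2 * cos (x / 2) ^+ 2)).
  by rewrite cs; field; rewrite s0 c0.
by field; rewrite s0 c0.
Qed.

Let angle (n k : nat) : R := (2 * k%:R + 1) * pi / 2 ^+ n.+2.

Let angle_pi m k : (k < 2 ^ m)%N -> 0 < angle m k < pi / 2.
Proof.
have pi0 := pi_gt0 R.
move=> km; rewrite /angle; have p2' : 0 < (2 : R) ^+ m.+2 by rewrite exprn_gt0.
have k1 : 2 * k%:R + 1 < (2 : R) ^+ m.+1.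
  have : (2 * k + 1 < 2 ^ m.+1)%N by rewrite expnS; lia.
  by rewrite -(ltr_nat R) natrD natrM natrX.
apply/andP; split.
  by rewrite divr_gt0// mulr_gt0//; have := ler0n R k; lra.
rewrite ltr_pdivrMr// (_ : pi / 2 * _ = pi * 2 ^+ m.+1); last first.
  by rewrite (exprS 2 m.+1); field.
by rewrite mulrC ltr_pM2l.
Qed.

(** The duplication formula sends each angle of level [n] to its half and to the complement of that
    half; together these are the angles of level [n.+1]. The sum is multiplied by 4 each time,
    starting from the value 2 at [pi / 4]. *)
Let sum_csc2 n : \sum_(k < 2 ^ n) csc2 (angle n k) = 2 * 4 ^+ n.
Proof.
have pi0 := pi_gt0 R.
have p2 m : (2 : R) ^+ m != 0 by rewrite expf_neq0.
elim: n => [|n IH].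
  rewrite expn0 big_ord1 expr0 mulr1 /angle mulr0 add0r mul1r.
  have := csc2_half (x := pi / 2); rewrite sin_pihalf oner_eq0 => /(_ isT).
  have -> : pi / 2 - pi / 2 / 2 = pi / 2 / 2 :> R by field.
  have -> : pi / 2 / 2 = pi / 2 ^+ 2 :> R by field.
  rewrite {1}/csc2 sin_pihalf expr1n invr1; lra.
rewrite exprS mulrCA -IH mulr_sumr.
have -> : (2 ^ n.+1 = 2 ^ n + 2 ^ n)%N by rewrite expnS mul2n addnn.
rewrite big_split_ord/= [X in _ + X](reindex_inj rev_ord_inj)/= -big_split/=.
apply: eq_bigr => k _.
have /andP[a0 a1] := angle_pi (ltn_ord k).
rewrite csc2_half; last by rewrite gt_eqF// sin_gt0_pi// a0; lra.
congr (csc2 _ + csc2 _).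
  by rewrite /angle (exprS 2 n.+2); field; rewrite p2.
have -> : (2 ^ n + (2 ^ n - k.+1) = 2 ^ n.+1 - k.+1)%N.
  by rewrite expnS; have := ltn_ord k; lia.
rewrite /angle natrB; last by rewrite expnS; have := ltn_ord k; lia.
by rewrite natrX -natr1 !(exprS 2); field.
Qed.

Definition odd_basel (n : nat) : R := \sum_(k < n) ((2 * k%:R + 1) ^+ 2)^-1.

(** Replacing [csc2] by the inverse square changes each of the [2 ^ n] terms by at most 1; after
    division by [16 * 4 ^+ n / pi ^+ 2] the total error is [pi ^+ 2 / 16 / 2 ^+ n]. *)
Let basel_pow n :
  odd_basel (2 ^ n) <= pi ^+ 2 / 8 <= odd_basel (2 ^ n) + pi ^+ 2 / 16 / 2 ^+ n.
Proof.
have pi0 := pi_gt0 R; have pi20 : 0 < (pi : R) ^+ 2 by rewrite exprn_gt0.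
have p2 : 0 < (2 : R) ^+ n by rewrite exprn_gt0.
have e4 : (4 : R) ^+ n = 2 ^+ n * 2 ^+ n by rewrite -exprMn; congr (_ ^+ _); ring.
have k0 k : 2 * k%:R + 1 != 0 :> R by rewrite gt_eqF//; have := ler0n R k; lra.
have sumE : \sum_(k < 2 ^ n) (angle n k ^+ 2)^-1 =
    16 * 4 ^+ n / pi ^+ 2 * odd_basel (2 ^ n).
  rewrite /odd_basel mulr_sumr; apply: eq_bigr => k _.
  rewrite e4 /angle !(exprS 2); move: (pi : R) pi0 => p p0.
  by field; rewrite k0 !gt_eqF.
have lo : 16 * 4 ^+ n / pi ^+ 2 * odd_basel (2 ^ n) <= 2 * 4 ^+ n.
  rewrite -sumE -sum_csc2; apply: ler_sum => k _.
  by have /andP[] := csc2_bounds (angle_pi (ltn_ord k)).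
have hi : 2 * 4 ^+ n <= 16 * 4 ^+ n / pi ^+ 2 * odd_basel (2 ^ n) + 2 ^+ n.
  rewrite -sumE -sum_csc2.
  have -> : (2 : R) ^+ n = \sum_(k < 2 ^ n) 1 by rewrite sumr_const card_ord -natrX.
  rewrite -big_split/=; apply: ler_sum => k _.
  by have /andP[] := csc2_bounds (angle_pi (ltn_ord k)).
rewrite {}e4 in lo hi; set b := odd_basel _ in lo hi *; set u := 2 ^+ n in lo hi p2 *.
have c0 : 0 < pi ^+ 2 / (16 * (u * u)) by rewrite divr_gt0// !mulr_gt0.
rewrite -(ler_pM2l c0) in lo; rewrite -(ler_pM2l c0) in hi.
clear pi20 sumE; move: (pi : R) pi0 c0 lo hi => p p0 c0 lo hi.
have e1 : p ^+ 2 / (16 * (u * u)) * (16 * (u * u) / p ^+ 2 * b) = b.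
  by field; rewrite !gt_eqF.
have e2 : p ^+ 2 / (16 * (u * u)) * (2 * (u * u)) = p ^+ 2 / 8.
  by field; rewrite !gt_eqF.
rewrite e1 e2 in lo; rewrite mulrDr e1 e2 in hi.
rewrite lo (le_trans hi)// lerD2l le_eqVlt; apply/orP; left; apply/eqP.
by field; rewrite !gt_eqF.
Qed.

Let odd_basel_mono : {homo odd_basel : m n / (m <= n)%N >-> m <= n}.
Proof.
move=> m n mn.
rewrite /odd_basel (big_ord_widen _ (fun k : nat => ((2 * k%:R + 1) ^+ 2)^-1) mn).
by rewrite big_mkcond/=; apply: ler_sum => k _; case: ifP.
Qed.

Lemma odd_basel_le n : odd_basel n <= pi ^+ 2 / 8.
Proof.
have /andP[h _] := basel_pow n; apply: le_trans h.
by apply: odd_basel_mono; exact/ltnW/ltn_expl.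
Qed.

Lemma odd_basel_cvg : odd_basel n @[n --> \oo] --> pi ^+ 2 / 8.
Proof.
apply/cvgrPdist_le => e e0.
pose n := Num.bound (pi ^+ 2 / 16 / e).
have pi20 : 0 <= (pi : R) ^+ 2 by exact: sqr_ge0.
have ne : pi ^+ 2 / 16 / 2 ^+ n <= e.
  have h1 : pi ^+ 2 / 16 / e < n%:R.
    by apply: archi_boundP; rewrite !divr_ge0// ltW.
  have h2 : (n%:R : R) <= 2 ^+ n by rewrite -natrX ler_nat; exact/ltnW/ltn_expl.
  rewrite ltr_pdivrMr// in h1; rewrite ler_pdivrMr ?exprn_gt0//.
  by rewrite (le_trans (ltW h1))// mulrC ler_pM2l.
near=> m.
have hm : (2 ^ n <= m)%N by near: m; exists (2 ^ n)%N.
rewrite ger0_norm ?subr_ge0 ?odd_basel_le//.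
have /andP[_ h] := basel_pow n; have := odd_basel_mono hm; lra.
Unshelve. all: by end_near.
Qed.

End basel.

Section log_ratio.
Variable R : realType.
Implicit Types x h : R.

(** At [x = expR (- D)] this is [- ln (tanh (D / 2))], the logarithmic loss caused by a frequency at
    logarithmic distance [D]. *)
Definition log_ratio x : R := ln (1 + x) - ln (1 - x).

Definition log_ratio_series (K : nat) x : R :=
  \sum_(k < K) 2 / (2 * k%:R + 1) * x ^+ (2 * k).+1.

Let odd0 (k : nat) : 0 < 2 * k%:R + 1 :> R.
Proof. by have := ler0n R k; lra. Qed.

Let natr_odd (k : nat) : (2 * k).+1%:R = 2 * k%:R + 1 :> R.
Proof. by rewrite -[in LHS]addn1 natrD natrM. Qed.

Let is_derive_monomial (c : R) n x :
  is_derive x 1 (fun y : R => c * y ^+ n.+1) (c * n.+1%:R * x ^+ n).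
Proof.
have -> : (fun y : R => c * y ^+ n.+1) = c \*: (@id R ^+ n.+1).
  apply/funext => y; rewrite /GRing.scale/=; congr (_ * _).
  by elim: n => [|n IH]; rewrite ?expr1// exprS IH [in RHS]exprS.
apply: (is_derive_eq (is_deriveZ c (is_deriveX n.+1 (is_derive_id x 1)))).
by rewrite /GRing.scale/= mulr1 mulrA.
Qed.

Let is_derive_series K x : is_derive x 1 (log_ratio_series K)
  (\sum_(k < K) 2 * x ^+ (2 * k)).
Proof.
elim: K => [|K IH].
  have -> : log_ratio_series 0 = cst 0 by apply/funext => y; rewrite /log_ratio_series big_ord0.
  by rewrite big_ord0; exact: is_derive_cst.
have -> : log_ratio_series K.+1 =
    log_ratio_series K + (fun y : R => 2 / (2 * K%:R + 1) * y ^+ (2 * K).+1).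
  by apply/funext => y; rewrite /log_ratio_series big_ord_recr.
rewrite big_ord_recr/=; apply: is_deriveD.
apply: (is_derive_eq (is_derive_monomial _ _ _)).
by have k0 := odd0 K; rewrite natr_odd; field; rewrite gt_eqF.
Qed.

Let geom K x : (1 - x ^+ 2) * (\sum_(k < K) 2 * x ^+ (2 * k)) = 2 * (1 - x ^+ (2 * K)).
Proof.
elim: K => [|K IH]; first by rewrite big_ord0 mulr0 muln0 expr0 subrr mulr0.
rewrite big_ord_recr/= mulrDr IH mulnS exprD; ring.
Qed.

Let is_derive_log_ratio x : 0 <= x < 1 -> is_derive x 1 log_ratio (2 / (1 - x ^+ 2)).
Proof.
move=> /andP[x0 x1].
have p1 : 0 < 1 + x by lra.
have p2 : 0 < 1 - x by lra.
have d1 : is_derive x 1 (@ln R \o (fun y => 1 + y)) ((1 + x)^-1 * 1).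
  apply: is_derive1_comp; first exact: is_derive1_ln.
  rewrite -[X in is_derive _ _ _ X]add0r.
  exact: is_deriveD (is_derive_cst _ _ _) (is_derive_id _ _).
have d2 : is_derive x 1 (@ln R \o (fun y => 1 - y)) ((1 - x)^-1 * - 1).
  apply: is_derive1_comp; first exact: is_derive1_ln.
  rewrite -[X in is_derive _ _ _ X]sub0r.
  exact: is_deriveB (is_derive_cst _ _ _) (is_derive_id _ _).
apply: (is_derive_eq (is_deriveB d1 d2)).
by field; rewrite !gt_eqF//=; nra.
Qed.

Let lt1 x : 0 <= x < 1 -> 0 < 1 - x ^+ 2.
Proof. by move=> /andP[x0 x1]; rewrite subr_gt0 expr_lt1. Qed.

Lemma log_ratio_ge K x : 0 <= x < 1 -> log_ratio_series K x <= log_ratio x.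
Proof.
move=> x01; have /andP[x0 x1] := x01.
pose f y := log_ratio y - log_ratio_series K y.
have f0 : f 0 = 0.
  rewrite /f /log_ratio addr0 subr0 subrr sub0r /log_ratio_series big1 ?oppr0// => k _.
  by rewrite expr0n mulr0.
suff : f 0 <= f x by rewrite f0 /f subr_ge0.
apply: (@is_derive_ge0_le R f (fun y => 2 / (1 - y ^+ 2) - \sum_(k < K) 2 * y ^+ (2 * k))) => //.
  move=> y /andP[y0 yx]; apply: is_deriveB; last exact: is_derive_series.
  by apply: is_derive_log_ratio; rewrite y0 (le_lt_trans yx).
move=> y /andP[y0 yx].
have y01 : 0 <= y < 1 by rewrite y0 (le_lt_trans yx).
rewrite subr_ge0 ler_pdivlMr ?lt1// mulrC geom.
by have : 0 <= y ^+ (2 * K) by [rewrite exprn_ge0]; lra.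
Qed.

Lemma log_ratio_le K x : 0 <= x < 1 ->
  log_ratio x <= log_ratio_series K x +
    2 / (1 - x ^+ 2) / (2 * K%:R + 1) * x ^+ (2 * K).+1.
Proof.
move=> x01; have /andP[x0 x1] := x01; have X0 := lt1 x01.
pose c := 2 / (1 - x ^+ 2).
pose f (y : R) := log_ratio_series K y + c / (2 * K%:R + 1) * y ^+ (2 * K).+1 - log_ratio y.
have f0 : f 0 = 0.
  rewrite /f /log_ratio addr0 subr0 subrr subr0 expr0n mulr0 addr0.
  by rewrite /log_ratio_series big1// => k _; rewrite expr0n mulr0.
suff : f 0 <= f x by rewrite f0 /f subr_ge0.
apply: (@is_derive_ge0_le R f (fun y => \sum_(k < K) 2 * y ^+ (2 * k) + c * y ^+ (2 * K)
   - 2 / (1 - y ^+ 2))) => //.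
  move=> y /andP[y0 yx]; apply: is_deriveB; last first.
    by apply: is_derive_log_ratio; rewrite y0 (le_lt_trans yx).
  apply: is_deriveD; first exact: is_derive_series.
  apply: (is_derive_eq (is_derive_monomial _ _ _)).
  by have k0 := odd0 K; rewrite natr_odd; field; rewrite gt_eqF.
move=> y /andP[y0 yx].
have y01 : 0 <= y < 1 by rewrite y0 (le_lt_trans yx).
rewrite subr_ge0 ler_pdivrMr ?lt1// mulrC mulrDr geom.
have yK : 0 <= y ^+ (2 * K) by rewrite exprn_ge0.
suff : 2 * y ^+ (2 * K) <= (1 - y ^+ 2) * (c * y ^+ (2 * K)) by lra.
rewrite mulrA ler_wpM2r// /c mulrA ler_pdivlMr// mulrC ler_wpM2r//.
by rewrite lerB// ler_pXn2r ?nnegrE.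
Qed.

Lemma log_ratio_cvg x : 0 <= x < 1 -> log_ratio_series K x @[K --> \oo] --> log_ratio x.
Proof.
move=> x01; have /andP[x0 x1] := x01; have X0 := lt1 x01.
have h : log_ratio x - 2 / (1 - x ^+ 2) * x ^+ K @[K --> \oo] --> log_ratio x.
  rewrite -[X in _ --> X]subr0 -[X in _ --> _ - X](mulr0 (2 / (1 - x ^+ 2))).
  apply: cvgB; first exact: cvg_cst.
  by apply: cvgMr; apply: cvg_expr; rewrite ger0_norm.
apply: (squeeze_cvgr _ h (cvg_cst _)).
near=> K; rewrite log_ratio_ge// andbT lerBlDr.
apply: (le_trans (log_ratio_le K x01)); rewrite lerD2l -mulrA.
apply: ler_wpM2l; first by rewrite divr_ge0// ltW.
have k1 : 1 <= 2 * K%:R + 1 :> R by have := ler0n R K; lra.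
apply: (@le_trans _ _ (1 * x ^+ (2 * K).+1)).
  by rewrite ler_wpM2r ?exprn_ge0// invf_le1 // (lt_le_trans ltr01).
rewrite mul1r; apply: ler_wiXn2l => //; [exact: ltW|lia].
Unshelve. all: by end_near.
Qed.

Let geometric_sum (r : R) M : (1 - r) * (\sum_(m < M) r ^+ m.+1) = r - r ^+ M.+1.
Proof.
elim: M => [|M IH]; first by rewrite big_ord0 mulr0 expr1 subrr.
rewrite big_ord_recr/= mulrDr IH [r ^+ M.+2]exprS; ring.
Qed.

Let log_ratio_series_sum K M h :
  \sum_(m < M) log_ratio_series K (expR (- (m.+1%:R * h))) =
  \sum_(k < K) 2 / (2 * k%:R + 1) *
    \sum_(m < M) expR (- ((2 * k%:R + 1) * h)) ^+ m.+1.
Proof.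
rewrite exchange_big/=; apply: eq_bigr => k _.
rewrite mulr_sumr; apply: eq_bigr => m _; congr (_ * _).
by rewrite -!expRM_natr natr_odd; congr expR; ring.
Qed.

Let expRN01 (y : R) : 0 < y -> 0 <= expR (- y) < 1.
Proof. by move=> y0; rewrite expR_ge0 -expR0 ltr_expR oppr_lt0. Qed.

(** Expanding and summing over [m] first leaves geometric series of ratio [expR (- y)] with
    [y = (2 k + 1) h], each at most [1 / y]; the inverse odd squares then add up to
    [2 / h * (pi ^+ 2 / 8)]. *)
Lemma log_ratio_sum_le M h : 0 < h ->
  \sum_(m < M) log_ratio (expR (- (m.+1%:R * h))) <= pi ^+ 2 / (4 * h).
Proof.
move=> h0.
have cv : \sum_(m < M) log_ratio_series K (expR (- (m.+1%:R * h))) @[K --> \oo] -->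
    \sum_(m < M) log_ratio (expR (- (m.+1%:R * h))).
  elim: M => [|M IH].
    rewrite big_ord0 (_ : (fun K => _) = cst 0); first exact: cvg_cst.
    by apply/funext => K; rewrite big_ord0.
  rewrite big_ord_recr/= (_ : (fun K => _) = (fun K =>
    \sum_(m < M) log_ratio_series K (expR (- (m.+1%:R * h))) +
    log_ratio_series K (expR (- (M.+1%:R * h))))); last first.
    by apply/funext => K; rewrite big_ord_recr.
  apply: cvgD => //; apply: log_ratio_cvg; apply: expRN01.
  by rewrite mulr_gt0.
apply: (ler_cvg_to cv (cvg_cst _)); near=> K.
rewrite log_ratio_series_sum.
apply: (@le_trans _ _ (2 / h * odd_basel R K)); last first.
  apply: (@le_trans _ _ (2 / h * (pi ^+ 2 / 8))).
    by rewrite ler_wpM2l ?odd_basel_le// divr_ge0// ltW.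
  by rewrite le_eqVlt; apply/orP; left; apply/eqP; field; rewrite gt_eqF.
rewrite /odd_basel mulr_sumr; apply: ler_sum => k _.
have k0 := odd0 k; set y := (2 * k%:R + 1) * h.
have y0 : 0 < y by rewrite mulr_gt0.
have /andP[r0 r1] := expRN01 y0; set r := expR (- y) in r0 r1 *.
have ry : y * r <= 1 - r.
  have : (1 + y) * r <= expR y * r by rewrite ler_wpM2r// expR_ge1Dx.
  by rewrite /r -expRD subrr expR0; lra.
rewrite (_ : 2 / h * _ = 2 / (2 * k%:R + 1) * y^-1); last first.
  by rewrite /y; field; rewrite !gt_eqF.
apply: ler_wpM2l; first by rewrite divr_ge0// ltW.
have r1' : 0 < 1 - r by lra.
rewrite -(ler_pM2l r1') geometric_sum ler_pdivlMr// mulrC.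
apply: le_trans ry; rewrite ler_wpM2l// ?(ltW y0)//.
by have := exprn_ge0 M.+1 r0; lra.
Unshelve. all: by end_near.
Qed.

(** Three errors, each at most [eta / 4]: the odd squares beyond [K], the 1 lost in
    [r / (1 - r) >= 1 / y - 1], and the truncation of the geometric series at [M]. *)
Lemma log_ratio_sum_ge (eta : R) : 0 < eta ->
  exists2 h0 : R, 0 < h0 & forall h, 0 < h < h0 -> exists M : nat,
    pi ^+ 2 / 2 - eta <= 2 * h * \sum_(m < M) log_ratio (expR (- (m.+1%:R * h))).
Proof.
move=> eta0.
have [K0 _ HK] : \forall K \near \oo, pi ^+ 2 / 8 - eta / 16 < odd_basel R K.
  apply: (@cvgr_gt _ _ _ _ _ _ (@odd_basel_cvg R)); lra.
pose K := K0.+1; have bK : pi ^+ 2 / 8 - eta / 16 < odd_basel R K by apply: HK => /=; lia.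
have Kp : 0 < K%:R :> R by rewrite ltr0n.
exists (eta / 16 / K%:R) => [|h /andP[h0 hh]]; first by rewrite !divr_gt0.
have hK : h * K%:R < eta / 16 by rewrite -ltr_pdivlMr.
have /andP[p0 p1] := expRN01 h0; set p := expR (- h) in p0 p1.
have p1' : 0 < 1 - p by lra.
have [M hM] : exists M, h * K%:R * (p ^+ M / (1 - p)) < eta / 16.
  have : h * K%:R * (p ^+ M / (1 - p)) @[M --> \oo] --> h * K%:R * (0 / (1 - p)).
    by apply: cvgMr; apply: cvgMl; apply: cvg_expr; rewrite ger0_norm.
  rewrite mul0r mulr0 => /(cvgr_lt 0)/(_ (eta / 16)) [|M _ HM]; first by lra.
  by exists M; apply: (HM M) => /=.
exists M.
apply: (@le_trans _ _ (2 * h * \sum_(m < M) log_ratio_series K (expR (- (m.+1%:R * h))))); last first.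
  rewrite ler_wpM2l ?mulr_ge0 ?(ltW h0)//; apply: ler_sum => m _.
  by apply: log_ratio_ge; apply: expRN01; rewrite mulr_gt0.
rewrite log_ratio_series_sum.
apply: (@le_trans _ _ (4 * odd_basel R K - 4 * (h * K%:R) -
    4 * (h * K%:R * (p ^+ M / (1 - p))))); first lra.
have -> : 4 * odd_basel R K - 4 * (h * K%:R) - 4 * (h * K%:R * (p ^+ M / (1 - p))) =
  \sum_(k < K) (4 * ((2 * k%:R + 1) ^+ 2)^-1 - 4 * h - 4 * h * (p ^+ M / (1 - p))).
  rewrite !sumrB -!mulr_sumr -/(odd_basel R K) !sumr_const card_ord.
  rewrite -(mulr_natr h) -(mulr_natr (1 - p)^-1).
  move: (odd_basel R K) (p ^+ M) (1 - p)^-1 (K%:R : R) => b s t k; ring.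
rewrite mulr_sumr; apply: ler_sum => k _.
have k0 := odd0 k; set y := (2 * k%:R + 1) * h.
have y0 : 0 < y by rewrite mulr_gt0.
have /andP[r0 r1] := expRN01 y0; set r := expR (- y) in r0 r1 *.
have r1' : 0 < 1 - r by lra.
have rp : r <= p by rewrite ler_expR lerN2 /y ler_peMl ?(ltW h0)//; have := ler0n R k; lra.
have sumE : \sum_(m < M) r ^+ m.+1 = (r - r ^+ M.+1) / (1 - r).
  by rewrite -geometric_sum mulrAC divff ?mul1r// gt_eqF.
have ry : 1 - r <= y by have := expR_ge1Dx (- y); rewrite -/r; lra.
have a1 : y^-1 - 1 <= r / (1 - r).
  have -> : r / (1 - r) = (1 - r)^-1 - 1 by field; rewrite gt_eqF.
  by rewrite lerD2r lef_pV2 ?posrE.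
have a2 : r ^+ M.+1 / (1 - r) <= p ^+ M / (1 - p).
  apply: ler_pM; rewrite ?exprn_ge0 ?invr_ge0 ?(ltW r1')//.
    apply: (@le_trans _ _ (r ^+ M)); first by apply: ler_wiXn2l => //; exact: ltW.
    by apply: lerXn2r; rewrite ?nnegrE.
  by rewrite lef_pV2 ?posrE//; lra.
apply: (@le_trans _ _ (4 * h / (2 * k%:R + 1) * (y^-1 - 1 - p ^+ M / (1 - p)))).
  rewrite !mulrBr mulr1.
  have -> : 4 * h / (2 * k%:R + 1) * y^-1 = 4 * ((2 * k%:R + 1) ^+ 2)^-1.
    by rewrite /y; field; rewrite !gt_eqF.
  have c1 : 4 * h / (2 * k%:R + 1) <= 4 * h.
    by rewrite ler_pdivrMr// ler_peMr ?mulr_ge0 ?(ltW h0)//; have := ler0n R k; lra.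
  have c2 : 4 * h / (2 * k%:R + 1) * (p ^+ M / (1 - p)) <= 4 * h * (p ^+ M / (1 - p)).
    by apply: ler_wpM2r => //; rewrite divr_ge0 ?exprn_ge0// ltW.
  lra.
rewrite sumE mulrBl.
have -> : 2 * h * (2 / (2 * k%:R + 1) * (r / (1 - r) - r ^+ M.+1 / (1 - r))) =
  4 * h / (2 * k%:R + 1) * (r / (1 - r) - r ^+ M.+1 / (1 - r)).
  by field; rewrite !gt_eqF.
by apply: ler_wpM2l; [rewrite divr_ge0 ?mulr_ge0// ltW|lra].
Qed.

End log_ratio.

(** * Small balls and finitely many frequencies *)

Section grid_lower.
Variable R : realType.

Definition blaschke (a y : R) : R := `|(y - a) / (y + a)|.

Lemma prod_blaschke_ge0 (tau : nat -> R) M y : 0 <= \prod_(l < M) blaschke (tau l) y.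
Proof. by apply: prodr_ge0 => i _; exact: normr_ge0. Qed.

Lemma grid_rowE N (y : R) (k : nat) :
  grid_row N (y - 1) k =
  expR (k.+1%:R / N%:R) / Num.sqrt N%:R * expR (- (y / N%:R)) ^+ k.+1.
Proof.
rewrite /grid_row -expRM_natr mulrAC -expRD; congr (expR _ / _).
by rewrite mulrBl mul1r -mulNr; ring.
Qed.

(* Shifting the frequencies by one costs the factor [expR 1], and keeps them
   away from [0]. *)
Lemma grid_row_dist N (tau : nat -> R) (M : nat) (y : R) : (0 < N)%N ->
  (forall i, 0 < tau i) ->
  (forall i j, (i < j)%N -> (j < M)%N -> tau i != tau j) -> 0 < y ->
  exists c : nat -> R,
   \sum_(k < N) (grid_row N (y - 1) k - \sum_(l < M) c l * grid_row N (tau l - 1) k) ^+ 2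
   <= (expR 1 / Num.sqrt y * \prod_(l < M) blaschke (tau l) y) ^+ 2.
Proof.
move=> N0 tau0 tau_inj y0.
have NR : 0 < N%:R :> R by rewrite ltr0n.
pose g (z : R) := expR (- (z / N%:R)).
have g01 z : 0 < z -> 0 < g z < 1.
  by move=> z0; rewrite expR_gt0 -expR0 ltr_expR oppr_lt0 divr_gt0.
have g_inj i j : (i < j)%N -> (j < M)%N -> g (tau i) != g (tau j).
  move=> ij jM; apply: contra (tau_inj _ _ ij jM) => /eqP/expR_inj/oppr_inj.
  by move/(mulIf (lt0r_neq0 _)) => ->; rewrite ?invr_gt0.
have [c Hc] := szego_dist (fun i => g01 _ (tau0 i)) g_inj (g01 _ y0).
exists c.
apply: (@le_trans _ _ (\sum_(k < N) expR 1 ^+ 2 / N%:R *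
    (g y ^+ k.+1 - \sum_(l < M) c l * g (tau l) ^+ k.+1) ^+ 2)).
  apply: ler_sum => k _.
  have -> : grid_row N (y - 1) k - \sum_(l < M) c l * grid_row N (tau l - 1) k =
     expR (k.+1%:R / N%:R) / Num.sqrt N%:R *
       (g y ^+ k.+1 - \sum_(l < M) c l * g (tau l) ^+ k.+1).
    rewrite grid_rowE mulrBr mulr_sumr; congr (_ - _); apply: eq_bigr => l _.
    by rewrite grid_rowE /g; ring.
  rewrite exprMn ler_wpM2r ?sqr_ge0// expr_div_n sqr_sqrtr ?ler0n//.
  rewrite ler_wpM2r ?invr_ge0 ?ler0n// ler_pXn2r ?nnegrE ?expR_ge0//.
  by rewrite ler_expR ler_pdivrMr// mul1r ler_nat.
rewrite -mulr_sumr.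
apply: le_trans (ler_wpM2l _ (Hc N)) _; first by rewrite divr_ge0 ?sqr_ge0 ?ler0n.
rewrite [leRHS]exprMn expr_div_n sqr_sqrtr ?(ltW y0)//.
(* [blaschke_exp_le] at scale [1 / N] replaces the Szego factors by Cauchy factors, in which [N]
   cancels. *)
have P1 : (\prod_(l < M) ((g y - g (tau l)) / (1 - g y * g (tau l)))) ^+ 2 <=
    (\prod_(l < M) blaschke (tau l) y) ^+ 2.
  rewrite -(real_normK (num_real _)) normr_prod.
  apply: lerXn2r; rewrite ?nnegrE ?prod_blaschke_ge0 ?prodr_ge0//.
  apply: ler_prod => l _; rewrite normr_ge0/=.
  apply: (le_trans (@blaschke_exp_le R (y / N%:R) (tau l / N%:R) _ _)); rewrite ?divr_gt0//.
  rewrite /blaschke le_eqVlt; apply/orP; left; apply/eqP; congr (`|_|).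
  by field; rewrite !gt_eqF ?addr_gt0.
have P2 : g y ^+ 2 / (1 - g y ^+ 2) <= N%:R / y.
  have /andP[gy0 gy1] := g01 _ y0.
  have g2 : g y ^+ 2 = expR (- (2 * (y / N%:R))) by rewrite -expRM_natr; congr expR; ring.
  have q0 : 0 < 1 - g y ^+ 2 by rewrite subr_gt0 expr_lt1// ltW.
  have := @expR_ge1Dx R (2 * (y / N%:R)).
  have z0 : 0 < y / N%:R by rewrite divr_gt0.
  rewrite -[N%:R / y]invf_div -[expR _]invrK -expRN -g2 ler_pdivrMr// mulrC.
  move: (y / N%:R) z0 => z z0; rewrite ler_pdivlMl//.
  have g0 : 0 < g y ^+ 2 by rewrite exprn_gt0.
  move: (g y ^+ 2) g0 q0 => p p0 q0.
  by rewrite -(ler_pM2r p0) mulVf ?gt_eqF//; lra.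
apply: (@le_trans _ _ (expR 1 ^+ 2 / N%:R *
   ((\prod_(l < M) blaschke (tau l) y) ^+ 2 * (N%:R / y)))).
  rewrite ler_wpM2l ?divr_ge0 ?sqr_ge0 ?ler0n// ler_pM ?sqr_ge0//.
  have /andP[gy0 gy1] := g01 _ y0.
  by rewrite divr_ge0 ?sqr_ge0// subr_ge0 exprn_ile1// ltW.
rewrite le_eqVlt; apply/orP; left; apply/eqP; field.
by rewrite !gt_eqF.
Qed.

Variables (d : measure_display) (T : measurableType d) (P : probability T R).
Variables (B : R -> {RV P >-> R}).
Hypothesis hB : standard_brownian_motion B.

(** There are as many pivots as grid cells, so every Gaussian coordinate receives a half-width
    [e j]. The left-hand side involves neither [u] nor [n], because the cost hypothesis covers all
    shifted frequencies [y = u + 1] at once. *)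
Lemma grid_laplace_ge (N : nat) (tau e : nat -> R) (delta : R) (u : nat -> R) (n : nat) :
  (0 < N)%N -> (forall i, 0 < tau i) ->
  (forall i j, (i < j)%N -> (j < N)%N -> tau i != tau j) ->
  (forall j, 0 <= e j) ->
  (forall y, 1 <= y -> \sum_(j < N) expR 1 / Num.sqrt y *
      (\prod_(l < j) blaschke (tau l) y) * e j <= delta) ->
  (forall i, (i < n)%N -> 0 <= u i) ->
  (\prod_(j < N) gauss [set x | (`|x| <= e j)%R] <=
   P [set w | forall i, (i < n)%N -> (`|grid_laplace B N (u i) w| <= delta)%R])%E.
Proof.
move=> N0 tau0 tau_inj e0 He u0.
(* Rows 0 to [N - 1] are the pivots, the next [n] rows the tested frequencies, which [I] selects. A
   pivot time [tau i - 1] may be negative; its row is used only as a vector. *)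
pose V (i : nat) (k : 'I_N) : R := if (i < N)%N then grid_row N (tau i - 1) k
  else grid_row N (u (i - N)%N) k.
pose r (i j : nat) : R := expR 1 / Num.sqrt (u (i - N)%N + 1) *
  \prod_(l < j) blaschke (tau l) (u (i - N)%N + 1).
pose I : set nat := [set i | (N <= i < N + n)%N].
have uI i : I i -> 1 <= u (i - N)%N + 1.
  by move=> /andP[Ni iN]; rewrite lerDr u0//; lia.
have iid := grid_increment_iid hB N N0.
apply: (le_trans (@gauss_rows_ge R d T P N _ V r e delta I iid e0 _ _ _)).
- by move=> i j; rewrite /r mulr_ge0 ?prod_blaschke_ge0// divr_ge0 ?expR_ge0.
- move=> i j Ii; have /andP[Ni _] := Ii.
  have [c Hc] := @grid_row_dist N tau j (u (i - N)%N + 1) N0 tau0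
     (fun i k ik kj => tau_inj _ _ ik (ltn_trans kj (ltn_ord j))) (lt_le_trans ltr01 (uI _ Ii)).
  exists c; apply: le_trans Hc; rewrite le_eqVlt; apply/orP; left; apply/eqP.
  apply: eq_bigr => k _; congr (_ ^+ 2); rewrite /V ltnNge Ni/= addrK; congr (_ - _).
  by apply: eq_bigr => l _; rewrite (ltn_trans (ltn_ord l) (ltn_ord j)).
- by move=> i Ii; exact: He (uI _ Ii).
apply: le_measure; rewrite ?inE.
- exact: (measurable_rows V delta I iid).
- exact: (measurable_rows (fun i (k : 'I_N) => grid_row N (u i) k) delta [set i | (i < n)%N] iid).
move=> w Hw i iN; have /= := Hw (N + i)%N; rewrite /I/= leq_addr ltn_add2l => /(_ iN).
rewrite /V ltnNge leq_addr/= [(N + i)%N]addnC; under eq_bigr do rewrite addnK.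
by [].
Qed.

End grid_lower.

(** * Countably many frequencies, and passage from the grid to the process *)

Section countable_reduction.
Variables (R : realType) (d : measure_display) (T : measurableType d).
Variables (P : probability T R) (B X : R -> {RV P >-> R}).
Hypothesis hX : laplace_wiener_process B X.

Definition nonneg_rat (n : nat) : R := `|ratr (odflt 0 (unpickle n : option rat))|.

Let nonneg_rat_ge0 n : 0 <= nonneg_rat n.
Proof. exact: normr_ge0. Qed.

Let nonneg_rat_dense (x y : R) : 0 <= x < y -> exists n, x < nonneg_rat n < y.
Proof.
move=> /andP[x0 xy]; have [q] := rat_in_itvoo xy; rewrite in_itv/= => /andP[xq qy].
exists (pickle q); rewrite /nonneg_rat pickleK/= ger0_norm ?xq ?qy//.
exact: le_trans x0 (ltW xq).
Qed.

(** A violation of the bound at [t] propagates, by continuity from the right, to rational times just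
    after [t]; approaching from the right covers [t = 0] as well. *)
Lemma sup_path_leE (delta : R) :
  [set w | (ereal_sup [set `|X t w|%:E | t in `[0%R, +oo[] <= delta%:E)%E] =
  \bigcap_n [set w | `|X (nonneg_rat n) w| <= delta].
Proof.
apply/seteqP; split => w /=.
  move=> Hw n _ /=; rewrite -lee_fin; apply: le_trans Hw; apply: ereal_sup_ubound.
  by exists (nonneg_rat n) => //=; rewrite in_itv/= nonneg_rat_ge0.
move=> Hw; apply: ge_ereal_sup => y [t /=]; rewrite in_itv/= andbT => t0 <-.
rewrite lee_fin leNgt; apply/negP => dt.
have /continuous_within_itvcyP[cX c0] := hX.2 w.
have ct : (fun s => X s w) s @[s --> t^'+] --> X t w.
  have [t0'|t0'] := ltP 0 t; last by have -> : t = 0 by lra.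
  by apply: cvg_at_right_filter; apply: cX; rewrite in_itv/= t0'.
have e0 : 0 < `|X t w| - delta by rewrite subr_gt0.
have /cvgrPdist_lt/(_ _ e0) := ct.
rewrite /at_right/= near_withinE => -[r /= r0 Hr].
have [n /andP[tn nt]] := @nonneg_rat_dense t (t + r) ltac:(lra).
have Xn : `|X t w - X (nonneg_rat n) w| < `|X t w| - delta.
  by apply: Hr => //=; rewrite ltr_norml; apply/andP; split; lra.
have /= := Hw n I.
have := ler_normD (X (nonneg_rat n) w) (X t w - X (nonneg_rat n) w).
have -> : X (nonneg_rat n) w + (X t w - X (nonneg_rat n) w) = X t w by ring.
lra.
Qed.

Lemma measurable_process_slab (n : nat) (u : nat -> R) (delta : R) :
  measurable [set w | forall i, (i < n)%N -> `|X (u i) w| <= delta].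
Proof.
rewrite (_ : [set w | _] = \big[setI/setT]_(i < n) [set w | `|X (u i) w| <= delta]).
  apply: bigsetI_measurable => i _.
  have := measurable_funP (X (u i)) measurableT _ (measurable_norm_le delta).
  by rewrite setTI.
rewrite -(bigcap_mkord n (fun i => [set w | `|X (u i) w| <= delta])); apply/seteqP; split => w /= H i; first by move=> /= /H.
by move=> iN; apply: H.
Qed.

Let slab (delta : R) n := [set w | forall i, (i < n)%N -> `|X (nonneg_rat i) w| <= delta].

Let bigcap_slab delta :
  \bigcap_n slab delta n = \bigcap_n [set w | `|X (nonneg_rat n) w| <= delta].
Proof.
apply/seteqP; split => w H n _ /=; first by apply: (H n.+1 I).
by move=> i _; apply: H.
Qed.

Lemma measurable_sup_path_le (delta : R) : measurable
  [set w | (ereal_sup [set `|X t w|%:E | t in `[0%R, +oo[] <= delta%:E)%E].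
Proof.
rewrite sup_path_leE -bigcap_slab; apply: bigcapT_measurable => n.
exact: measurable_process_slab.
Qed.

Lemma small_ball_prob_le (n : nat) (u : nat -> R) (delta : R) :
  (forall i, (i < n)%N -> 0 <= u i) ->
  (small_ball_prob X delta <= P [set w | forall i, (i < n)%N -> (`|X (u i) w| <= delta)%R])%E.
Proof.
move=> u0; apply: le_measure; rewrite ?inE.
- exact: measurable_sup_path_le.
- exact: measurable_process_slab.
move=> w /= Hw i iN; rewrite -lee_fin; apply: le_trans Hw; apply: ereal_sup_ubound.
by exists (u i) => //=; rewrite in_itv/= u0.
Qed.

Lemma small_ball_prob_ge (p : \bar R) (delta : R) :
  (forall n (u : nat -> R), (forall i, (i < n)%N -> 0 <= u i) ->
     (p <= P [set w | forall i, (i < n)%N -> (`|X (u i) w| <= delta)%R])%E) ->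
  (p <= small_ball_prob X delta)%E.
Proof.
move=> H; rewrite /small_ball_prob sup_path_leE -bigcap_slab.
have cv : (P \o slab delta) n @[n --> \oo] --> P (\bigcap_n slab delta n).
  apply: nonincreasing_cvg_mu.
  - exact: le_lt_trans (probability_le1 _ (measurable_process_slab _ _ _)) (ltry _).
  - by move=> i; exact: measurable_process_slab.
  - by apply: bigcapT_measurable => n; exact: measurable_process_slab.
  - move=> m n mn; apply/subsetPset => w /= Hw i im; apply: Hw.
    exact: leq_trans im mn.
rewrite -(cvg_lim _ cv)//; apply: lime_ge; first by apply/cvg_ex; eexists; exact: cv.
by near=> n; apply: H.
Unshelve. all: by end_near.
Qed.

Lemma small_ball_prob_homo (delta delta' : R) : delta <= delta' ->
  (small_ball_prob X delta <= small_ball_prob X delta')%E.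
Proof.
move=> dd; apply: le_measure; rewrite ?inE; [exact: measurable_sup_path_le..|].
by move=> w /= /le_trans; apply; rewrite lee_fin.
Qed.

Hypothesis hB : standard_brownian_motion B.

Lemma grid_laplace_tail_sum (n : nat) (u : nat -> R) (delta : R) : 0 < delta ->
  (forall i, (i < n)%N -> 0 <= u i) ->
  exists2 C : R, 0 <= C & forall N, (0 < N)%N ->
    (\sum_(i < n) P [set w | (delta < `|grid_laplace B N (u i) w - X (u i) w|)%R] <=
     (C / N%:R)%:E)%E.
Proof.
move=> d0 u0.
exists (\sum_(i < n) 4 * fine (gauss_moment2 R) * (u i) ^+ 2 / delta ^+ 2).
  apply: sumr_ge0 => i _; rewrite divr_ge0 ?sqr_ge0// mulr_ge0 ?sqr_ge0//.
  by rewrite mulr_ge0// fine_ge0// gauss_moment2_ge0.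
move=> N N0; have NR : 0 < N%:R :> R by rewrite ltr0n.
apply: (@le_trans _ _ (\sum_(i < n) (4 * fine (gauss_moment2 R) * (u i / N%:R) ^+ 2 / delta ^+ 2)%:E)%E).
  by apply: lee_sum => i _; apply: (grid_laplace_tail hB hX) => //; apply: u0.
rewrite sumEFin lee_fin mulr_suml; apply: ler_sum => i _.
have N1 : N%:R^-1 <= 1 :> R by rewrite invf_le1 // ler1n.
rewrite expr_div_n (_ : 4 * _ * (_ / _) / _ =
   4 * fine (gauss_moment2 R) * u i ^+ 2 / delta ^+ 2 / N%:R * N%:R^-1); last first.
  by field; rewrite !gt_eqF.
apply: ler_piMr => //; rewrite !divr_ge0 ?sqr_ge0// mulr_ge0 ?sqr_ge0//.
by rewrite mulr_ge0// fine_ge0// gauss_moment2_ge0.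
Qed.

(** The error [C / N] depends on the tested frequencies through [C]; so arbitrarily fine grids are
    required once these are fixed, with the same [p] throughout. *)
Lemma small_ball_prob_ge_grid (p delta : R) : 0 < delta ->
  (forall n (u : nat -> R), (forall i, (i < n)%N -> 0 <= u i) ->
     forall N0 : nat, exists2 N, (N0 < N)%N &
     (p%:E <= P [set w | forall i, (i < n)%N -> (`|grid_laplace B N (u i) w| <= delta)%R])%E) ->
  (p%:E <= small_ball_prob X (delta + delta))%E.
Proof.
move=> d0 H; apply: small_ball_prob_ge => n u u0.
set q := P _.
have qfin : q \is a fin_num by apply: fin_num_measure; exact: measurable_process_slab.
rewrite -(fineK qfin) lee_fin; apply/ler_addgt0Pl => eps eps0.
have [C C0 HC] := grid_laplace_tail_sum d0 u0.
have [N HN Hp] := H n u u0 (Num.truncn (C / eps)).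
have N0 : (0 < N)%N by lia.
have CN : C / N%:R <= eps.
  rewrite ler_pdivrMr ?ltr0n// mulrC -ler_pdivrMr//.
  by apply: (le_trans (ltW (truncnS_gt _))); rewrite ler_nat.
rewrite -lee_fin EFinD fineK// addeC; apply: (le_trans Hp).
apply: (le_trans (slab_approx P n delta delta
   (fun i => measurable_grid_laplace B N (u i)) (fun i => measurable_funP (X (u i))))).
by rewrite leeD2l//; apply: (le_trans (HC N N0)); rewrite lee_fin.
Qed.

End countable_reduction.

(** The coordinates outside [J] are independent of those in [J] and, by Chebyshev's inequality,
    contribute at most [delta] with probability at least one half. Adding them doubles the slab and
    costs the factor 2; this is how the time interval gets extended beyond 1. *)
Lemma slab_restrict_le (R : realType) (d : measure_display) (T : measurableType d)
    (P : probability T R) (M : nat) (xi : 'I_M -> T -> R) (J : pred 'I_M)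
    (V : nat -> 'I_M -> R) (n : nat) (delta : R) :
  iid_gauss P xi -> 0 < delta ->
  \sum_(i < n) fine (gauss_moment2 R) * (\sum_(k | ~~ J k) V i k ^+ 2) / delta ^+ 2 <= 2^-1 ->
  (P [set w | forall i, (i < n)%N -> (`|\sum_(k | J k) V i k * xi k w| <= delta)%R] <=
   2%:E * P [set w | forall i, (i < n)%N -> (`|\sum_k V i k * xi k w| <= delta + delta)%R])%E.
Proof.
move=> iid d0 Hs.
pose VJ (i : nat) k := if J k then V i k else 0.
pose VC (i : nat) k := if J k then 0 else V i k.
have sumJ i w : \sum_(k | J k) V i k * xi k w = \sum_k VJ i k * xi k w.
  by rewrite big_mkcond/=; apply: eq_bigr => k _; rewrite /VJ; case: ifP => // _; rewrite mul0r.
have sumV i w : \sum_k V i k * xi k w = \sum_k VJ i k * xi k w + \sum_k VC i k * xi k w.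
  rewrite -big_split/=; apply: eq_bigr => k _; rewrite /VJ /VC -mulrDl; congr (_ * _).
  by case: ifP => _; rewrite ?addr0 ?add0r.
pose EJ := [set w | forall i, (i < n)%N -> `|\sum_k VJ i k * xi k w| <= delta].
pose EC := [set w | forall i, (i < n)%N -> `|\sum_k VC i k * xi k w| <= delta].
have mJ : measurable EJ by exact: (measurable_rows VJ delta [set i | (i < n)%N] iid).
have mC : measurable EC by exact: (measurable_rows VC delta [set i | (i < n)%N] iid).
have -> : [set w | forall i, (i < n)%N -> `|\sum_(k | J k) V i k * xi k w| <= delta] = EJ.
  by apply/seteqP; split => w H i iN; have := H i iN; rewrite sumJ.
set EV := [set w | _].
have mV : measurable EV by exact: (measurable_rows V (delta + delta) [set i | (i < n)%N] iid).
have half : (2^-1%:E <= P EC)%E.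
  have mVC i : measurable_fun setT (fun w => \sum_k VC i k * xi k w).
    by apply: measurable_sum => k; apply: measurable_funM => //; exact: iid.1.
  (* With zero as the first family its slab is the sure event, and the approximation lemma becomes a
     union bound. *)
  have := slab_approx P n 0 delta (fun=> measurable_cst (0 : R)) mVC.
  rewrite [X in P X](_ : _ = setT) ?probability_setT; last first.
    by apply/seteqP; split => // w _ i _; rewrite normr0.
  under [X in (_ + X)%E]eq_bigr do under eq_set do rewrite sub0r normrN.
  rewrite add0r -/EC => H1.
  have H2 : (\sum_(i < n) P [set w | (delta < `|\sum_k VC i k * xi k w|)%R] <= 2^-1%:E)%E.
    apply: (@le_trans _ _ (\sum_(i < n) (fine (gauss_moment2 R) * (\sum_(k | ~~ J k) V i k ^+ 2) / delta ^+ 2)%:E)%E).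
      apply: lee_sum => i _; apply: (le_trans (gauss_row_tail (VC i) iid d0)).
      suff -> : \sum_k VC i k ^+ 2 = \sum_(k | ~~ J k) V i k ^+ 2 by [].
      rewrite [RHS]big_mkcond/=; apply: eq_bigr => k _.
      by rewrite /VC; case: ifP => //; rewrite expr0n.
    by rewrite sumEFin lee_fin.
  have := le_trans H1 (leeD2l _ H2).
  rewrite -(fineK (fin_num_measure P _ mC)) -EFinD !lee_fin; lra.
have ind : P (EJ `&` EC) = (P EJ * P EC)%E.
  apply: (indep_groups iid (J := J)).
    apply: sigma_of_forall => i _.
    apply: (sigma_of_lin (A := [set x | `|x| <= delta])); last exact: measurable_norm_le.
    by move=> k /negbTE nJ; rewrite /VJ nJ.
  apply: sigma_of_forall => i _.
  apply: (sigma_of_lin (A := [set x | `|x| <= delta])); last exact: measurable_norm_le.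
  by move=> k; rewrite /= negbK /VC => ->.
apply: (@le_trans _ _ (2%:E * P (EJ `&` EC))%E).
  rewrite ind muleC -muleA -{1}[P EJ]mule1; apply: lee_pmul => //.
  apply: (@le_trans _ _ (2^-1%:E * 2%:E)%E); last by apply: lee_wpmul2r.
  by rewrite -EFinM mulVf.
apply: lee_wpmul2l => //; apply: le_measure; rewrite ?inE//; first exact: measurableI.
move=> w [HJ HC] i iN; rewrite sumV; apply: (le_trans (ler_normD _ _)).
by apply: lerD; [exact: HJ|exact: HC].
Qed.

Section grid_gram.
Variable R : realType.
Implicit Types (y s t : R).

Let geo y M := \sum_(k < M) expR (- y) ^+ k.+1.

Let geoE y M : (1 - expR (- y)) * geo y M = expR (- y) - expR (- y) ^+ M.+1.
Proof.
rewrite /geo; elim: M => [|M IH]; first by rewrite big_ord0 mulr0 expr1 subrr.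
rewrite big_ord_recr/= mulrDr IH [expR _ ^+ M.+2]exprS; ring.
Qed.

Let lt1 y : 0 < y -> 0 < 1 - expR (- y).
Proof. by move=> y0; rewrite subr_gt0 -expR0 ltr_expR oppr_lt0. Qed.

Let ratio_ge0 y : 0 < y -> 0 <= expR (- y) / (1 - expR (- y)).
Proof. by move=> y0; rewrite divr_ge0 ?expR_ge0// ltW// lt1. Qed.

Let ratio_le y : 0 < y -> expR (- y) / (1 - expR (- y)) <= y^-1.
Proof.
move=> y0; have r1 := lt1 y0.
rewrite ler_pdivrMr// mulrC ler_pdivlMr// mulrC.
have : (1 + y) * expR (- y) <= expR y * expR (- y) by rewrite ler_wpM2r ?expR_ge0// expR_ge1Dx.
by rewrite -expRD subrr expR0; lra.
Qed.

Let ratio_ge y : 0 < y -> y^-1 - 1 <= expR (- y) / (1 - expR (- y)).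
Proof.
move=> y0; have r1 := lt1 y0.
have -> : expR (- y) / (1 - expR (- y)) = (1 - expR (- y))^-1 - 1 by field; rewrite gt_eqF.
by rewrite lerD2r lef_pV2 ?posrE//; have := expR_ge1Dx (- y); lra.
Qed.

Let geo_ratio y M : 0 < y ->
  geo y M = expR (- y) / (1 - expR (- y)) * (1 - expR (- y) ^+ M).
Proof.
move=> y0; have r1 := lt1 y0.
apply: (mulfI (lt0r_neq0 r1)); rewrite geoE exprS; field.
by rewrite gt_eqF.
Qed.

Lemma grid_row_gram N M t s :
  \sum_(k < M) grid_row N t k * grid_row N s k = N%:R^-1 * geo ((t + s) / N%:R) M.
Proof.
rewrite /geo mulr_sumr; apply: eq_bigr => k _; rewrite /grid_row mulf_div -expRD.
rewrite -expr2 sqr_sqrtr// mulrC -expRM_natr; congr (_ * expR _); ring.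
Qed.

Lemma grid_row_gram_le N M t s : (0 < N)%N -> 0 < t + s ->
  \sum_(k < M) grid_row N t k * grid_row N s k <= (t + s)^-1.
Proof.
move=> N0 ts0; have NR : 0 < N%:R :> R by rewrite ltr0n.
have y0 : 0 < (t + s) / N%:R by rewrite divr_gt0.
rewrite grid_row_gram ler_pdivrMl// geo_ratio//.
have -> : N%:R * (t + s)^-1 = ((t + s) / N%:R)^-1 by rewrite invf_div.
apply: le_trans (ratio_le y0); apply: ler_piMr.
  exact: ratio_ge0.
by rewrite gerBl exprn_ge0 ?expR_ge0.
Qed.

Let expRN_le_inv y : 0 < y -> expR (- y) <= y^-1.
Proof.
move=> y0; rewrite expRN lef_pV2 ?posrE ?expR_gt0//.
by have := expR_ge1Dx y; lra.
Qed.

Lemma grid_row_gram_ge N t s : (0 < N)%N -> 0 < t + s ->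
  (t + s)^-1 - (1 + (t + s) ^- 2) / N%:R <=
  \sum_(k < N * N) grid_row N t k * grid_row N s k.
Proof.
move=> N0 ts0; have NR : 0 < N%:R :> R by rewrite ltr0n.
set z := t + s in ts0 *.
have y0 : 0 < z / N%:R by rewrite divr_gt0.
rewrite grid_row_gram -/z ler_pdivlMl// geo_ratio// [leRHS]mulrBr mulr1.
have rM : expR (- (z / N%:R)) ^+ (N * N) <= (z * N%:R)^-1.
  rewrite -expRM_natr (_ : - (z / N%:R) * _ = - (z * N%:R)); last first.
    by rewrite natrM; field; rewrite gt_eqF.
  by apply: expRN_le_inv; rewrite mulr_gt0.
have r0 : 0 <= expR (- (z / N%:R)) ^+ (N * N) by rewrite exprn_ge0 ?expR_ge0.
have q0 := ratio_ge0 y0.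
have := ler_pM q0 r0 (ratio_le y0) rM.
have := ratio_ge y0.
have -> : (z / N%:R)^-1 / (z * N%:R) = z ^- 2 by field; rewrite !gt_eqF.
have -> : N%:R * (z^-1 - (1 + z ^- 2) / N%:R) = (z / N%:R)^-1 - 1 - z ^- 2.
  by field; rewrite !gt_eqF.
lra.
Qed.

(** [N * N] cells of length [1 / N] cover times up to [N], so one limit refines the mesh and sends
    the horizon to infinity. The limit is the integral of [expR (- ((t + s) * x))] over the
    half-line. *)
Lemma grid_row_gram_cvg t s : 0 < t + s ->
  \sum_(k < N * N) grid_row N t k * grid_row N s k @[N --> \oo] --> (t + s)^-1.
Proof.
move=> ts0.
have h : (t + s)^-1 - (1 + (t + s) ^- 2) / N%:R @[N --> \oo] --> (t + s)^-1.
  rewrite -[X in _ --> X]subr0; apply: cvgB; first exact: cvg_cst.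
  rewrite -[X in _ --> X](mulr0 (1 + (t + s) ^- 2)); apply: cvgMr.
  apply/gtr0_cvgV0; last exact: cvgr_idn.
  by near=> n; rewrite ltr0n; near: n; exists 1%N.
apply: (squeeze_cvgr _ h (cvg_cst _)).
near=> N; have N0 : (0 < N)%N by near: N; exists 1%N.
by rewrite grid_row_gram_ge// grid_row_gram_le.
Unshelve. all: by end_near.
Qed.

(** The cells with index at least [N] lie beyond time 1; the bound is the integral of
    [expR (- (2 * t * x))] over [x >= 1]. *)
Lemma grid_row_tail_le N t : (0 < N)%N -> 0 < t ->
  \sum_(k < N * N | ~~ (k < N)%N) grid_row N t k ^+ 2 <= expR (- (2 * t)) / (2 * t).
Proof.
move=> N0 t0; have NR : 0 < N%:R :> R by rewrite ltr0n.
have z0 : 0 < t + t by lra.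
have y0 : 0 < (t + t) / N%:R by rewrite divr_gt0.
have NN : (N <= N * N)%N by rewrite leq_pmulr.
have -> : \sum_(k < N * N | ~~ (k < N)%N) grid_row N t k ^+ 2 =
    \sum_(k < N * N) grid_row N t k * grid_row N t k -
    \sum_(k < N) grid_row N t k * grid_row N t k.
  rewrite [in RHS](bigID (fun k : 'I_(N * N) => (k < N)%N))/=.
  by rewrite (big_ord_widen (N * N) (fun k => grid_row N t k * grid_row N t k) NN) addrAC subrr add0r.
rewrite !grid_row_gram -mulrBr !geo_ratio// -mulrBr.
have rN : expR (- ((t + t) / N%:R)) ^+ N = expR (- (2 * t)).
  by rewrite -expRM_natr; congr expR; field; rewrite gt_eqF.
have r0 : 0 <= expR (- ((t + t) / N%:R)) ^+ (N * N) by rewrite exprn_ge0 ?expR_ge0.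
have q0 := ratio_ge0 y0.
rewrite rN ler_pdivrMl//.
have -> : N%:R * (expR (- (2 * t)) / (2 * t)) = ((t + t) / N%:R)^-1 * expR (- (2 * t)).
  by rewrite -mulr2n -mulr_natl; field; rewrite !gt_eqF.
apply: le_trans (ler_wpM2r (expR_ge0 _) (ratio_le y0)).
by apply: ler_wpM2l => //; lra.
Qed.

End grid_gram.

Section grid_upper.
Variables (R : realType) (d : measure_display) (T : measurableType d).
Variables (P : probability T R) (B X : R -> {RV P >-> R}).
Hypotheses (hB : standard_brownian_motion B) (hX : laplace_wiener_process B X).

Let blaschkeE (t : nat -> R) m : (\prod_(l < m) blaschke (t l) (t m)) ^+ 2 =
  (\prod_(l < m) ((t m - t l) / (t m + t l))) ^+ 2.
Proof. by rewrite -[RHS](real_normK (num_real _)) normr_prod. Qed.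

Lemma grid_slab_le (t : nat -> R) (n : nat) (delta : R) :
  (forall i, 0 < t i) -> (forall i j, (i < j)%N -> t i != t j) -> 0 < delta ->
  \forall N \near \oo,
  (P [set w | forall i, (i < n)%N ->
        (`|\sum_(k < N * N) grid_row N (t i) k * grid_increment B N k w| <= delta)%R] <=
  (\prod_(i < n) (4 * delta * Num.sqrt (2 * t i) /
     \prod_(l < i) blaschke (t l) (t i)))%:E)%E.
Proof.
move=> t0 t_inj d0.
pose G N i j := \sum_(k < N * N) grid_row N (t i) k * grid_row N (t j) k.
pose K (x y : R) := (x + y)^-1.
pose b (a x : R) := (x - a) / (x + a).
have b_neq0 i j : (i < j)%N -> b (t i) (t j) != 0.
  move=> ij; rewrite mulf_neq0 ?invr_neq0//; last by rewrite gt_eqF// addr_gt0.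
  by rewrite subr_eq0 eq_sym t_inj.
have G0E m i j : schur (fun i j => K (t i) (t j)) m i j =
    (\prod_(l < m) b (t l) (t i)) * (\prod_(l < m) b (t l) (t j)) * K (t i) (t j).
  apply: (@schur_kernel R R K b (fun x => 0 < x)) => //.
    by move=> x y a x0 y0 a0; exact: laplace_kernel_schur.
  by move=> i'; rewrite invr_neq0// gt_eqF// addr_gt0.
have bprod m : 0 < \prod_(l < m) blaschke (t l) (t m).
  by apply: prodr_gt0 => l _; rewrite normr_gt0; exact: b_neq0.
(* Half of the limiting residual: the inequality [lG] is then strict and survives for the Gram
   matrices [G N] with [N] large. *)
pose l (i : nat) := 2^-1 * (\prod_(l < i) blaschke (t l) (t i)) / Num.sqrt (2 * t i).
have l0 i : 0 < l i by rewrite divr_gt0 ?mulr_gt0// sqrtr_gt0 mulr_gt0.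
have lG i : l i ^+ 2 < schur (fun i j => K (t i) (t j)) i i i.
  rewrite G0E -expr2 -blaschkeE /l expr_div_n sqr_sqrtr ?mulr_ge0 ?(ltW (t0 i))//.
  rewrite exprMn /K (_ : t i + t i = 2 * t i); last by ring.
  rewrite -mulrA.
  have : 0 < (\prod_(l < i) blaschke (t l) (t i)) ^+ 2 / (2 * t i).
    by rewrite divr_gt0 ?exprn_gt0 ?mulr_gt0.
  move: (_ / _) => q; lra.
have G0n m : schur (fun i j => K (t i) (t j)) m m m != 0.
  by rewrite gt_eqF// (le_lt_trans _ (lG m))// sqr_ge0.
have cv m : schur (G N) m m m @[N --> \oo] --> schur (fun i j => K (t i) (t j)) m m m.
  by apply: schur_cvg => // i j; apply: grid_row_gram_cvg; rewrite addr_gt0.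
have ev : \forall N \near \oo, forall i : 'I_n, l i ^+ 2 <= schur (G N) i i i.
  by apply: filter_forall => i; apply: (cvgr_ge _ (cv i)); exact: lG.
near=> N.
have N0 : (0 < N)%N by near: N; exists 1%N.
have nN : (n <= N * N)%N.
  have : (n <= N)%N by near: N; exists n.
  by move=> /leq_trans; apply; rewrite leq_pmulr.
have HN : forall i : 'I_n, l i ^+ 2 <= schur (G N) i i i by near: N.
have := @gauss_rows_le R d T P (N * N) _ (fun i (k : 'I_(N * N)) => grid_row N (t i) k)
  (G N) l delta n (grid_increment_iid hB (N * N) N0) (ltW d0) nN
  (fun i j _ _ => erefl) (fun k _ => l0 k)
  (fun k kn => HN (Ordinal kn)).
move=> /le_trans; apply; rewrite lee_fin le_eqVlt; apply/orP; left; apply/eqP.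
apply: eq_bigr => i _; rewrite /l; field.
by rewrite !gt_eqF ?sqrtr_gt0 ?mulr_gt0.
Unshelve. all: by end_near.
Qed.

(** [delta] is doubled twice, in passing from [X] to the grid and in extending the grid beyond time
    1; with the 4 of [grid_slab_le] this makes 16. *)
Lemma small_ball_prob_le_prod (t : nat -> R) (n : nat) (delta : R) :
  (forall i, 0 < t i) -> (forall i j, (i < j)%N -> t i != t j) -> 0 < delta ->
  \sum_(i < n) fine (gauss_moment2 R) * (expR (- (2 * t i)) / (2 * t i)) /
     (delta + delta) ^+ 2 <= 2^-1 ->
  (small_ball_prob X delta <=
  (2 * \prod_(i < n) (16 * delta * Num.sqrt (2 * t i) /
     \prod_(l < i) blaschke (t l) (t i)))%:E)%E.
Proof.
move=> t0 t_inj d0 Hs.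
set Q := 2 * _.
have tp i : (i < n)%N -> 0 <= t i by move=> _; exact: ltW.
apply: (le_trans (small_ball_prob_le hX delta tp)).
set q := P _.
have qfin : q \is a fin_num by apply: fin_num_measure; exact: measurable_process_slab.
rewrite -(fineK qfin) lee_fin; apply/ler_addgt0Pl => eps eps0.
have [C C0 HC] := grid_laplace_tail_sum hX hB d0 tp.
have d4 : 0 < (delta + delta) + (delta + delta) by lra.
have [M _ HM] := @grid_slab_le t n _ t0 t_inj d4.
pose N := maxn M (Num.truncn (C / eps)).+1.
have N0 : (0 < N)%N by rewrite /N leq_max orbT.
have CN : C / N%:R <= eps.
  rewrite ler_pdivrMr ?ltr0n// mulrC -ler_pdivrMr//.
  by apply: (le_trans (ltW (truncnS_gt _))); rewrite ler_nat leq_maxr.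
have iid := grid_increment_iid hB (N * N) N0.
rewrite -lee_fin EFinD fineK//.
apply: (le_trans (slab_approx P n delta delta
   (fun i => measurable_funP (X (t i))) (fun i => measurable_grid_laplace B N (t i)))).
rewrite [leRHS]addeC; apply: leeD; last first.
  under eq_bigr do under eq_set do rewrite distrC.
  by apply: (le_trans (HC N N0)); rewrite lee_fin.
have NN : (N <= N * N)%N by rewrite leq_pmulr.
have -> : [set w | forall i, (i < n)%N -> `|grid_laplace B N (t i) w| <= delta + delta] =
  [set w | forall i, (i < n)%N ->
   `|\sum_(k < N * N | (k < N)%N) grid_row N (t i) k * grid_increment B N k w| <= delta + delta].
  apply/seteqP; split => w H i iN; have := H i iN;
   by rewrite /grid_laplace (big_ord_widen (N * N) (fun k => grid_row N (t i) k * (Num.sqrt N%:R * (B (k.+1%:R / N%:R) w - B (k%:R / N%:R) w))) NN).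
apply: (le_trans (slab_restrict_le (J := fun k : 'I_(N * N) => (k < N)%N)
   (V := fun i (k : 'I_(N * N)) => grid_row N (t i) k) iid _ _)); first lra.
  apply: le_trans Hs; apply: ler_sum => i _; rewrite ler_wpM2r ?invr_ge0 ?sqr_ge0//.
  by rewrite ler_wpM2l ?fine_ge0 ?gauss_moment2_ge0// grid_row_tail_le.
rewrite EFinM; apply: lee_wpmul2l => //.
have MN : (M <= N)%N by rewrite leq_maxl.
apply: (le_trans (HM N MN)); rewrite lee_fin le_eqVlt; apply/orP; left; apply/eqP.
by apply: eq_bigr => i _; congr (_ / _); ring.
Qed.

End grid_upper.

Section blaschke_log_ratio.
Variable R : realType.
Implicit Types x z D : R.

Lemma expR_log_ratio x : 0 <= x < 1 -> expR (- log_ratio x) = (1 - x) / (1 + x).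
Proof.
by move=> /andP[x0 x1]; rewrite /log_ratio opprB expRD expRN !lnK// posrE; lra.
Qed.

Lemma blaschke_expE x z : blaschke (expR x) (expR z) =
  (1 - expR (- `|z - x|)) / (1 + expR (- `|z - x|)).
Proof.
wlog xz : x z / x <= z.
  move=> H; have [xz|/ltW zx] := leP x z; first exact: H.
  rewrite distrC -H// /blaschke -[in RHS]normrN; congr (`| _ |).
  by rewrite -mulNr opprB [expR x + _]addrC.
have zE : expR z = expR x * expR (z - x) by rewrite -expRD; congr expR; ring.
rewrite ger0_norm ?subr_ge0// /blaschke zE expRN.
have x0 := expR_gt0 x; have d0 := expR_gt0 (z - x).
have d1 : 1 <= expR (z - x) by have := expR_ge1Dx (z - x); lra.
move: (expR (z - x)) (expR x) x0 d0 d1 => d e e0 d0 d1.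
rewrite ger0_norm; first by field; rewrite !gt_eqF// ?addr_gt0 ?mulr_gt0//; nra.
by rewrite divr_ge0//; nra.
Qed.

Let ratio_homo (s t : R) : 0 <= s -> s <= t -> (1 - t) / (1 + t) <= (1 - s) / (1 + s).
Proof.
move=> s0 st; rewrite ler_pdivrMr; last lra.
by rewrite mulrAC ler_pdivlMr; [nra|lra].
Qed.

Lemma blaschke_exp_le_log_ratio x z D : 0 < D -> `|z - x| <= D ->
  blaschke (expR x) (expR z) <= expR (- log_ratio (expR (- D))).
Proof.
move=> D0 zD; rewrite expR_log_ratio; last first.
  by rewrite expR_ge0 -expR0 ltr_expR oppr_lt0.
by rewrite blaschke_expE; apply: ratio_homo; rewrite ?expR_ge0// ler_expR lerN2.
Qed.

Lemma blaschke_exp_ge_log_ratio x z D : 0 < D -> D <= `|z - x| ->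
  expR (- log_ratio (expR (- D))) <= blaschke (expR x) (expR z).
Proof.
move=> D0 zD; rewrite expR_log_ratio; last first.
  by rewrite expR_ge0 -expR0 ltr_expR oppr_lt0.
by rewrite blaschke_expE; apply: ratio_homo; rewrite ?expR_ge0// ler_expR lerN2.
Qed.

Lemma blaschke_ge0 (a y : R) : 0 <= blaschke a y.
Proof. exact: normr_ge0. Qed.

Lemma blaschke_le1 (a y : R) : 0 < a -> 0 < y -> blaschke a y <= 1.
Proof.
move=> a0 y0; rewrite /blaschke ler_norml ler_pdivlMr ?ler_pdivrMr ?addr_gt0//.
by apply/andP; split; lra.
Qed.

End blaschke_log_ratio.

Section cost.
Variable R : realType.
Implicit Types (y : R) (s : seq (R * R)).

(** A pair holds a frequency and the half-width of its coordinate. The recursion is the Horner form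
    of the sum in [slab_costE]: the cost of an appended batch gets multiplied by all earlier
    factors. *)
Fixpoint slab_cost y s : R :=
  if s is a :: s' then a.2 + blaschke a.1 y * slab_cost y s' else 0.

Definition slab_prod y s : R := \prod_(a <- s) blaschke a.1 y.

Lemma slab_costE y s : slab_cost y s =
  \sum_(j < size s) (\prod_(l < j) blaschke (nth (1, 0) s l).1 y) * (nth (1, 0) s j).2.
Proof.
elim: s => [|a s IH]; first by rewrite big_ord0.
rewrite /= big_ord_recl/= big_ord0 mul1r IH mulr_sumr; congr (_ + _).
by apply: eq_bigr => j _; rewrite big_ord_recl/= mulrA.
Qed.

Lemma slab_cost_cat y s1 s2 :
  slab_cost y (s1 ++ s2) = slab_cost y s1 + slab_prod y s1 * slab_cost y s2.
Proof.
rewrite /slab_prod; elim: s1 => [|a s IH]; first by rewrite big_nil mul1r add0r.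
by rewrite /= IH big_cons; ring.
Qed.

Lemma slab_cost_le y s : 0 < y -> all (fun a => (0 < a.1) && (0 <= a.2)) s ->
  slab_cost y s <= \sum_(a <- s) a.2.
Proof.
move=> y0; elim: s => [|a s IH] /=; first by rewrite big_nil.
move=> /andP[/andP[a0 a1] /[dup] Hs /IH H]; rewrite big_cons lerD2l.
apply: le_trans H; apply: ler_piMl; last exact: blaschke_le1.
elim: s Hs {IH} => //= b s IH /andP[/andP[b0 b1] /IH H].
by rewrite addr_ge0// mulr_ge0 ?blaschke_ge0.
Qed.

End cost.

(** * Choice of the frequencies *)

Section batches.
Variable R : realType.

Lemma sum_linear_geometric (a p : R) n : 0 <= a -> 0 <= p ->
  \sum_(i < n) (a + p * i%:R) * 4^-1 ^+ i <= 2 * a + 2 * p.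
Proof.
move=> a0 p0.
suff : \sum_(i < n) (a + p * i%:R) * 4^-1 ^+ i <=
    2 * a + 2 * p - (2 * a + 2 * p + 2 * p * n%:R) * 4^-1 ^+ n.
  move/le_trans; apply; rewrite gerBl mulr_ge0 ?exprn_ge0 ?invr_ge0//.
  by rewrite !addr_ge0 ?mulr_ge0.
elim: n => [|n IH]; first by rewrite big_ord0 expr0; lra.
rewrite big_ord_recr/=; apply: (le_trans (lerD IH (lexx _))).
have nS : n.+1%:R = n%:R + 1 :> R by rewrite -addn1 natrD.
rewrite exprSr nS.
have : 0 <= (a / 2 + p + p * n%:R / 2) * 4^-1 ^+ n.
  by rewrite mulr_ge0 ?exprn_ge0 ?invr_ge0// !addr_ge0// ?mulr_ge0.
move: (4^-1 ^+ n) (n%:R : R) => e m; lra.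
Qed.

Variables (h : R) (M p : nat).
Hypothesis h0 : 0 < h.

(** The factor 2 counts [M] points on either side of a frequency. For small [h] and suitable [M],
    [h] times this gain is close to [pi ^+ 2 / 2]. *)
Definition batch_gain : R := 2 * \sum_(m < M) log_ratio (expR (- (m.+1%:R * h))).
Definition batch_size (J : nat) : nat := ((2 * M).+1 + p * J.+1)%N.
(** Logarithms of frequencies, with a margin of [M] points around the range to be covered. The
    offset [h / (J%:R + 2)], at most [h / 2], differs from batch to batch and keeps all points
    distinct. *)
Definition batch_point (J i : nat) : R := (i%:R - M%:R) * h + h / (J%:R + 2).

Local Notation q := batch_gain.

Lemma batch_point_inj J i J' i' : batch_point J i = batch_point J' i' -> J = J' /\ i = i'.
Proof.
have hinv (j : nat) : 0 < (j%:R + 2)^-1 :> R by rewrite invr_gt0 ltr_wpDl.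
have hinv2 (j : nat) : (j%:R + 2)^-1 <= 2^-1 :> R.
  by rewrite lef_pV2 ?posrE ?ltr_wpDl// lerDr.
rewrite /batch_point ![h / _]mulrC -!mulrDl => /(mulIf (lt0r_neq0 h0)) E.
have ii : i = i'.
  apply/eqP; rewrite eqn_leq; apply/andP; split; rewrite -ltnS -(ltr_nat R) -[X in _ < X]natr1.
    by have := hinv J; have := hinv2 J'; have := hinv J'; lra.
  by have := hinv J; have := hinv2 J; have := hinv J'; lra.
split=> //; move: E; rewrite ii => /addrI/invr_inj/addIr/eqP.
by rewrite eqr_nat => /eqP.
Qed.

Let F J z i := blaschke (expR (batch_point J i)) (expR z).

Let F01 J z i : 0 <= F J z i <= 1.
Proof. by rewrite blaschke_ge0 blaschke_le1 ?expR_gt0. Qed.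

Let prodF01 J z m n : 0 <= \prod_(m <= i < n) F J z i <= 1.
Proof.
apply/andP; split; first by apply: prodr_ge0 => i _; exact: blaschke_ge0.
by apply: prodr_ile1 => i _; exact: F01.
Qed.

Lemma batch_prod_le J z : 0 <= z -> z <= p%:R * J.+1%:R * h ->
  \prod_(0 <= i < batch_size J) F J z i <= expR (- q).
Proof.
move=> z0 zp.
have j0 : 0 < (J%:R + 2)^-1 :> R by rewrite invr_gt0 ltr_wpDl.
have j2 : (J%:R + 2)^-1 <= 2^-1 :> R by rewrite lef_pV2 ?posrE ?ltr_wpDl// lerDr.
have hj0 : 0 < h / (J%:R + 2) by rewrite mulr_gt0.
have hj2 : h / (J%:R + 2) <= h / 2 by rewrite ler_wpM2l// ltW.
(* [k] is such that [z] lies between the positions of indices [k + M - 1] and [k + M]; the added [h]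
   keeps [w] nonnegative. The [M] points on each side are within [h], [2 h], ..., [M h], and all
   other factors are at most 1. *)
pose w := z - h / (J%:R + 2) + h.
have w0 : 0 <= w by rewrite /w; lra.
pose k := Num.truncn (w / h).
have kw : k%:R * h <= w by rewrite -ler_pdivlMr// truncn_le// divr_ge0// ltW.
have wk : w < k%:R * h + h.
  by have := truncnS_gt (w / h); rewrite ltr_pdivrMr// -/k -natr1 mulrDl mul1r.
have kp : (k <= p * J.+1)%N.
  rewrite -ltnS -(ltr_nat R) -natr1 natrM -(ltr_pM2r h0) mulrDl mul1r.
  by apply: (le_lt_trans kw); rewrite /w; lra.
have M2 : (k + M <= k + M + M)%N by exact: leq_addr.
have ks : (k + M + M <= batch_size J)%N.
  by rewrite /batch_size -addnA addnn -mul2n addSn addnC ltnW// ltnS leq_add2l.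
have dist_below (m : nat) : (m < M)%N -> `|z - batch_point J (k + (M - m.+1))| <= m.+1%:R * h.
  move=> mM; rewrite /batch_point natrD natrB// ler_norml.
  rewrite -natr1 in w0 *; rewrite /w in kw wk.
  have -> : z - ((k%:R + (M%:R - (m%:R + 1)) - M%:R) * h + h / (J%:R + 2)) =
     (z - h / (J%:R + 2) + h - k%:R * h) + m%:R * h by ring.
  by rewrite mulrDl mul1r; have := mulr_ge0 (ler0n R m) (ltW h0); move=> mh; apply/andP; split; lra.
have dist_above (m : nat) : (m < M)%N -> `|z - batch_point J (k + M + m)| <= m.+1%:R * h.
  move=> mM; rewrite /batch_point !natrD ler_norml.
  rewrite -natr1; rewrite /w in kw wk.
  have -> : z - ((k%:R + M%:R + m%:R - M%:R) * h + h / (J%:R + 2)) =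
     (z - h / (J%:R + 2) + h - k%:R * h) - m%:R * h - h by ring.
  by rewrite mulrDl mul1r; have := mulr_ge0 (ler0n R m) (ltW h0); move=> mh; apply/andP; split; lra.
have mh0 (m : nat) : 0 < m.+1%:R * h by rewrite mulr_gt0.
pose g := \prod_(m < M) expR (- log_ratio (expR (- (m.+1%:R * h)))).
have gE : g = expR (- (q / 2)).
  by rewrite /g -expR_sum sumrN /q; congr expR; field.
have below : \prod_(k <= i < k + M) F J z i <= g.
  rewrite -{1}[k]add0n big_addn addKn big_mkord (reindex_inj rev_ord_inj)/=.
  apply: ler_prod => m _; rewrite blaschke_ge0/=.
  by apply: blaschke_exp_le_log_ratio => //; rewrite addnC; exact: dist_below.
have above : \prod_(k + M <= i < k + M + M) F J z i <= g.
  rewrite -{1}[(k + M)%N]add0n big_addn addKn big_mkord.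
  apply: ler_prod => m _; rewrite blaschke_ge0/=.
  by apply: blaschke_exp_le_log_ratio => //; rewrite addnC; exact: dist_above.
rewrite (big_cat_nat (n := (k + M + M)%N))//=.
rewrite (big_cat_nat (n := (k + M)%N) (p := (k + M + M)%N))//=.
rewrite (big_cat_nat (n := k) (p := (k + M)%N)) ?leq_addr//=.
have -> : expR (- q) = 1 * g * g * 1.
  by rewrite gE mul1r mulr1 -expRD; congr expR; field.
have A1 := prodF01 J z 0 k.
have A2 := prodF01 J z k (k + M).
have A3 := prodF01 J z (k + M) (k + M + M).
have A4 := prodF01 J z (k + M + M) (batch_size J).
move: A1 A2 A3 A4 below above => /andP[? ?] /andP[? ?] /andP[? ?] /andP[? ?] ? ?.
by rewrite !ler_pM// ?mulr_ge0.
Qed.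


Hypotheses (hp : 2 * q <= p%:R * h) (q4 : 4 <= q).
Variable delta : R.
Hypothesis d0 : 0 < delta.

Definition batch_const : R := expR 1 * (2 * (2 * M + 1 + p)%:R + 2 * p%:R).

(** After [J] batches the weighted residuals are at most [expR (- (J * q))]. Radii growing by
    [expR (q - 2)] leave a factor [expR (- 2)] per batch, less than a quarter, which outweighs the
    linear growth of the batch sizes; [batch_const] normalizes the resulting sum. *)
Definition batch_radius J : R := delta * expR (J%:R * (q - 2)) / batch_const.

Definition batches n : seq (R * R) :=
  [seq (expR (batch_point J i), batch_radius J) | J <- iota 0 n, i <- iota 0 (batch_size J)].

Lemma batch_const_gt0 : 0 < batch_const.
Proof. by rewrite mulr_gt0 ?expR_gt0// ltr_wpDr ?mulr_ge0// mulr_gt0// ltr0n addn1. Qed.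

Lemma batch_radius_gt0 J : 0 < batch_radius J.
Proof. by rewrite divr_gt0 ?mulr_gt0 ?expR_gt0. Qed.

Lemma batchesS n : batches n.+1 = batches n ++
  [seq (expR (batch_point n i), batch_radius n) | i <- iota 0 (batch_size n)].
Proof. by rewrite /batches -addn1 iotaD allpairs_cat/= cats0. Qed.

Let batch J := [seq (expR (batch_point J i), batch_radius J) | i <- iota 0 (batch_size J)].

Lemma size_batches n : (n <= size (batches n))%N.
Proof.
elim: n => // n IH; rewrite batchesS size_cat size_map size_iota -addn1 leq_add//.
Qed.

Lemma batches_gt0 n : all (fun a => (0 < a.1) && (0 <= a.2)) (batches n).
Proof.
elim: n => // n IH; rewrite batchesS all_cat IH andTb; apply/allP => _ /mapP[i _ ->]/=.
by rewrite expR_gt0 ltW// batch_radius_gt0.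
Qed.

Lemma uniq_batches n : uniq [seq a.1 | a <- batches n].
Proof.
rewrite map_allpairs.
apply: (@allpairs_uniq_dep _ (fun=> _) _ (fun J i => expR (batch_point J i)) (iota 0 n)
  (fun J => iota 0 (batch_size J))); rewrite ?iota_uniq//.
  by move=> J _; exact: iota_uniq.
by move=> [J i] [J' i'] _ _ /= /expR_inj/batch_point_inj[-> ->].
Qed.

Let slab_prod01 n z : 0 <= slab_prod (expR z) (batches n) <= 1.
Proof.
rewrite /slab_prod !big_seq; apply/andP; split.
  by apply: prodr_ge0 => a _; exact: blaschke_ge0.
apply: prodr_ile1 => a an; rewrite blaschke_ge0 blaschke_le1 ?expR_gt0//.
by have /allP/(_ _ an)/andP[] := batches_gt0 n.
Qed.

(* A new batch gains the factor [expR (- q)] for the frequencies in its range;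
   beyond it the factor [expR (- (z / 2))] alone is small enough. *)
Lemma batches_prod_le n z : 0 <= z ->
  expR (- (z / 2)) * slab_prod (expR z) (batches n) <= expR (- (n%:R * q)).
Proof.
move=> z0; elim: n => [|n IH].
  rewrite /slab_prod big_nil mulr1 ler_expR mul0r; lra.
have nS : n.+1%:R = n%:R + 1 :> R by rewrite -addn1 natrD.
have [zp|pz] := leP z (p%:R * n.+1%:R * h).
  have -> : expR (- (n.+1%:R * q)) = expR (- (n%:R * q)) * expR (- q).
    by rewrite -expRD nS; congr expR; ring.
  rewrite batchesS -/(batch n) /slab_prod big_cat/= -/(slab_prod _ _) mulrA.
  have /andP[b0 b1] := slab_prod01 n z.
  apply: ler_pM => //; first by rewrite mulr_ge0 ?expR_ge0.
    by apply: prodr_ge0 => a _; exact: blaschke_ge0.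
  rewrite /batch big_map -[batch_size n]subn0.
  exact: batch_prod_le.
have /andP[b0 b1] := slab_prod01 n.+1 z.
rewrite -[leRHS]mulr1; apply: ler_pM => //.
rewrite ler_expR lerN2.
have : n.+1%:R * (2 * q) <= n.+1%:R * (p%:R * h) by rewrite ler_wpM2l.
lra.
Qed.

Let batch_sizeE J : (batch_size J)%:R = (2 * M + 1 + p)%:R + p%:R * J%:R :> R.
Proof. by rewrite -natrM -natrD; congr (_%:R); rewrite /batch_size; lia. Qed.

(** With [y = expR z] the weight is [expR (- (z / 2))]. Within a batch only the gain of the
    preceding batches is counted, so batch [J] contributes at most its size times its radius times
    [expR (- (J * q))]. *)
Lemma batches_cost_le n y : 1 <= y ->
  expR 1 / Num.sqrt y * slab_cost y (batches n) <= delta.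
Proof.
move=> y1; have y0 : 0 < y by lra.
pose z := ln y; have zE : y = expR z by rewrite lnK.
have z0 : 0 <= z by rewrite ln_ge0.
have sE : (Num.sqrt y)^-1 = expR (- (z / 2)).
  rewrite expRN; congr (_^-1); have -> : y = expR (z / 2) ^+ 2.
    by rewrite -expRM_natr zE; congr expR; field.
  by rewrite sqrtr_sqr ger0_norm ?expR_ge0.
rewrite sE -mulrA -ler_pdivlMl ?expR_gt0//.
suff : expR (- (z / 2)) * slab_cost y (batches n) <=
  \sum_(J < n) ((2 * M + 1 + p)%:R + p%:R * J%:R) * 4^-1 ^+ J * (delta / batch_const).
  move/le_trans; apply; rewrite -mulr_suml.
  apply: (@le_trans _ _ ((2 * (2 * M + 1 + p)%:R + 2 * p%:R) * (delta / batch_const))).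
    by rewrite ler_wpM2r ?divr_ge0 ?(ltW batch_const_gt0) ?(ltW d0)// sum_linear_geometric.
  rewrite le_eqVlt; apply/orP; left; apply/eqP; rewrite /batch_const.
  have : 0 < 2 * (2 * M + 1 + p)%:R + 2 * p%:R :> R.
    by have := batch_const_gt0; rewrite pmulr_rgt0 ?expR_gt0.
  have := expR_gt0 (1 : R); move: (expR 1) (_ + _) => e c e0 c0; field.
  by rewrite !gt_eqF.
elim: n => [|n IH]; first by rewrite mulr0 big_ord0.
rewrite batchesS -/(batch n) slab_cost_cat big_ord_recr/= mulrDr; apply: lerD => //.
rewrite mulrA zE.
have all_batch : all (fun a => (0 < a.1) && (0 <= a.2)) (batch n).
  apply/allP => _ /mapP[i _ ->]/=.
  by rewrite expR_gt0 ltW// batch_radius_gt0.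
have := slab_cost_le (expR_gt0 z) all_batch.
rewrite big_map big_const_seq count_predT size_iota iter_addr_0 -[_ *+ batch_size n]mulr_natl => H.
have /andP[b0 b1] := slab_prod01 n z.
apply: (@le_trans _ _ (expR (- (n%:R * q)) * ((batch_size n)%:R * batch_radius n))).
  apply: (le_trans (ler_wpM2l _ H)); first by rewrite mulr_ge0 ?expR_ge0.
  apply: ler_wpM2r; last exact: batches_prod_le.
  by rewrite mulr_ge0// ltW// batch_radius_gt0.
rewrite batch_sizeE /batch_radius.
have -> : expR (- (n%:R * q)) * (((2 * M + 1 + p)%:R + p%:R * n%:R) *
   (delta * expR (n%:R * (q - 2)) / batch_const)) =
   ((2 * M + 1 + p)%:R + p%:R * n%:R) *
   (expR (- (n%:R * q)) * expR (n%:R * (q - 2))) * (delta / batch_const) by ring.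
rewrite -expRD.
apply: ler_wpM2r; first by rewrite divr_ge0 ?(ltW batch_const_gt0) ?(ltW d0).
apply: ler_wpM2l; first by rewrite -natrM -natrD.
have -> : - (n%:R * q) + n%:R * (q - 2) = - 2 * n%:R by ring.
rewrite expRM_natr; apply: lerXn2r; rewrite ?nnegrE ?expR_ge0//.
rewrite -[- 2]mulN1r expRM_natr expRN exprVn lef_pV2 ?posrE ?exprn_gt0 ?expR_gt0//.
have : 2 <= expR 1 :> R by have := expR_ge1Dx (1 : R); lra.
by move=> e2; rewrite expr2; nra.
Qed.

End batches.

Lemma gauss_batches_ge (R : realType) (h : R) (M p : nat) (delta K : R) (n : nat) :
  0 < delta -> 0 < K ->
  (forall e : R, 0 < e -> ((e / (e + K))%:E <= gauss [set x : R | (`|x| <= e)%R])%E) ->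
  ((expR (- \sum_(J < n) (batch_size M p J)%:R * ln (1 + K / batch_radius h M p delta J)))%:E <=
   \prod_(a <- batches h M p delta n) gauss [set x : R | (`|x| <= a.2)%R])%E.
Proof.
move=> d0 K0 HK; elim: n => [|n IH]; first by rewrite big_ord0 oppr0 expR0 big_nil.
rewrite big_ord_recr/= opprD expRD EFinM batchesS big_cat big_map.
apply: lee_pmul => //; rewrite ?lee_fin ?expR_ge0//.
have := batch_radius_gt0 h M p d0 n.
move: (batch_radius h M p delta n) => e e0; have eK := HK _ e0.
have e1 : 0 < 1 + K / e by rewrite addr_gt0// divr_gt0.
have -> : expR (- ((batch_size M p n)%:R * ln (1 + K / e))) =
    (e / (e + K)) ^+ batch_size M p n.
  rewrite -mulrN mulrC expRM_natr expRN lnK ?posrE//.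
  by congr (_ ^+ _); field; rewrite !gt_eqF ?addr_gt0.
have ee : 0 <= e / (e + K) by rewrite ltW// divr_gt0// addr_gt0.
elim: (batch_size M p n) => [|m IHm]; first by rewrite big_nil.
rewrite -[in X in (_ <= X)%E](addn1 m) iotaD big_cat/= big_seq1 exprSr EFinM.
by apply: lee_pmul => //; rewrite lee_fin// exprn_ge0.
Qed.

Section batch_exponent.
Variables (R : realType) (h : R) (M p : nat).
Local Notation q := (batch_gain h M).
Hypothesis q4 : 4 <= q.

Let q2 : 2 <= q - 2.
Proof. by move: (batch_gain h M) q4 => g; lra. Qed.

Let q20 : 0 <= q - 2.
Proof. exact: le_trans q2. Qed.

Let ln1DexpR_le (x : R) : 0 <= x -> ln (1 + expR x) <= 1 + x.
Proof.
move=> x0; rewrite -[leRHS]expRK ler_ln ?posrE ?ltr_pwDl ?expR_gt0// expRD.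
have := expR_ge1Dx (1 : R); have : 1 <= expR x by rewrite -expR0 ler_expR.
by move: (expR x) (expR 1) => a b; nra.
Qed.

(** The hypothesis says that the radius has reached [K] at stage [N]. Before it a point costs about
    [(N - J) (q - 2)]; from it on the costs decay like powers of 1/4, so the bound is independent of
    the number [k] of further batches, which merely lengthen the list. *)
Lemma batch_log_sum_le (delta K : R) (N k : nat) : 0 < delta -> 0 < K ->
  K * batch_const R M p <= delta * expR (N%:R * (q - 2)) ->
  \sum_(J < N + k) (batch_size M p J)%:R * ln (1 + K / batch_radius h M p delta J) <=
  \sum_(J < N) (batch_size M p J)%:R * (1 + (N%:R - J%:R) * (q - 2)) +
  (2 * (batch_size M p N)%:R + 2 * p%:R).
Proof.
move=> d0 K0 HK; have c0 := batch_const_gt0 R M p.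
have e0 J := batch_radius_gt0 h M p d0 J.
have b0 J : 0 < 1 + K / batch_radius h M p delta J by rewrite ltr_pwDl// divr_ge0// ltW.
have radius_le J : K / batch_radius h M p delta J <= expR ((N%:R - J%:R) * (q - 2)).
  rewrite /batch_radius ler_pdivrMr ?divr_gt0 ?mulr_gt0 ?expR_gt0// mulrA ler_pdivlMr//.
  rewrite [leRHS]mulrCA -expRD -mulrDl subrK.
  exact: HK.
rewrite big_split_ord/=; apply: lerD.
  apply: ler_sum => J _; apply: ler_wpM2l => //.
  have NJ : 0 <= (N%:R - J%:R) * (q - 2).
    by apply: mulr_ge0 => //; rewrite subr_ge0 ler_nat ltnW.
  apply: le_trans (ln1DexpR_le NJ).
  have e1 : 0 < 1 + expR ((N%:R - J%:R) * (q - 2)) by rewrite addr_gt0 ?expR_gt0.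
  by rewrite ler_ln ?posrE// lerD2l.
apply: le_trans (@sum_linear_geometric R (batch_size M p N)%:R p%:R k _ _) => //.
apply: ler_sum => J _.
have -> : (batch_size M p (N + J))%:R = (batch_size M p N)%:R + p%:R * J%:R :> R.
  by rewrite -natrM -natrD; congr (_%:R); rewrite /batch_size; lia.
apply: ler_wpM2l; first by rewrite addr_ge0 ?mulr_ge0.
apply: (le_trans (le_ln1Dx _)); first by rewrite (lt_le_trans _ (ltW (divr_gt0 K0 (e0 _)))).
apply: (le_trans (radius_le _)); rewrite natrD.
have -> : (N%:R - (N%:R + J%:R)) * (q - 2) = - (q - 2) * J%:R by ring.
rewrite expRM_natr; apply: lerXn2r; rewrite ?nnegrE ?expR_ge0 ?invr_ge0//.
rewrite expRN lef_pV2 ?posrE ?expR_gt0//.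
have : expR (1 + 1) <= expR (q - 2) by rewrite ler_expR.
have := expR_ge1Dx (1 : R); rewrite (expRD 1 1).
by move: (expR 1) (expR (q - 2)) => a b; nra.
Qed.

(** The leading term is the sum of [p J (N - J) (q - 2)], about [p (q - 2) N^3 / 6]; the rest is
    quadratic in [N]. *)
Lemma batch_exponent_le (N : nat) : (0 < N)%N ->
  \sum_(J < N) (batch_size M p J)%:R * (1 + (N%:R - J%:R) * (q - 2)) +
  (2 * (batch_size M p N)%:R + 2 * p%:R) <=
  p%:R * (q - 2) / 6 * N%:R ^+ 3 +
  ((2 * M + 1 + p)%:R * (q + 1) + 5 * p%:R) * N%:R ^+ 2.
Proof.
move=> N0; have sizeE J : (batch_size M p J)%:R = (2 * M + 1 + p)%:R + p%:R * J%:R :> R.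
  by rewrite -natrM -natrD; congr (_%:R); rewrite /batch_size; lia.
have a1 : 0 <= (2 * M + 1 + p)%:R :> R by [].
have p0 : 0 <= p%:R :> R by [].
have closed (x : R) n : \sum_(J < n) (batch_size M p J)%:R * (1 + (x - J%:R) * (q - 2)) =
   (2 * M + 1 + p)%:R * n%:R * (1 + x * (q - 2)) +
   (p%:R * (1 + x * (q - 2)) - (2 * M + 1 + p)%:R * (q - 2)) * (n%:R * (n%:R - 1) / 2) -
   p%:R * (q - 2) * (n%:R * (n%:R - 1) * (2 * n%:R - 1) / 6).
  elim: n => [|n IH]; first by rewrite big_ord0; ring.
  have nS : n.+1%:R = n%:R + 1 :> R by rewrite -addn1 natrD.
  rewrite big_ord_recr/= IH sizeE nS; move: (2 * M + 1 + p)%:R => a; by field.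
rewrite closed sizeE.
have N1 : 1 <= N%:R :> R by rewrite ler1n.
move: (2 * M + 1 + p)%:R (p%:R) (N%:R) a1 p0 N1 => a r n a1 r0 n1.
have n2 : 0 <= n ^+ 2 - n by rewrite expr2; nra.
have ar := mulr_ge0 a1 n2.
have n21 : 0 <= n ^+ 2 - 1 by nra.
have aq : 0 <= a * (q - 2) * (n ^+ 2 - n) by rewrite !mulr_ge0.
have rn : 0 <= r * (n ^+ 2 - n) by rewrite mulr_ge0.
have rn1 : 0 <= r * (n ^+ 2 - 1) by rewrite mulr_ge0.
have an1 : 0 <= a * (n ^+ 2 - 1) by rewrite mulr_ge0.
have rq : 0 <= r * (q - 2) * n by rewrite !mulr_ge0//; apply: le_trans n1.
have rN : 0 <= r * n ^+ 2 by rewrite mulr_ge0// sqr_ge0.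
move: (batch_gain h M) q20 aq rq => g g0 aq rq; lra.
Qed.

End batch_exponent.

Lemma cubic_eventually_le (R : realType) (a b g D c : R) :
  0 <= a -> 0 <= b -> 0 <= g -> 0 <= D -> a * b ^+ 3 < c ->
  exists L0 : R, forall L N, L0 <= L -> 0 <= N -> N <= b * L + g ->
    a * N ^+ 3 + D * N ^+ 2 <= c * L ^+ 3.
Proof.
move=> a0 b0 g0 D0 abc.
(* For [L >= 1] each term of lower order is at most its coefficient times [L ^+ 2]; [W] adds up
   these coefficients. *)
pose W := a * (3 * b ^+ 2 * g + 3 * b * g ^+ 2 + g ^+ 3) + D * (b + g) ^+ 2.
exists (Num.max 1 (W / (c - a * b ^+ 3))) => L N; rewrite ge_max => /andP[L1 WL] N0 NL.
have L0 : 0 <= L by lra.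
have NL' : N <= (b + g) * L.
  by rewrite mulrDl; apply: (le_trans NL); rewrite lerD2l ler_peMr.
have cc : 0 < c - a * b ^+ 3 by rewrite subr_gt0.
have WL' : W * L ^+ 2 <= (c - a * b ^+ 3) * L ^+ 3.
  rewrite [L ^+ 3]exprS [leRHS]mulrA ler_wpM2r ?sqr_ge0// mulrC.
  by move: WL; rewrite ler_pdivrMr.
have N3 : N ^+ 3 <= (b * L + g) ^+ 3.
  by apply: lerXn2r; rewrite ?nnegrE ?addr_ge0 ?mulr_ge0.
have N2 : N ^+ 2 <= (b + g) ^+ 2 * L ^+ 2.
  by rewrite -exprMn; apply: lerXn2r; rewrite ?nnegrE ?mulr_ge0 ?addr_ge0.
have L12 : L <= L ^+ 2 by rewrite expr2 ler_peMr.
have L02 : 1 <= L ^+ 2 by lra.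
have B3 : (b * L + g) ^+ 3 <= b ^+ 3 * L ^+ 3 +
   (3 * b ^+ 2 * g + 3 * b * g ^+ 2 + g ^+ 3) * L ^+ 2.
  have : 3 * b * g ^+ 2 * L <= 3 * b * g ^+ 2 * L ^+ 2.
    by rewrite ler_wpM2l ?mulr_ge0 ?sqr_ge0.
  have : g ^+ 3 * 1 <= g ^+ 3 * L ^+ 2 by rewrite ler_wpM2l ?exprn_ge0.
  by move=> H1 H2; lra.
have := ler_wpM2l a0 (le_trans N3 B3); have := ler_wpM2l D0 N2.
move: WL'; rewrite /W; lra.
Qed.

Section lower_bound.
Variables (R : realType) (d : measure_display) (T : measurableType d).
Variables (P : probability T R) (B X : R -> {RV P >-> R}).
Hypotheses (hB : standard_brownian_motion B) (hX : laplace_wiener_process B X).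

(** The length of [s] becomes the number of grid cells, hence the demand for arbitrarily long lists
    that share one lower bound [c]. *)
Lemma small_ball_prob_ge_seq (c delta : R) : 0 < delta ->
  (forall n : nat, exists s : seq (R * R),
    [/\ (n < size s)%N, all (fun a => (0 < a.1) && (0 <= a.2)) s,
        uniq [seq a.1 | a <- s],
        (forall y, 1 <= y -> expR 1 / Num.sqrt y * slab_cost y s <= delta) &
        (c%:E <= \prod_(a <- s) gauss [set x : R | (`|x| <= a.2)%R])%E]) ->
  (c%:E <= small_ball_prob X (delta + delta))%E.
Proof.
move=> d0 H; apply: (small_ball_prob_ge_grid hX hB d0) => n u u0 n0.
have [s [ns s0 us cs ps]] := H n0.
exists (size s) => //; apply: (le_trans ps).
rewrite (big_nth (1, 0)) big_mkord.
have nth0 i : (0 < (nth (1, 0) s i).1) /\ (0 <= (nth (1, 0) s i).2).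
  have [si|si] := leqP (size s) i; first by rewrite nth_default.
  by have /allP/(_ _ (mem_nth (1, 0) si))/andP[] := s0.
apply: (grid_laplace_ge hB (tau := fun i => (nth (1, 0) s i).1)
   (e := fun i => (nth (1, 0) s i).2)) => //.
- exact: leq_ltn_trans ns.
- by move=> i; exact: (nth0 i).1.
- move=> i j ij js; rewrite -!(nth_map _ (1 : R) fst)//; last exact: ltn_trans js.
  by rewrite nth_uniq ?size_map// ?(ltn_trans ij js)// ltn_eqF.
- by move=> j; exact: (nth0 j).2.
move=> y y1; have := cs y y1; rewrite slab_costE mulr_sumr.
by under eq_bigr do rewrite mulrA.
Qed.

Lemma small_ball_prob_ge_batches (h : R) (M p : nat) : 0 < h ->
  4 <= batch_gain h M -> 2 * batch_gain h M <= p%:R * h ->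
  exists C D : R, [/\ 0 < C, 0 <= D & forall (delta : R) (N : nat),
    0 < delta -> (0 < N)%N -> C <= delta * expR (N%:R * (batch_gain h M - 2)) ->
    ((expR (- (p%:R * (batch_gain h M - 2) / 6 * N%:R ^+ 3 + D * N%:R ^+ 2)))%:E <=
     small_ball_prob X (delta + delta))%E].
Proof.
move=> h0 q4 hp; have [K K0 HK] := gauss_itv_ge R.
exists (K * batch_const R M p), ((2 * M + 1 + p)%:R * (batch_gain h M + 1) + 5 * p%:R).
split.
- by rewrite mulr_gt0 ?batch_const_gt0.
- rewrite addr_ge0 ?mulr_ge0//; move: (batch_gain h M) q4 => g; lra.
move=> delta N d0 N0 HN; apply: small_ball_prob_ge_seq => // n.
exists (batches h M p delta (N + n.+1)); split.
- by apply: leq_trans (size_batches h M p delta _); rewrite addnS ltnS leq_addl.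
- exact: batches_gt0.
- exact: uniq_batches.
- by move=> y y1; exact: batches_cost_le.
apply: le_trans (gauss_batches_ge h M p (N + n.+1) d0 K0 HK).
rewrite lee_fin ler_expR lerN2.
apply: (le_trans (batch_log_sum_le _ _ d0 K0 HN)) => //.
exact: batch_exponent_le.
Qed.

End lower_bound.

(** The comparison behind [batch_parameters], multiplied out: [(2 a + u) / (6 (a - u)^2)] stays
    below [1 / (3 a) + eta], where [u] bounds the errors in [p h^2] and [(q - 2) h]. *)
Lemma cubic_slack (R : realType) (a u eta : R) : 2 <= a -> 0 < u -> u <= 2^-1 ->
  u <= eta * a / 4 -> 0 < eta ->
  3 * a * (2 * a + u) < (1 + 3 * a * eta) * (6 * (a - u) ^+ 2).
Proof.
move=> a2 u0 u1 u2 eta0.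
have au0 : 0 <= a * u by rewrite mulr_ge0 ?(ltW u0)//; lra.
have ae : 0 < a * eta by rewrite mulr_gt0//; lra.
have H1 : a * u <= eta * a ^+ 2 / 4 by rewrite expr2; nra.
have H2 : 2 * (eta * a ^+ 2) <= eta * a ^+ 3.
  have : 0 <= (a - 2) * (eta * a ^+ 2) by rewrite mulr_ge0 ?mulr_ge0 ?sqr_ge0 ?(ltW eta0)//; lra.
  by rewrite !exprS expr0; lra.
have H3 : a * u * (a * eta) * 4 <= eta * a ^+ 3.
  have : 0 <= (a - 4 * u) * (a ^+ 2 * eta) by rewrite mulr_ge0 ?mulr_ge0 ?sqr_ge0 ?(ltW eta0)//; lra.
  by rewrite !exprS expr0; lra.
have H4 : 0 < eta * a ^+ 3 by rewrite mulr_gt0 ?exprn_gt0//; lra.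
have H5 : 0 <= u ^+ 2 * (1 + 3 * (a * eta)) by rewrite mulr_ge0 ?sqr_ge0//; lra.
move: H1 H2 H3 H4 H5; rewrite !exprS !expr0 !mulr1.
move: (a) (u) (eta) => A U E H1 H2 H3 H4 H5; lra.
Qed.

(** Put [a = pi ^+ 2 / 2]. The gain has [q h] close to [a], and [p] is taken close to [2 q / h], so
    [p h^2] is close to [2 a]. As about [L / (q - 2)] batches are used, the cubic coefficient is
    [p / (6 (q - 2)^2)], close to [2 a / (6 a^2) = 2 / (3 pi^2)]. *)
Lemma batch_parameters (R : realType) (eta : R) : 0 < eta ->
  exists (h : R) (M p : nat),
    [/\ 0 < h, 4 <= batch_gain h M, 2 * batch_gain h M <= p%:R * h &
     p%:R * (batch_gain h M - 2) / 6 * (batch_gain h M - 2)^-1 ^+ 3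
       < 2 / (3 * pi ^+ 2) + eta].
Proof.
move=> eta0; pose a : R := pi ^+ 2 / 2.
have pi2 := pi_ge2 R.
have a2 : 2 <= a by rewrite /a ler_pdivlMr// expr2; have := ler_pM _ _ pi2 pi2; lra.
pose u := Num.min (2^-1) (eta * a / 4).
have u0 : 0 < u by rewrite lt_min invr_gt0 ltr0n/= divr_gt0// mulr_gt0//; lra.
have u1 : u <= 2^-1 by rewrite ge_min lexx.
have u2 : u <= eta * a / 4 by rewrite ge_min lexx orbT.
have u20 : 0 < u / 2 by lra.
have [h0 h00 Hh] := log_ratio_sum_ge u20.
pose h := Num.min (h0 / 2) (u / 4).
have hp : 0 < h by rewrite lt_min; apply/andP; split; lra.
have hh0 : h < h0.
  have : h <= h0 / 2 by rewrite ge_min lexx.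
  lra.
have hu : h <= u / 4 by rewrite ge_min lexx orbT.
have [M HM] := Hh h ltac:(by rewrite hp hh0).
have := log_ratio_sum_le M hp.
set S := \sum_(m < M) _ in HM * => HS.
have qE : batch_gain h M = 2 * S by [].
pose q := batch_gain h M.
have qh1 : q * h <= a.
  move: HS; rewrite ler_pdivlMr ?mulr_gt0// => HS; rewrite /q qE /a ler_pdivlMr//.
  by apply: le_trans HS; rewrite le_eqVlt; apply/orP; left; apply/eqP; ring.
have qh2 : a - u / 2 <= q * h.
  by move: HM; rewrite -/a /q qE; lra.
have q4 : 4 <= q.
  rewrite -(ler_pM2r hp); apply: le_trans qh2; lra.
exists h, M, (Num.truncn (2 * q / h)).+1; split => //.
  by rewrite -ler_pdivrMr//; apply: ltW; exact: truncnS_gt.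
set p : R := _%:R.
have ph : p * h ^+ 2 <= 2 * a + u.
  have : p <= 2 * q / h + 1.
    rewrite /p -natr1 lerD2r truncn_le// divr_ge0 ?(ltW hp)// mulr_ge0//.
    exact: le_trans q4.
  rewrite -(ler_pM2r (exprn_gt0 2 hp)) => /le_trans; apply.
  have -> : (2 * q / h + 1) * h ^+ 2 = 2 * (q * h) + h ^+ 2 by field; rewrite gt_eqF.
  have : h ^+ 2 <= u by rewrite expr2; nra.
  lra.
rewrite -/q.
have q20 : 0 < q - 2 by lra.
have qq : a - u <= (q - 2) * h by rewrite mulrBl; lra.
have -> : p * (q - 2) / 6 * (q - 2)^-1 ^+ 3 = p * h ^+ 2 / (6 * ((q - 2) * h) ^+ 2).
  by field; rewrite !gt_eqF.
have au : 0 < a - u by lra.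
have -> : 2 / (3 * pi ^+ 2) = (3 * a)^-1 :> R.
  by rewrite /a; move: (pi : R) pi2 => z z2; field; rewrite gt_eqF//; lra.
apply: (@le_lt_trans _ _ ((2 * a + u) / (6 * (a - u) ^+ 2))).
  apply: ler_pM => //; first by rewrite mulr_ge0 ?sqr_ge0.
    by rewrite invr_ge0 mulr_ge0 ?sqr_ge0.
  rewrite lef_pV2 ?posrE ?mulr_gt0 ?exprn_gt0 ?mulr_gt0// ler_pM2l//.
  by apply: lerXn2r; rewrite ?nnegrE ?mulr_ge0// ltW.
rewrite ltr_pdivrMr ?mulr_gt0 ?exprn_gt0//.
have a0 : 0 < 3 * a by lra.
rewrite -(ltr_pM2l a0).
have -> : 3 * a * (((3 * a)^-1 + eta) * (6 * (a - u) ^+ 2)) =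
  (1 + 3 * a * eta) * (6 * (a - u) ^+ 2) by field; rewrite gt_eqF//; lra.
exact: cubic_slack.
Qed.

Section lower_asymptotics.
Variables (R : realType) (d : measure_display) (T : measurableType d).
Variables (P : probability T R) (B X : R -> {RV P >-> R}).
Hypotheses (hB : standard_brownian_motion B) (hX : laplace_wiener_process B X).

Lemma small_ball_prob_lower (eta : R) : 0 < eta ->
  exists L0 : R, forall delta : R, 0 < delta -> L0 <= ln (1 / delta) ->
  ((expR (- ((2 / (3 * pi ^+ 2) + eta) * ln (1 / delta) ^+ 3)))%:E <=
   small_ball_prob X delta)%E.
Proof.
move=> eta0; have [h [M [p [h0 q4 hp hc]]]] := batch_parameters eta0.
have [C [D [C0 D0 H]]] := small_ball_prob_ge_batches hB hX h0 q4 hp.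
move: (batch_gain h M) q4 hp hc H => q q4 hp hc H.
have q20 : 0 < q - 2 by lra.
pose g := `|ln (2 * C)| / (q - 2) + 1.
have g0 : 0 <= g by rewrite addr_ge0// divr_ge0// ltW.
have a0 : 0 <= p%:R * (q - 2) / 6 by rewrite divr_ge0// mulr_ge0// ltW.
have b0 : 0 <= (q - 2)^-1 by rewrite invr_ge0 ltW.
have [L0 HL0] := cubic_eventually_le a0 b0 g0 D0 hc.
exists (Num.max 0 L0) => delta d0; rewrite ge_max; set L := ln _ => /andP[L0' L0L].
have dE : delta / 2 + delta / 2 = delta by lra.
(* Enough batches for [C <= delta / 2 * expR (N (q - 2))], at most one more than that requires once
   [L] is large; halving [delta] anticipates the doubling in the batch bound. *)
pose N := (Num.truncn (Num.max 0 (L + ln (2 * C)) / (q - 2))).+1.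
have := H (delta / 2) N; rewrite dE => HN.
have C2 : 0 < 2 * C by rewrite mulr_gt0.
have K : C <= delta / 2 * expR (N%:R * (q - 2)).
  rewrite mulrAC ler_pdivlMr// mulrC -ler_pdivrMl//.
  have -> : delta^-1 * (2 * C) = expR (L + ln (2 * C)).
    by rewrite expRD /L !lnK ?posrE ?divr_gt0//; field; rewrite gt_eqF.
  rewrite ler_expR -ler_pdivrMr//.
  apply: le_trans (ltW (truncnS_gt _)).
  by rewrite ler_wpM2r ?invr_ge0 ?(ltW q20)// le_max lexx orbT.
apply: le_trans (HN _ _ K) => //; last by lra.
rewrite lee_fin ler_expR lerN2; apply: HL0 => //.
rewrite /N -natr1 /g addrA lerD2r.
apply: (@le_trans _ _ (Num.max 0 (L + ln (2 * C)) / (q - 2))).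
  by rewrite truncn_le// divr_ge0 ?(ltW q20)// le_max lexx.
rewrite [(q - 2)^-1 * L]mulrC -mulrDl ler_wpM2r ?invr_ge0 ?(ltW q20)// ge_max addr_ge0//=.
by rewrite lerD2l ler_norm.
Qed.

End lower_asymptotics.

(** * Upper bound: frequencies along a square-root sequence *)

Section square_root_grid.
Variable R : realType.

Definition sqrtS (i : nat) : R := Num.sqrt i.+1%:R.

Lemma sqrtS_gt0 i : 0 < sqrtS i.
Proof. by rewrite sqrtr_gt0 ltr0n. Qed.

Lemma sqr_sqrtS i : sqrtS i ^+ 2 = i.+1%:R.
Proof. by rewrite sqr_sqrtr. Qed.

Lemma ltr_sqrtS i j : (i < j)%N -> sqrtS i < sqrtS j.
Proof. by move=> ij; rewrite ltr_sqrt ?ltr0n// ltr_nat. Qed.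

(** Comparison with the integral of the square root; the induction step is
    [2 (b^3 - a^3) <= 3 b (b^2 - a^2)] with [b^2 = a^2 + 1]. *)
Lemma sum_sqrtS_ge n : 2 / 3 * Num.sqrt n%:R ^+ 3 <= \sum_(i < n) sqrtS i.
Proof.
elim: n => [|n IH]; first by rewrite big_ord0 sqrtr0 expr0n mulr0.
rewrite big_ord_recr/=; apply: le_trans (lerD IH (lexx _)).
have nS : n.+1%:R = n%:R + 1 :> R by rewrite -addn1 natrD.
have a2 : Num.sqrt n%:R ^+ 2 = n%:R :> R by rewrite sqr_sqrtr.
have b2 := sqr_sqrtS n; rewrite nS -a2 in b2.
have b0 := sqrtS_gt0 n; rewrite -/(sqrtS n).
have a0 : 0 <= Num.sqrt n%:R :> R by exact: sqrtr_ge0.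
move: (Num.sqrt n%:R) (sqrtS n) a0 b0 b2 => a b a0 b0 b2.
have ab : a <= b.
  rewrite leNgt; apply/negP => ba; have : b ^+ 2 < a ^+ 2 by rewrite ltr_pXn2r ?nnegrE// ltW.
  lra.
have : 0 <= (b - a) * ((b - a) * (2 * a + b)).
  by rewrite !mulr_ge0 ?subr_ge0// addr_ge0 ?mulr_ge0// ltW.
have -> : (b - a) * ((b - a) * (2 * a + b)) =
  3 * b * (b ^+ 2 - a ^+ 2) - 2 * (b ^+ 3 - a ^+ 3) by ring.
by rewrite b2; lra.
Qed.

(** The optimal slope. With [k] in place of [c], point [i] yields about [expR (- ((k / 2 - pi ^+ 2 /
    (2 * k)) * sqrtS i))] and about [(2 L / k)^2] points fit, so the exponent is
    [8 / 3 (k^-2 - pi^2 k^-4) L^3], which is largest at [k^2 = 2 pi^2]. *)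
Definition grid_slope : R := Num.sqrt 2 * pi.
Local Notation c := grid_slope.

Lemma grid_slope_gt0 : 0 < c.
Proof. by rewrite mulr_gt0 ?sqrtr_gt0 ?pi_gt0. Qed.

Lemma sqr_grid_slope : c ^+ 2 = 2 * pi ^+ 2.
Proof. by rewrite exprMn sqr_sqrtr. Qed.

Definition grid_time (L : R) (i : nat) : R := expR (2 * L - c * sqrtS i).

Lemma grid_time_gt0 L i : 0 < grid_time L i.
Proof. exact: expR_gt0. Qed.

Lemma grid_time_inj L i j : (i < j)%N -> grid_time L i != grid_time L j.
Proof.
move=> ij; apply/negP => /eqP/expR_inj/addrI/oppr_inj/(mulfI (lt0r_neq0 grid_slope_gt0)).
by have := ltr_sqrtS ij; move=> /[swap] ->; rewrite ltxx.
Qed.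

(** By concavity of the square root, point [l] is at logarithmic distance at least [(i - l) h] from
    point [i], with [h = c / (2 * sqrtS i)] the local spacing. The bound [pi ^+ 2 / (4 * h)] for
    equal spacing equals [c / 4 * sqrtS i], because [pi ^+ 2 = c ^+ 2 / 2]. *)
Lemma grid_time_prod_ge L i :
  expR (- (c / 4 * sqrtS i)) <=
  \prod_(l < i) blaschke (grid_time L l) (grid_time L i).
Proof.
have c0 := grid_slope_gt0; have s0 := sqrtS_gt0 i.
pose h := c / (2 * sqrtS i).
have h0 : 0 < h by apply: divr_gt0 => //; apply: mulr_gt0.
apply: (@le_trans _ _ (\prod_(l < i) expR (- log_ratio (expR (- (l.+1%:R * h)))))).
  rewrite -expR_sum sumrN ler_expR lerN2; apply: (le_trans (log_ratio_sum_le _ h0)).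
  rewrite /h (_ : pi ^+ 2 = c ^+ 2 / 2); last by rewrite sqr_grid_slope mulrC mulKf.
  by move: c c0 => k k0; rewrite le_eqVlt; apply/orP; left; apply/eqP; field; rewrite !gt_eqF.
rewrite (reindex_inj rev_ord_inj)/=; apply: ler_prod => l _; rewrite expR_ge0/=.
apply: blaschke_exp_ge_log_ratio; first by rewrite mulr_gt0// ltr0n.
have li : sqrtS l <= sqrtS i by apply: ltW; exact: ltr_sqrtS.
have -> : 2 * L - c * sqrtS i - (2 * L - c * sqrtS l) = - (c * (sqrtS i - sqrtS l)) by ring.
rewrite normrN ger0_norm; last by rewrite mulr_ge0 ?subr_ge0 ?(ltW c0).
have -> : (i - l.+1).+1%:R = sqrtS i ^+ 2 - sqrtS l ^+ 2.
  by rewrite !sqr_sqrtS -natrB ?ltnS 1?ltnW//; congr (_%:R); have := ltn_ord l; lia.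
rewrite /h mulrCA ler_wpM2l ?(ltW c0)// ler_pdivrMr ?mulr_gt0// subr_sqr.
by rewrite ler_wpM2l ?subr_ge0//; lra.
Qed.

End square_root_grid.

Section upper_bound.
Variables (R : realType) (d : measure_display) (T : measurableType d).
Variables (P : probability T R) (B X : R -> {RV P >-> R}).
Hypotheses (hB : standard_brownian_motion B) (hX : laplace_wiener_process B X).
Local Notation c := (@grid_slope R).

(** [delta] cancels the [2 * L] in [grid_time]: [delta * Num.sqrt (2 * grid_time L i)] is at most
    [2 * expR (- (c / 2 * sqrtS i))], and half of this exponent is lost to the product of [blaschke]
    factors. *)
Lemma small_ball_prob_le_grid (n : nat) (delta : R) : 0 < delta ->
  let L := ln (1 / delta) in
  \sum_(i < n) fine (gauss_moment2 R) *
    (expR (- (2 * grid_time L i)) / (2 * grid_time L i)) / (delta + delta) ^+ 2 <= 2^-1 ->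
  (small_ball_prob X delta <=
   (2 * 32 ^+ n * expR (- (c / 6 * Num.sqrt n%:R ^+ 3)))%:E)%E.
Proof.
move=> d0 L Hs.
apply: (le_trans (small_ball_prob_le_prod hB hX (grid_time_gt0 L) (@grid_time_inj R L) d0 Hs)).
have c0 := grid_slope_gt0 R.
rewrite lee_fin -mulrA ler_pM2l//.
apply: (@le_trans _ _ (\prod_(i < n) (32 * expR (- (c / 4 * sqrtS R i))))).
  apply: ler_prod => i _.
  have b0 : 0 < \prod_(l < i) blaschke (grid_time L l) (grid_time L i).
    exact: lt_le_trans (expR_gt0 _) (grid_time_prod_ge L i).
  rewrite divr_ge0 ?(ltW b0) ?mulr_ge0 ?sqrtr_ge0 ?(ltW d0)//= ler_pdivrMr//.
  apply: (@le_trans _ _ (32 * expR (- (c / 4 * sqrtS R i)) * expR (- (c / 4 * sqrtS R i)))).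
    rewrite -[leRHS]mulrA -expRD.
    have tE : Num.sqrt (2 * grid_time L i) <= 2 * expR (L - c / 2 * sqrtS R i).
      have -> : grid_time L i = expR (L - c / 2 * sqrtS R i) ^+ 2.
        by rewrite -expRM_natr /grid_time; congr expR; field.
      rewrite sqrtrM// sqrtr_sqr ger0_norm ?expR_ge0// ler_wpM2r ?expR_ge0//.
      by rewrite -[leRHS]ger0_norm// -sqrtr_sqr ler_sqrt// expr2; lra.
    apply: (le_trans (ler_wpM2l _ tE)); first by rewrite mulr_ge0// ltW.
    have dE : delta = expR (- L) by rewrite expRN /L lnK ?posrE ?divr_gt0// invf_div divr1.
    rewrite [X in 16 * X]dE.
    have -> : 16 * expR (- L) * (2 * expR (L - c / 2 * sqrtS R i)) =
      32 * (expR (- L) * expR (L - c / 2 * sqrtS R i)) by ring.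
    by rewrite -expRD le_eqVlt; apply/orP; left; apply/eqP; congr (_ * expR _); field.
  by rewrite ler_wpM2l ?mulr_ge0 ?expR_ge0// grid_time_prod_ge.
rewrite big_split/= prodr_const card_ord ler_wpM2l ?exprn_ge0//.
rewrite -expR_sum sumrN ler_expR lerN2 -mulr_sumr.
have := ler_wpM2l (ltW (divr_gt0 c0 (ltr0n R 4))) (sum_sqrtS_ge R n).
by apply: le_trans; rewrite le_eqVlt; apply/orP; left; apply/eqP; move: c c0 => k k0; field.
Qed.

End upper_bound.

Section upper_asymptotics.
Variables (R : realType) (d : measure_display) (T : measurableType d).
Variables (P : probability T R) (B X : R -> {RV P >-> R}).
Hypotheses (hB : standard_brownian_motion B) (hX : laplace_wiener_process B X).
Local Notation c := (@grid_slope R).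

Let expR_ge_sqr (x : R) : 0 <= x -> x ^+ 2 / 2 <= expR x.
Proof.
move=> x0; have := @expR_ge1Dxn R x 1 x0; rewrite (_ : 2`!%:R = 2 :> R)//.
by move: (x ^+ 2 / 2) => y; lra.
Qed.

Let slope_ge2 : 2 <= c.
Proof.
rewrite -(@ler_pXn2r _ 2) ?nnegrE ?(ltW (grid_slope_gt0 R))// sqr_grid_slope.
by have := pi_ge2 R; move: (pi : R) => x x2; nra.
Qed.

(* All the frequencies are at least [2 L], so that the Brownian motion after
   time [1] contributes at most [delta]. *)
Lemma grid_time_tail_le (delta eps : R) (n : nat) : 0 < delta -> 0 < eps ->
  let L := ln (1 / delta) in
  1 <= L -> eps ^- 2 <= L -> fine (gauss_moment2 R) <= L ->
  c * Num.sqrt n%:R <= (2 - 2 * eps) * L ->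
  \sum_(i < n) fine (gauss_moment2 R) *
    (expR (- (2 * grid_time L i)) / (2 * grid_time L i)) / (delta + delta) ^+ 2 <= 2^-1.
Proof.
move=> d0 e0 L L1 Le Lm cn.
have L0 : 0 < L by lra.
have m0 : 0 <= fine (gauss_moment2 R) by rewrite fine_ge0// gauss_moment2_ge0.
have dE : delta = expR (- L) by rewrite expRN /L lnK ?posrE ?divr_gt0// invf_div divr1.
have tL (i : 'I_n) : 2 * L <= grid_time L i.
  have si : c * sqrtS R i <= c * Num.sqrt n%:R.
    by rewrite ler_wpM2l ?(ltW (grid_slope_gt0 R))// ler_wsqrtr// ler_nat.
  (* The quadratic Taylor term of this exponential already exceeds [2 * L], once [eps ^- 2 <= L]. *)
  apply: (@le_trans _ _ (expR (2 * eps * L))); last by rewrite ler_expR; lra.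
  have eL0 : 0 <= 2 * eps * L by rewrite !mulr_ge0 ?ltW.
  apply: le_trans (expR_ge_sqr eL0).
  have -> : (2 * eps * L) ^+ 2 / 2 = 2 * L * (eps ^+ 2 * L) by field.
  by rewrite ler_peMr ?mulr_ge0 ?(ltW L0)// mulrC -ler_pdivrMr ?exprn_gt0// div1r.
have n2 : n%:R <= L ^+ 2.
  have : Num.sqrt n%:R <= L.
    rewrite -(ler_pM2l (grid_slope_gt0 R)); apply: (le_trans cn).
    by rewrite ler_wpM2r ?(ltW L0)//; have := slope_ge2; lra.
  move=> H; rewrite -[leLHS]sqr_sqrtr// lerXn2r ?nnegrE ?sqrtr_ge0// ltW//.
have term (i : 'I_n) : fine (gauss_moment2 R) *
    (expR (- (2 * grid_time L i)) / (2 * grid_time L i)) / (delta + delta) ^+ 2 <=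
    fine (gauss_moment2 R) * expR (- (2 * L)) / 8.
  rewrite -[leRHS]mulrA -mulrA ler_wpM2l//.
  have t0 := grid_time_gt0 L i.
  (* The decay to [expR (- (4 * L))] outweighs the division by [(delta + delta) ^+ 2]; what is left,
     [expR (- (2 * L)) / 8], is summed over at most [L ^+ 2] points. *)
  have h1 : expR (- (2 * grid_time L i)) <= expR (- L) ^+ 4.
    by rewrite -expRM_natr ler_expR; have := tL i; lra.
  have h2 : (2 * grid_time L i)^-1 <= 2^-1.
    by rewrite lef_pV2 ?posrE ?mulr_gt0//; have := tL i; lra.
  rewrite ler_pdivrMr ?exprn_gt0 ?addr_gt0//.
  apply: (le_trans (ler_pM (expR_ge0 _) _ h1 h2)); first by rewrite invr_ge0 mulr_ge0// ltW.
  rewrite dE (_ : - (2 * L) = - L * 2%:R); last by ring.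
  rewrite expRM_natr le_eqVlt; apply/orP; left; apply/eqP.
  by move: (expR (- L)) => e; field.
apply: (le_trans (ler_sum _ (fun i _ => term i))).
rewrite sumr_const card_ord -[_ *+ n]mulr_natr.
have e2 : L ^+ 2 * expR (- (2 * L)) <= 2 / L.
  have x0 := expR_gt0 L.
  have -> : expR (- (2 * L)) = (expR L * expR L)^-1 by rewrite -expRD -expRN; congr expR; ring.
  rewrite ler_pdivrMr ?mulr_gt0// mulrAC ler_pdivlMr//.
  have h1 := expR_ge_sqr (ltW L0).
  have h2 : L <= expR L by have := expR_ge1Dx L; lra.
  have := ler_pM _ _ h1 h2; rewrite divr_ge0 ?sqr_ge0 ?(ltW L0)// => /(_ erefl erefl).
  by lra.
have h : fine (gauss_moment2 R) * (n%:R * expR (- (2 * L))) <= L * (2 / L).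
  apply: ler_pM => //.
  by apply: le_trans e2; rewrite ler_wpM2r ?expR_ge0.
have LL : L * (2 / L) = 2 by field; rewrite gt_eqF.
rewrite LL in h.
have -> : fine (gauss_moment2 R) * expR (- (2 * L)) / 8 * n%:R =
  fine (gauss_moment2 R) * (n%:R * expR (- (2 * L))) / 8 by ring.
lra.
Qed.

(** The [eps] in [b] keeps the lowest frequency above [2 * L]; it multiplies the constant by
    [(1 - eps) ^+ 3], a loss below [eta] because [4 / (3 * c ^+ 2) <= 3^-1] and [eps <= eta]. The
    factor [32 ^+ n] contributes only order [L ^+ 2] to the exponent. *)
Lemma small_ball_prob_upper (eta : R) : 0 < eta ->
  exists L0 : R, forall delta : R, 0 < delta -> L0 <= ln (1 / delta) ->
  (small_ball_prob X delta <=
   (expR (- ((2 / (3 * pi ^+ 2) - eta) * ln (1 / delta) ^+ 3)))%:E)%E.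
Proof.
move=> eta0; have c0 := grid_slope_gt0 R; have c2 := slope_ge2.
pose eps := Num.min (2^-1) eta.
have e0 : 0 < eps by rewrite lt_min invr_gt0 ltr0n.
have e1 : eps <= 2^-1 by rewrite ge_min lexx.
have e2 : eps <= eta by rewrite ge_min lexx orbT.
pose b := (2 - 2 * eps) / c.
have b0 : 0 < b by rewrite divr_gt0//; lra.
have piE : 2 / (3 * pi ^+ 2) = 4 / (3 * c ^+ 2) :> R.
  rewrite sqr_grid_slope; have := pi_gt0 R; move: (pi : R) => x x0.
  by field; rewrite gt_eqF.
have gap : 2 / (3 * pi ^+ 2) - eta < c / 6 * b ^+ 3.
  have -> : c / 6 * b ^+ 3 = 4 / (3 * c ^+ 2) * (1 - eps) ^+ 3.
    rewrite /b; move: c c0 => k k0; field; rewrite gt_eqF//.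
  have cc : 0 < 3 * c ^+ 2 by apply: mulr_gt0 => //; exact: exprn_gt0.
  have k1 : 4 / (3 * c ^+ 2) <= 3^-1.
    have c4 : 4 <= c ^+ 2 by move: c c2 => k k2; nra.
    by rewrite ler_pdivrMr// mulKf.
  have k0 : 0 < 4 / (3 * c ^+ 2) by exact: divr_gt0.
  rewrite piE; move: (4 / _) k0 k1 => k k0 k1.
  have : 1 - 3 * eps < (1 - eps) ^+ 3.
    have : 0 < eps ^+ 2 * (3 - eps) by rewrite mulr_gt0 ?exprn_gt0//; lra.
    by rewrite !exprS expr0; lra.
  rewrite -(ltr_pM2l k0); have : 0 <= (3^-1 - k) * eps.
    by apply: mulr_ge0; [rewrite subr_ge0|exact: ltW].
  move: ((1 - eps) ^+ 3) => e; lra.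
pose W := c / 6 * (3 * b ^+ 2 + 3 * b + 1) + (b ^+ 2 * ln 32 + ln 2).
pose g := c / 6 * b ^+ 3 - (2 / (3 * pi ^+ 2) - eta).
have g0 : 0 < g by rewrite subr_gt0.
exists (Num.max 1 (Num.max (eps ^- 2) (Num.max (fine (gauss_moment2 R)) (W / g)))).
move=> delta d0; set L := ln _; rewrite !ge_max => /and4P[L1 Le Lm LW].
have L0 : 0 < L by lra.
pose n := Num.truncn ((b * L) ^+ 2).
have bL0 : 0 <= b * L by rewrite mulr_ge0 ?ltW.
have nb : n%:R <= (b * L) ^+ 2 by rewrite truncn_le// sqr_ge0.
have bn : (b * L) ^+ 2 < n%:R + 1 by have := truncnS_gt ((b * L) ^+ 2); rewrite -natr1.
pose w : R := Num.sqrt n%:R.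
have w0 : 0 <= w by exact: sqrtr_ge0.
have w2 : w ^+ 2 = n%:R by rewrite sqr_sqrtr.
have wb : w <= b * L.
  by rewrite -(@ler_pXn2r _ 2) ?nnegrE// w2.
have bw : b * L <= w + 1.
  rewrite -(@ler_pXn2r _ 2) ?nnegrE ?addr_ge0//; apply: (le_trans (ltW bn)).
  by rewrite -w2 sqrrD1; lra.
have cn : c * w <= (2 - 2 * eps) * L.
  have -> : (2 - 2 * eps) * L = c * (b * L) by rewrite /b; field; rewrite gt_eqF.
  by rewrite ler_pM2l.
apply: (le_trans (small_ball_prob_le_grid hB hX d0 (grid_time_tail_le d0 e0 L1 Le Lm cn))).
rewrite lee_fin -/w.
have -> : 2 * 32 ^+ n * expR (- (c / 6 * w ^+ 3)) =
    expR (ln 2 + n%:R * ln 32 - c / 6 * w ^+ 3).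
  by rewrite !expRD [n%:R * _]mulrC expRM_natr !lnK ?posrE.
rewrite ler_expR.
have l2 : 0 <= ln 2 :> R by rewrite ln_ge0// ler1n.
have l32 : 0 <= ln 32 :> R by rewrite ln_ge0// ler1n.
have L12 : L <= L ^+ 2 by rewrite expr2 ler_peMr// ltW.
have L02 : 1 <= L ^+ 2 by lra.
have WL : W * L ^+ 2 <= g * L ^+ 3.
  rewrite [L ^+ 3]exprS [leRHS]mulrA ler_wpM2r ?sqr_ge0// mulrC.
  by move: LW; rewrite ler_pdivrMr.
have cub : c / 6 * (b ^+ 3 * L ^+ 3) <= c / 6 * (w ^+ 3) + c / 6 * ((3 * b ^+ 2 + 3 * b + 1) * L ^+ 2).
  rewrite -mulrDr ler_wpM2l ?divr_ge0 ?(ltW c0)// -exprMn.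
  have : (b * L) ^+ 3 <= (w + 1) ^+ 3 by rewrite lerXn2r ?nnegrE ?addr_ge0.
  move/le_trans; apply.
  have -> : (w + 1) ^+ 3 = w ^+ 3 + (3 * w ^+ 2 + 3 * w + 1) by ring.
  have w2b : w ^+ 2 <= (b * L) ^+ 2 by rewrite w2.
  have wbL : w <= b * L ^+ 2 by apply: (le_trans wb); rewrite ler_wpM2l// ltW.
  rewrite lerD2l; move: w2b wbL L02; rewrite exprMn.
  move: (L ^+ 2) (w ^+ 2) => L2 W2; lra.
have nL : n%:R * ln 32 <= b ^+ 2 * ln 32 * L ^+ 2.
  by rewrite mulrAC -exprMn ler_wpM2r.
have lL : ln 2 <= ln 2 * L ^+ 2 :> R by rewrite ler_peMr.
move: WL cub nL lL; rewrite /W /g.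
move: (2 / (3 * pi ^+ 2)) (L ^+ 3) (L ^+ 2) (w ^+ 3) => k L3 L2 w3.
lra.
Qed.

End upper_asymptotics.

(** The lower bound covers small [delta]; larger ones follow by monotonicity. Positivity makes the
    logarithm finite for every positive [delta]. *)
Lemma small_ball_prob_gt0 (R : realType) (d : measure_display) (T : measurableType d)
    (P : probability T R) (B X : R -> {RV P >-> R}) (delta : R) :
  standard_brownian_motion B -> laplace_wiener_process B X -> 0 < delta ->
  (0 < small_ball_prob X delta)%E.
Proof.
move=> hB hX d0; have [L0 HL] := small_ball_prob_lower hB hX (@ltr01 R).
have e0 : 0 < Num.min delta (expR (- L0)) by rewrite lt_min d0 expR_gt0.
apply: (@lt_le_trans _ _ (small_ball_prob X (Num.min delta (expR (- L0))))).
  apply: lt_le_trans (HL _ e0 _); first by rewrite lte_fin expR_gt0.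
  rewrite div1r lnV ?posrE// lerNr -[leRHS]expRK ler_ln ?posrE ?expR_gt0//.
  by rewrite ge_min lexx orbT.
by apply: (small_ball_prob_homo hX); rewrite ge_min lexx.
Qed.

Theorem theorem1p2 (R : realType) (d : measure_display)
    (T : measurableType d) (P : probability T R)
    (B X : R -> {RV P >-> R})
    (hB : standard_brownian_motion B)
    (hX : laplace_wiener_process B X) :
  exists r : R -> R,
    (forall delta : R, 0 < delta < 1 / 4 ->
       lne (small_ball_prob X delta)
       = (- (2 / (3 * pi ^+ 2)) * ln (1 / delta) ^+ 3 + r delta)%:E) /\
    r =o_ (0^'+) (fun delta : R => ln (1 / delta) ^+ 3).
Proof.
pose F delta := fine (small_ball_prob X delta).
have FE delta : small_ball_prob X delta = (F delta)%:E.
  rewrite /F fineK//; apply: fin_num_measure.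
  exact: measurable_sup_path_le hX delta.
have F0 delta : 0 < delta -> 0 < F delta.
  by move=> d0; rewrite -lte_fin -FE; exact: small_ball_prob_gt0 hB hX d0.
pose c : R := 2 / (3 * pi ^+ 2).
(* The remainder is the exact difference, so the formula holds by construction; what remains is the
   two-sided [eps] bound near 0. *)
exists (fun delta => ln (F delta) + c * ln (1 / delta) ^+ 3); split.
  move=> delta /andP[d0 _]; rewrite FE lne_EFin ?F0//; congr (_%:E).
  by rewrite -/c; move: c => k; ring.
apply/eqoP => eps eps0.
have [L1 H1] := small_ball_prob_lower hB hX eps0.
have [L2 H2] := small_ball_prob_upper hB hX eps0.
pose L0 := Num.max 0 (Num.max L1 L2).
near=> delta.
have d0 : 0 < delta by near: delta; exact: nbhs_right_gt.
have dL : delta <= expR (- L0) by near: delta; apply: nbhs_right_le; exact: expR_gt0.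
have : L0 <= ln (1 / delta).
  by rewrite div1r lnV ?posrE// lerNr -[leRHS]expRK ler_ln ?posrE ?expR_gt0.
set L := ln (1 / delta); rewrite !ge_max => /and3P[L00 L10 L20].
have := H1 _ d0 L10; have := H2 _ d0 L20; rewrite !FE !lee_fin -/L -/c => U V.
rewrite ler_norml.
rewrite [`|L ^+ 3|]ger0_norm ?exprn_ge0//.
have lU : ln (F delta) <= - ((c - eps) * L ^+ 3).
  by rewrite -[leRHS]expRK ler_ln ?posrE ?expR_gt0 ?F0.
have lV : - ((c + eps) * L ^+ 3) <= ln (F delta).
  by rewrite -[leLHS]expRK ler_ln ?posrE ?expR_gt0 ?F0.
move: lU lV; move: (ln (F delta)) (L ^+ 3) (c) => f l k lU lV.
by apply/andP; split; lra.
Unshelve. all: by end_near.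
Qed.
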